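(* Let $V$ be a vertex super-algebra. Then there is a bijection between the set of equivalence classes of irreducible $\mathbb{N}$-graded $\phi$-coordinated $V$-modules and the set of isomorphism classes of irreducible $\widetilde{A}(V)$-modules; it is induced by $W\mapsto W[0]$, where each irreducible $\mathbb{N}$-graded $\phi$-coordinated $V$-module $W=\bigoplus_{n\in\mathbb{N}}W[n]$ is normalized (by shifting the grading) so that $W[0]\neq0$, and $v\in V$ acts on $W[0]$ as $v_{[0]}$.
   Context: All vector spaces are over $\mathbb{C}$; $\mathbb{N}=\{0,1,2,\dots\}$. A vertex super-algebra is a $\mathbb{Z}/2$-graded space $V=V_{\bar0}\oplus V_{\bar1}$ with vertex operator map $Y(v,x)=\sum_{n}v_nx^{-n-1}$ and vacuum $\mathbf{1}$ satisfying the usual axioms, with the super Jacobi identity (sign $(-1)^{|u||v|}$). A $\phi$-coordinated $V$-module (for $\phi(x,z)=xe^z$) is a vector space $W$ with a linear map $Y_W(\cdot,x):V\to(\mathrm{End}\,W)[[x,x^{-1}]]$, $Y_W(v,x)=\sum_{n\in\mathbb{Z}}v_{[n]}x^{-n}$, such that $Y_W(v,x)w\in W((x))$ for $v\in V,w\in W$, $Y_W(\mathbf{1},x)=1_W$, and for any $u,v\in V$ there is $k\in\mathbb{N}$ with $(x_1-x_2)^kY_W(u,x_1)Y_W(v,x_2)\in\mathrm{Hom}(W,W((x_1,x_2)))$, where $W((x_1,x_2))=W[[x_1,x_2]][x_1^{-1},x_2^{-1}]$, and $$(e^{x_0}-1)^kY_W(Y(u,x_0)v,x_2)=\left((x_1/x_2-1)^kY_W(u,x_1)Y_W(v,x_2)\right)|_{x_1=x_2e^{x_0}}.$$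 It is $\mathbb{N}$-graded if equipped with a grading $W=\bigoplus_{n\in\mathbb{N}}W[n]$ such that $v_{[m]}W[n]\subset W[n-m]$ for $v\in V$, $m\in\mathbb{Z}$, $n\in\mathbb{N}$ ($W[p]=0$ for $p<0$). Irreducible means nonzero with no graded submodules other than $0$ and itself. Two $\mathbb{N}$-graded $\phi$-coordinated modules $W_1,W_2$ are equivalent if there is an isomorphism $\psi:W_1\to W_2$ of $\phi$-coordinated $V$-modules and a fixed integer $k$ with $\psi(W_1[n])=W_2[n+k]$ for all $n$. $\widetilde{A}(V)=V/\widetilde{O}(V)$, where $\widetilde{O}(V)$ is the linear span of $\mathrm{Res}_x\frac{e^x}{(e^x-1)^2}Y(u,x)v$ for $u,v\in V$; it is an associative algebra with product induced by $u*v=\mathrm{Res}_x\frac{e^x}{e^x-1}Y(u,x)v$ and identity $\mathbf{1}+\widetilde{O}(V)$ (here $1/(e^x-1)$ is the inverse of $e^x-1$ in $\mathbb{C}((x))$). *)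

(* Defs.v *)
From HB Require Import structures.
From mathcomp Require Import all_boot all_order all_algebra.
From mathcomp Require Import ring_quotient.
From mathcomp Require Import boolp classical_sets fsbigop.
From mathcomp Require Export reals complex.

Set Implicit Arguments.
Unset Strict Implicit.
Unset Printing Implicit Defensive.

Import Order.TTheory GRing.Theory Num.Theory.

Local Open Scope classical_set_scope.
Local Open Scope ring_scope.
Local Open Scope quotient_scope.

(* An infinite sum [\sum_(i \in [set: I]) f i] is the finitely supported sum
   of fsbigop. It is only used below where all but finitely many terms vanish
   (by the truncation axioms); it has the value 0 on infinite supports. *)

Section FormalPowerSeries.
Variable F : numFieldType.

(* [s : nat -> F] stands for the series sum_n s_n x^n. *)
Definition fps := nat -> F.

Definition fps1 : fps := fun n => (n == 0%N)%:R.

Definition fps_mul (s t : fps) : fps :=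
  fun n => \sum_(i < n.+1) s i * t (n - i)%N.

Definition fps_exp (s : fps) (k : nat) : fps := iter k (fps_mul s) fps1.

(* The first [n] coefficients of 1/s, from the usual recursion
   t_n = - s_0^{-1} sum_{i < n} s_{n-i} t_i. *)
Fixpoint fps_inv_seq (s : fps) (n : nat) : seq F :=
  if n is m.+1 then
    let t := fps_inv_seq s m in
    rcons t ((s 0%N)^-1 * ((m == 0%N)%:R - \sum_(i < m) s (m - i)%N * t`_i))
  else [::].

Definition fps_inv (s : fps) : fps := fun n => (fps_inv_seq s n.+1)`_n.

Lemma size_fps_inv_seq s n : size (fps_inv_seq s n) = n.
Proof. by elim: n => //= n IHn; rewrite size_rcons IHn. Qed.

Lemma nth_fps_inv_seq s n i : (i < n)%N -> (fps_inv_seq s n)`_i = fps_inv s i.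
Proof.
elim: n => // n IHn; rewrite ltnS leq_eqVlt => /orP[/eqP -> //|lt_in].
by rewrite /= nth_rcons size_fps_inv_seq lt_in IHn.
Qed.

Lemma fps_mulV s : s 0%N != 0 -> fps_mul s (fps_inv s) = fps1.
Proof.
move=> s0; apply/funext => n; rewrite /fps_mul /fps1.
rewrite (reindex_inj rev_ord_inj) /= big_ord_recr /= !subSS subnn.
rewrite {2}/fps_inv /= nth_rcons size_fps_inv_seq subn0 ltnn eqxx mulrA mulfV //.
rewrite mul1r addrC -addrA [X in _ + X](_ : _ = 0) ?addr0 //.
apply/eqP; rewrite addrC subr_eq0; apply/eqP.
apply: eq_bigr => i _; rewrite !subSS subKn 1?ltnW //.
by rewrite nth_fps_inv_seq.
Qed.

(* exp(a x) *)
Definition fps_expo (a : F) : fps := fun n => a ^+ n / n`!%:R.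

(* exp(x) - 1 *)
Definition fps_expm1 : fps := fun n => fps_expo 1 n - fps1 n.

(* (exp(x) - 1) / x, a unit of F[[x]] *)
Definition fps_expm1_divx : fps := fun n => fps_expm1 n.+1.

Lemma fps_expm1_divx0 : fps_expm1_divx 0 != 0.
Proof.
by rewrite /fps_expm1_divx /fps_expm1 /fps_expo /fps1 /= subr0 expr1n divr1 oner_eq0.
Qed.

(* Since exp(x) - 1 = x E(x) with E = fps_expm1_divx, in F((x)) one has
   exp(x) / (exp(x) - 1)^d = x^{-d} exp(x) E(x)^{-d}; [zhu_kernel d] is the
   power series exp(x) E(x)^{-d}. *)
Definition zhu_kernel (d : nat) : fps :=
  fps_mul (fps_expo 1) (fps_exp (fps_inv fps_expm1_divx) d).

(* Generalized binomial coefficient m(m-1)...(m-i+1)/i! for m in Z. *)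
Definition binz (m : int) (i : nat) : F :=
  (\prod_(j < i) (m - j%:Z)%:~R) / i`!%:R.

End FormalPowerSeries.

Section Subspaces.
Variables (F : numFieldType) (L : lmodType F).

Definition subspace (S : set L) : Prop :=
  S 0 /\ forall (a : F) u v, S u -> S v -> S (a *: u + v).

(* L is the internal direct sum of the subspaces S n, n in N. *)
Definition direct_sum (S : nat -> set L) : Prop :=
  [/\ forall n, subspace (S n),
      forall w, exists (N : nat) (c : nat -> L),
        (forall i, S i (c i)) /\ w = \sum_(i < N) c i
    & forall (N : nat) (c : nat -> L),
        (forall i, S i (c i)) -> \sum_(i < N) c i = 0 ->
        forall i, (i < N)%N -> c i = 0].

Definition linear_span (X : set L) : set L :=
  [set w | exists (n : nat) (a : 'I_n -> F) (x : 'I_n -> L),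
    (forall i, X (x i)) /\ w = \sum_(i < n) a i *: x i].

Lemma subspace_linear_span X : subspace (linear_span X).
Proof.
split=> [|a u v [n [b [x [Xx ->]]]] [m [c [y [Xy ->]]]]].
  exists 0%N, (fun=> 0), (fun=> 0); split; first by case.
  by rewrite big_ord0.
exists (n + m)%N.
exists (fun i => match split i with inl j => a * b j | inr j => c j end).
exists (fun i => match split i with inl j => x j | inr j => y j end).
split=> [i|]; first by case: split.
rewrite big_split_ord /= scaler_sumr; congr (_ + _).
  by apply: eq_bigr => i _; rewrite (unsplitK (inl i)) scalerA.
by apply: eq_bigr => i _; rewrite (unsplitK (inr i)).
Qed.

End Subspaces.

(* The quotient of a vector space by a subspace: ring_quotient provides its
   additive group structure, to which scalar multiplication is added. *)
Section QuotientSpace.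
Variables (F : numFieldType) (L : lmodType F) (I : zmodClosed L).
Hypothesis IZ : GRing.scaler_closed I.

Let Q := Quotient.quot I.

Definition quot_scale (a : F) : Q -> Q := fun x => \pi_Q (a *: repr x).

Lemma pi_quot_scale a (u : L) : quot_scale a (\pi_Q u) = \pi_Q (a *: u).
Proof.
apply/eqP; rewrite -Quotient.idealrBE -scalerBr.
by apply: IZ; rewrite Quotient.idealrBE reprK.
Qed.

Lemma quot_scaleA a b (x : Q) :
  quot_scale a (quot_scale b x) = quot_scale (a * b) x.
Proof. by elim/quotW: x => u; rewrite (pi_quot_scale b u) !pi_quot_scale scalerA. Qed.

Lemma quot_scale1 : left_id 1 quot_scale.
Proof. by elim/quotW => u; rewrite pi_quot_scale scale1r. Qed.

Lemma quot_scaleDr : right_distributive quot_scale +%R.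
Proof.
move=> a; elim/quotW => u; elim/quotW => v; rewrite -raddfD !pi_quot_scale.
by rewrite scalerDr raddfD.
Qed.

Lemma quot_scaleDl (x : Q) :
  {morph quot_scale^~ x : a b / a + b}.
Proof. by elim/quotW: x => u a b; rewrite !pi_quot_scale scalerDl raddfD. Qed.

End QuotientSpace.

(* [nprod u n v] is u_n v, where Y(u,x) = sum_n u_n x^{-n-1}; [vpar false] and
   [vpar true] are the even and the odd part. [vjacobi] is the coefficient of
   x_0^{-l-1} x_1^{-m-1} x_2^{-n-1} in the super Jacobi identity
     x_0^{-1} delta((x_1-x_2)/x_0) Y(u,x_1)Y(v,x_2)
      - (-1)^{|u||v|} x_0^{-1} delta((x_2-x_1)/(-x_0)) Y(v,x_2)Y(u,x_1)
     = x_2^{-1} delta((x_1-x_0)/x_2) Y(Y(u,x_0)v,x_2)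
   applied to w. *)
Record vertexSuperalgebra (F : numFieldType) := VertexSuperalgebra {
  vspace_of :> lmodType F;
  vpar : bool -> set vspace_of;
  nprod : vspace_of -> int -> vspace_of -> vspace_of;
  vacuum : vspace_of;
  vpar_subspace : forall a, subspace (vpar a);
  vpar_sum : forall v, exists v0 v1,
    [/\ vpar false v0, vpar true v1 & v = v0 + v1];
  vpar_direct : forall v, vpar false v -> vpar true v -> v = 0;
  nprod_linearl : forall n v, linear (fun u => nprod u n v);
  nprod_linearr : forall u n, linear (nprod u n);
  nprod_trunc : forall u v, exists N : int, forall n, N <= n -> nprod u n v = 0;
  nprod_par : forall a b u n v,
    vpar a u -> vpar b v -> vpar (a (+) b) (nprod u n v);
  vacuum_even : vpar false vacuum;
  nprod_vacuuml : forall n v, nprod vacuum n v = if n == -1 then v else 0;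
  nprod_vacuumr_ge0 : forall v (n : int), 0 <= n -> nprod v n vacuum = 0;
  nprod_vacuumrN1 : forall v, nprod v (-1) vacuum = v;
  vjacobi : forall (a b : bool) u v w (l m n : int), vpar a u -> vpar b v ->
    \sum_(i \in [set: nat]) ((-1) ^+ i * binz F l i) *:
        nprod u (m + l - i%:Z) (nprod v (n + i%:Z) w)
    - (-1) ^+ (a && b) *:
      \sum_(i \in [set: nat]) ((-1) ^+ i * (-1) ^ l * binz F l i) *:
        nprod v (n + l - i%:Z) (nprod u (m + i%:Z) w)
    = \sum_(i \in [set: nat]) binz F m i *:
        nprod (nprod u (l + i%:Z) v) (m + n - i%:Z) w
}.

Section FormalSeries2.
Variables (F : numFieldType) (W : lmodType F).

(* [A : int -> int -> W] stands for sum_{a,b} A_{a,b} x_1^a x_2^b. *)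
Definition bilaurent := int -> int -> W.

(* Multiplication by x_1 - x_2. *)
Definition mul_x1Bx2 (A : bilaurent) : bilaurent :=
  fun a b => A (a - 1) b - A a (b - 1).

(* Membership in W((x_1,x_2)) = W[[x_1,x_2]][x_1^{-1},x_2^{-1}]. *)
Definition in_laurent2 (A : bilaurent) : Prop :=
  exists N : int, forall a b : int, (a < N) || (b < N) -> A a b = 0.

(* Coefficient of x_0^p in exp(a x_0). *)
Definition exp_coef (a p : int) : F :=
  if p is Posz n then fps_expo a%:~R n else 0.

(* For A in W((x_1,x_2)), the coefficient of x_0^p x_2^q in
   (x_2^{-k} A) |_{x_1 = x_2 exp(x_0)}
     = sum_{a,b} A_{a,b} x_2^{a+b-k} exp(a x_0). *)
Definition subst_coef (k : nat) (A : bilaurent) (p q : int) : W :=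
  \sum_(a \in [set: int]) exp_coef a p *: A a (q + k%:Z - a).

End FormalSeries2.

Section PhiCoordinatedModules.
Variables (F : numFieldType) (V : vertexSuperalgebra F).

Section Operators.
Variables (W : lmodType F) (mode : V -> int -> W -> W).

(* With Y_W(v,x) = sum_n v_[n] x^{-n} and [mode v n] = v_[n]: the series
   Y_W(u,x_1) Y_W(v,x_2) w. *)
Definition YY (u v : V) (w : W) : bilaurent W :=
  fun a b => mode u (- a) (mode v (- b) w).

(* (x_1 - x_2)^k Y_W(u,x_1) Y_W(v,x_2) w *)
Definition YYk (k : nat) (u v : V) (w : W) : bilaurent W :=
  iter k (@mul_x1Bx2 F W) (YY u v w).

(* Coefficient of x_0^p x_2^q in (exp(x_0)-1)^k Y_W(Y(u,x_0)v,x_2) w; the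
   coefficient of x_0^{p-j} in Y(u,x_0)v is u_{j-p-1} v. *)
Definition Yiter_coef (k : nat) (u v : V) (w : W) (p q : int) : W :=
  \sum_(j \in [set: nat])
    fps_exp (fps_expm1 F) k j *: mode (nprod u (j%:Z - p - 1) v) (- q) w.

End Operators.

(* (x_1/x_2 - 1)^k = x_2^{-k} (x_1 - x_2)^k explains the use of
   [subst_coef k] with [YYk k] in [pmode_assoc]. *)
Record phiModule := PhiModule {
  pmod_space :> lmodType F;
  pmode : V -> int -> pmod_space -> pmod_space;
  pmode_linearl : forall n w, linear (fun v => pmode v n w);
  pmode_linearr : forall v n, linear (pmode v n);
  pmode_trunc : forall v w, exists N : int, forall n, N <= n -> pmode v n w = 0;
  pmode_vacuum : forall n w,
    pmode (vacuum V) n w = if n == 0 then w else 0;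
  pmode_assoc : forall u v, exists k : nat,
    (forall w, in_laurent2 (YYk pmode k u v w)) /\
    (forall w p q, Yiter_coef pmode k u v w p q
                   = subst_coef k (YYk pmode k u v w) p q)
}.

Definition intgrade (W : lmodType F) (gr : nat -> set W) (p : int) : set W :=
  if p is Posz n then gr n else [set 0].

Record gradedPhiModule := GradedPhiModule {
  gpm_module :> phiModule;
  gpm_gr : nat -> set gpm_module;
  gpm_direct : direct_sum gpm_gr;
  gpm_degree : forall v (m : int) (n : nat) w,
    gpm_gr n w -> intgrade gpm_gr (n%:Z - m) (pmode v m w)
}.

Definition graded_submodule (W : gradedPhiModule) (S : set W) : Prop :=
  [/\ subspace S,
      forall v n w, S w -> S (pmode v n w)
    & forall (N : nat) (c : nat -> W),
        (forall i, gpm_gr i (c i)) -> S (\sum_(i < N) c i) ->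
        forall i, (i < N)%N -> S (c i)].

Definition phi_irreducible (W : gradedPhiModule) : Prop :=
  (exists w : W, w <> 0) /\
  forall S : set W, graded_submodule S -> S = [set 0] \/ S = [set: W].

Definition phi_equivalent (W1 W2 : gradedPhiModule) : Prop :=
  exists (psi : {linear W1 -> W2}) (k : int),
    [/\ bijective psi,
        forall v n w, psi (pmode v n w) = pmode v n (psi w)
      & forall n : nat,
          psi @` @gpm_gr W1 n = intgrade (@gpm_gr W2) (n%:Z + k)].

Definition irrPhiModule := {W : gradedPhiModule | phi_irreducible W}.

Definition irrPhi_equivalent (W1 W2 : irrPhiModule) : Prop :=
  phi_equivalent (sval W1) (sval W2).

Definition normalized (W : gradedPhiModule) : Prop := @gpm_gr W 0 <> [set 0].

End PhiCoordinatedModules.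

Section AtildeAlgebra.
Variables (F : numFieldType) (V : vertexSuperalgebra F).

(* Res_x exp(x)/(exp(x)-1)^d Y(u,x)v: the coefficient of x^{j-d} in
   exp(x)/(exp(x)-1)^d is [zhu_kernel F d j]. *)
Definition zhu_res (d : nat) (u v : V) : V :=
  \sum_(j \in [set: nat]) zhu_kernel F d j *: nprod u (j%:Z - d%:Z) v.

Definition zhu_mul (u v : V) : V := zhu_res 1 u v.

Definition Otilde : set V :=
  linear_span [set w | exists u v : V, w = zhu_res 2 u v].

Definition Otilde_pred : {pred V} := fun v => `[< Otilde v >].

Lemma Otilde_submod_closed : GRing.submod_closed Otilde_pred.
Proof.
have [O0 OD] := subspace_linear_span [set w | exists u v : V, w = zhu_res 2 u v].
split; first exact/asboolP.
by move=> a u v /asboolP Ou /asboolP Ov; apply/asboolP; exact: OD.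
Qed.

HB.instance Definition _ :=
  GRing.isSubmodClosed.Build F V Otilde_pred
    (GRing.submod_closed_semi Otilde_submod_closed).

Definition Atilde := Quotient.quot Otilde_pred.

HB.instance Definition _ := GRing.Zmodule.on Atilde.

Let OZ : GRing.scaler_closed Otilde_pred.
Proof. by move=> a v; exact: rpredZ. Qed.

HB.instance Definition _ := GRing.Zmodule_isLmodule.Build F Atilde
  (quot_scaleA OZ) (quot_scale1 OZ) (quot_scaleDr OZ) (quot_scaleDl OZ).

Definition to_Atilde (v : V) : Atilde := \pi_Atilde v.

Lemma to_Atilde_linear : linear to_Atilde.
Proof.
move=> a u v; rewrite /to_Atilde raddfD; congr (_ + _).
exact/esym/(pi_quot_scale OZ).
Qed.

Lemma to_Atilde_surj (x : Atilde) : exists v, to_Atilde v = x.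
Proof. by elim/quotW: x => v; exists v. Qed.

Lemma to_Atilde_eq0 (v : V) : to_Atilde v = 0 <-> Otilde v.
Proof.
have -> : (0 : Atilde) = to_Atilde 0 by rewrite /to_Atilde raddf0.
have e : `[< Otilde v >] = (to_Atilde v == to_Atilde 0).
  by have := Quotient.idealrBE Otilde_pred v 0; rewrite subr0.
by split=> [v0|/asboolP]; [apply/asboolP; rewrite e v0 | rewrite e => /eqP].
Qed.

(* A module over the algebra Atilde: a linear representation of the quotient
   space compatible with its identity, the class of the vacuum, and with its
   product, (class of u)(class of v) = class of u * v. *)
Record AtModule := ATModule {
  atmod_space :> lmodType F;
  atact : Atilde -> atmod_space -> atmod_space;
  atact_linearl : forall x, linear (fun a => atact a x);
  atact_linearr : forall a, linear (atact a);
  atact1 : forall x, atact (to_Atilde (vacuum V)) x = x;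
  atactM : forall u v x,
    atact (to_Atilde (zhu_mul u v)) x
    = atact (to_Atilde u) (atact (to_Atilde v) x)
}.

Definition at_irreducible (U : AtModule) : Prop :=
  (exists x : U, x <> 0) /\
  forall S : set U, subspace S -> (forall a x, S x -> S (atact a x)) ->
    S = [set 0] \/ S = [set: U].

Definition at_isomorphic (U1 U2 : AtModule) : Prop :=
  exists psi : {linear U1 -> U2},
    bijective psi /\ forall a x, psi (atact a x) = atact a (psi x).

Definition irrAtModule := {U : AtModule | at_irreducible U}.

Definition irrAt_isomorphic (U1 U2 : irrAtModule) : Prop :=
  at_isomorphic (sval U1) (sval U2).

(* W[0], with v acting as v_[0], is an Atilde-module, identified with U by the
   embedding j. *)
Definition degree0_module (W : gradedPhiModule V) (U : AtModule) : Prop :=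
  exists j : {linear U -> W},
    [/\ injective j,
        range j = @gpm_gr _ _ W 0
      & forall v x, j (atact (to_Atilde v) x) = pmode v 0 (j x)].

End AtildeAlgebra.

(* The set of classes of a relation E, each class being the predicate E x. *)
Section Classes.
Variables (T : Type) (E : T -> T -> Prop).

Definition classes := {C : T -> Prop | exists x, C = E x}.

Definition class_of (x : T) : classes := exist _ (E x) (ex_intro _ x erefl).

End Classes.

(* Main.v *)
From HB Require Import structures.
Require Import Defs.
From mathcomp Require Import all_boot all_order all_algebra.
From mathcomp Require Import boolp classical_sets functions fsbigop.
From mathcomp Require Import zify ring.

(** Everything is expressed in the coordinate [t = exp(z)], in which the
    substitution [x1 = x2 exp(z)] becomes [x1/x2 = t]. Let [expres a m u v] be
    the residue of [t^a (t-1)^m Y(u,z) v dz]; the product of the Zhu algebra is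
    induced by [expres 1 (-1)], and the subspace factored out of V is spanned by
    the [expres 1 (-2) u v]. For [w] in a coordinated module and an integer [q],
    the series with the terms [u_[p] v_[q-p] w t^(-p)] and, up to sign, the series
    with the terms [v_[p] u_[q-p] w t^(p-q)] are the expansions at infinity and at
    0 of one rational function R(t), whose only other pole is at 1. The residue
    theorem for [t^a (t-1)^m R(t) dt/t] gives an identity similar to the Jacobi
    identity, [residue_identity], which expresses [(expres a m u v)_[q] w] by
    the [u_[p] v_[q-p] w] and the [v_[p] u_[q-p] w]. It is equivalent to the
    associativity axiom of coordinated modules ([weak_assoc_residue],
    [weak_assoc_assoc]): the axiom controls the forms without pole at 0, and
    skew-symmetry of V ([expres_skew]), which is the symmetry [t |-> 1/t], gives
    the forms without pole at infinity; all others are differences of these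
    ([residue_theorem]).

    From a module to the algebra. On a vector of degree 0 most terms of the
    identity vanish; it shows that [v |-> v_[0]] is a representation of the
    Zhu algebra ([deg0_zhu]), and that the submodule generated by a set of
    vectors of degree 0 is spanned by the [v_[m] x] ([generated_mode]), so that
    it meets degree 0 in what the [v_[0]] generate ([generated_deg0]). Hence the
    degree 0 part of an irreducible module is irreducible, and it determines the
    module: the diagonal in the degree 0 part of [W1 * W2] generates the graph
    of an isomorphism ([degree0_equivalent]).

    From the algebra to a module. A vector [w] of degree [n] of an irreducible
    module with degree 0 part U is determined by the functional [v |-> v_[n] w]
    from V to U. The functionals that occur are homogeneous, and the rational
    functions [f (Y(u,z) v)] satisfy conditions on their poles ([regular]); weak associativity
    dictates how V acts on them ([ract]). Conversely, the regular functionals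
    form a coordinated module ([fun_graded]), by the Jacobi identity of V in the
    coordinates [t1], [t2] ([expres_assoc], [rcoef_expres]). In degree 0 the
    regular functionals are those that vanish on the subspace factored out.
    If U is an irreducible module of that algebra, then the functionals
    [v |-> v x], for [x] in U, generate a submodule [induced] whose degree 0 part
    is U. It is irreducible: a nonzero functional [f] of degree [n] has a nonzero
    value [f v], and [v_[n] f] is the functional of degree 0 given by the vector
    [f v] of U. *)

Set Implicit Arguments.
Unset Strict Implicit.
Unset Printing Implicit Defensive.

Import Order.TTheory GRing.Theory Num.Theory.

Local Open Scope classical_set_scope.
Local Open Scope ring_scope.

(** * Finitely supported sums over the integers *)

Lemma subACA (A : zmodType) (a b c d : A) : a - b - (c - d) = a - c - (b - d).
Proof. by rewrite opprD addrACA -opprD. Qed.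

Section LinearMaps.
Variables (F : numFieldType) (A B : lmodType F) (g : A -> B).
Hypothesis lg : linear g.

Lemma lin0 : g 0 = 0.
Proof. by have := lg (-1) 0 0; rewrite scaler0 addr0 scaleN1r addNr. Qed.

Lemma linD x y : g (x + y) = g x + g y.
Proof. by have := lg 1 x y; rewrite !scale1r. Qed.

Lemma linZ a x : g (a *: x) = a *: g x.
Proof. by have := lg a x 0; rewrite lin0 !addr0. Qed.

Lemma linN x : g (- x) = - g x.
Proof. by rewrite -scaleN1r linZ scaleN1r. Qed.

Lemma linB x y : g (x - y) = g x - g y.
Proof. by rewrite linD linN. Qed.

Lemma lin_sum (I : Type) (r : seq I) (P : pred I) (f : I -> A) :
  g (\sum_(i <- r | P i) f i) = \sum_(i <- r | P i) g (f i).
Proof. by apply: (big_morph g linD lin0). Qed.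

Definition mklinear : {linear A -> B} :=
  HB.pack g (GRing.isLinear.Build F A B _ g lg).

End LinearMaps.

Definition zsum (M : nmodType) (f : int -> M) : M := \sum_(i \in [set: int]) f i.

Definition zsupp (M : nmodType) (lo hi : int) (f : int -> M) :=
  forall i, ~~ ((lo <= i) && (i <= hi)) -> f i = 0.

Definition zfin (M : nmodType) (f : int -> M) := exists lo hi, zsupp lo hi f.

Definition zfin2 (M : nmodType) (f : int -> int -> M) :=
  exists lo hi : int, forall i j,
    ~~ [&& lo <= i, i <= hi, lo <= j & j <= hi] -> f i j = 0.

Definition zrange (lo hi : int) : seq int :=
  [seq lo + k%:Z | k <- iota 0 (if lo <= hi then `|hi - lo|%N.+1 else 0%N)].

Lemma zrangeE lo (k : nat) :
  zrange lo (lo + k%:Z) = [seq lo + i%:Z | i <- iota 0 k.+1].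
Proof.
rewrite /zrange (_ : lo <= lo + k%:Z); last by lia.
by rewrite (_ : absz (lo + k%:Z - lo)%R = k); last by lia.
Qed.

Lemma zrange_uniq lo hi : uniq (zrange lo hi).
Proof. by rewrite map_inj_uniq ?iota_uniq // => x y /addrI []. Qed.

Lemma mem_zrange lo hi i : (i \in zrange lo hi) = (lo <= i) && (i <= hi).
Proof.
apply/mapP/idP => [[k]|h].
  by rewrite mem_iota; case: ifP => // ? ? ->; lia.
exists `|i - lo|%N; last by lia.
by rewrite mem_iota; case: ifP; lia.
Qed.

Section ZSum.
Variable M : nmodType.
Implicit Types f g : int -> M.

Lemma zsumE lo hi f : zsupp lo hi f -> zsum f = \sum_(i <- zrange lo hi) f i.
Proof.
move=> fs; rewrite /zsum -(fsbig_widen [set` zrange lo hi] setT) //.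
  by rewrite -fsbig_seq // zrange_uniq.
by move=> i /= [_]; rewrite mem_zrange => /negP h; apply: fs.
Qed.

Lemma eq_zsum f g : f =1 g -> zsum f = zsum g.
Proof. by move=> fg; congr zsum; apply/funext. Qed.

Lemma zsum0 f : (forall i, f i = 0) -> zsum f = 0.
Proof. by move=> f0; apply: fsbig1. Qed.

Lemma zsum1 i0 f : (forall i, i != i0 -> f i = 0) -> zsum f = f i0.
Proof.
move=> f0; rewrite (@zsumE i0 i0) => [|i ni]; last by apply: f0; lia.
rewrite /zrange lexx subrr /= big_cons big_nil addr0; congr f; lia.
Qed.

Lemma zsupp_widen lo hi lo' hi' f : zsupp lo hi f ->
  lo' <= lo -> hi <= hi' -> zsupp lo' hi' f.
Proof. by move=> fs h1 h2 i hi0; apply: fs; lia. Qed.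

Lemma zfin_common f g : zfin f -> zfin g ->
  exists lo hi, zsupp lo hi f /\ zsupp lo hi g.
Proof.
move=> [l1 [h1 s1]] [l2 [h2 s2]]; exists (Num.min l1 l2), (Num.max h1 h2).
by split; [apply: zsupp_widen s1 _ _ | apply: zsupp_widen s2 _ _]; lia.
Qed.

Lemma zsumD f g : zfin f -> zfin g ->
  zsum (fun i => f i + g i) = zsum f + zsum g.
Proof.
move=> ff gf; have [lo [hi [fs gs]]] := zfin_common ff gf.
rewrite !(@zsumE lo hi) // ?big_split // => i hi0.
by rewrite fs // gs // addr0.
Qed.

Lemma zsum_bij (h h' : int -> int) f : cancel h h' -> cancel h' h ->
  zsum f = zsum (fun i => f (h i)).
Proof. by move=> k k'; rewrite /zsum (reindex_fsbigT h) //; exists h'. Qed.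

Lemma zsum_shift c f : zsum f = zsum (fun i => f (i + c)).
Proof. by apply: (@zsum_bij _ (fun i => i - c)) => i; lia. Qed.

Lemma zsum_rev c f : zsum f = zsum (fun i => f (c - i)).
Proof. by apply: (@zsum_bij _ (fun i => c - i)) => i; lia. Qed.

Lemma zsum_exch (f : int -> int -> M) : zfin2 f ->
  zsum (fun i => zsum (f i)) = zsum (fun j => zsum (fun i => f i j)).
Proof.
move=> [lo [hi fs]]; rewrite !(@zsumE lo hi).
- rewrite (eq_bigr (fun i => \sum_(j <- zrange lo hi) f i j)).
    rewrite exchange_big; apply: eq_bigr => j _; rewrite (@zsumE lo hi) //.
    by move=> i hi0; apply: fs; lia.
  by move=> i _; rewrite (@zsumE lo hi) // => j hj; apply: fs; lia.
- by move=> j hj; apply: zsum0 => i; apply: fs; lia.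
- by move=> i hi0; apply: zsum0 => j; apply: fs; lia.
Qed.

Lemma natsum_zsum (g : nat -> M) (N : nat) : (forall i, (N <= i)%N -> g i = 0) ->
  \sum_(i \in [set: nat]) g i = zsum (fun i => if i is Posz k then g k else 0).
Proof.
move=> g0; rewrite -(fsbig_widen [set` iota 0 N] setT) //; last first.
  by move=> i /= [_]; rewrite mem_iota => /negP h; apply: g0; lia.
rewrite -fsbig_seq ?iota_uniq // (@zsumE 0 N%:Z); last first.
  by case=> // i hi; apply: g0; lia.
rewrite -[N%:Z]add0r zrangeE (eq_map (g := Posz)) => [|k]; last exact: add0r.
by rewrite big_map -addn1 iotaD big_cat /= big_cons big_nil add0n g0 // !addr0.
Qed.

End ZSum.

Section ZSumLinear.
Variable F : numFieldType.
Variables (A B : lmodType F) (g : A -> B).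
Hypothesis lg : linear g.

Lemma zfin_lin f : zfin f -> zfin (fun i => g (f i)).
Proof. by move=> [lo [hi fs]]; exists lo, hi => i /fs ->; rewrite lin0. Qed.

Lemma zsum_lin f : zfin f -> g (zsum f) = zsum (fun i => g (f i)).
Proof.
move=> [lo [hi fs]]; rewrite !(@zsumE _ lo hi) ?lin_sum // => i /fs ->.
by rewrite lin0.
Qed.

End ZSumLinear.

Section ZSumScale.
Variables (F : numFieldType) (M : lmodType F).

Lemma scale_linear (a : F) : linear (fun x : M => a *: x).
Proof. by move=> b x y; rewrite scalerDr !scalerA mulrC. Qed.

Lemma scalel_linear (x : M) : linear (fun a : F^o => a *: x).
Proof. by move=> b c d; rewrite scalerDl scalerA. Qed.

Lemma zsumZ (a : F) (f : int -> M) : zfin f ->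
  zsum (fun i => a *: f i) = a *: zsum f.
Proof. by move=> ff; rewrite (zsum_lin (scale_linear a)). Qed.

Lemma zsumZl (x : M) (f : int -> F) : zfin f ->
  zsum (fun i => f i *: x) = zsum f *: x.
Proof. by move=> ff; rewrite -(zsum_lin (scalel_linear x) (f := f : int -> F^o)). Qed.

Lemma zsumMl (a : F) (f : int -> F) : zfin f ->
  zsum (fun i => a * f i) = a * zsum f.
Proof.
move=> [lo [hi fs]]; rewrite !(@zsumE _ lo hi) ?mulr_sumr // => i /fs ->.
by rewrite mulr0.
Qed.

Lemma zfinZ (a : F) (f : int -> M) : zfin f -> zfin (fun i => a *: f i).
Proof. by move=> [lo [hi fs]]; exists lo, hi => i /fs ->; rewrite scaler0. Qed.

Lemma zsumN (f : int -> M) : zfin f -> zsum (fun i => - f i) = - zsum f.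
Proof.
move=> [lo [hi fs]]; rewrite !(@zsumE _ lo hi) ?sumrN // => i /fs ->.
by rewrite oppr0.
Qed.

Lemma zfinN (f : int -> M) : zfin f -> zfin (fun i => - f i).
Proof. by move=> [lo [hi fs]]; exists lo, hi => i /fs ->; rewrite oppr0. Qed.

Lemma zsumB (f g : int -> M) : zfin f -> zfin g ->
  zsum (fun i => f i - g i) = zsum f - zsum g.
Proof. by move=> ff gf; rewrite zsumD ?zsumN //; apply: zfinN. Qed.

End ZSumScale.

(** * Binomial coefficients with an integer numerator *)

Section Binomials.
Variable F : numFieldType.

(** [bc m i] is the coefficient of [t^(m-i)] in the expansion of [(t-1)^m] at
    infinity. *)
Definition bc (m i : int) : F :=
  if i is Posz k then (-1) ^+ k * binz F m k else 0.

Lemma signz_sqr m : (-1) ^ m * (-1) ^ m = 1 :> F.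
Proof. by rewrite -exprzMl ?unitrN1 // mulrNN mul1r exp1rz. Qed.

Lemma factS_neq0 n : ((n.+1)`!%:R : F) != 0.
Proof. by rewrite pnatr_eq0 -lt0n fact_gt0. Qed.

Lemma natS_neq0 n : (n.+1%:R : F) != 0.
Proof. by rewrite pnatr_eq0. Qed.

Lemma binz0 m : binz F m 0 = 1.
Proof. by rewrite /binz big_ord0 fact0 divr1. Qed.

Lemma binzS m k : k.+1%:R * binz F m k.+1 = (m - k%:Z)%:~R * binz F m k.
Proof.
rewrite /binz big_ord_recr /= factS natrM.
have h := factS_neq0 k; have h' : (k`!%:R : F) != 0.
  by rewrite pnatr_eq0 -lt0n fact_gt0.
field; rewrite h' /= nat1r; exact: natS_neq0.
Qed.

Lemma binz_pascal m k : binz F (m + 1) k.+1 = binz F m k.+1 + binz F m k.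
Proof.
elim: k => [|k IHk].
  have := binzS (m + 1) 0; have := binzS m 0; rewrite !binz0 !mul1r !mulr1.
  by move=> -> ->; rewrite !subr0 intrD.
apply: (mulfI (natS_neq0 k.+1)); rewrite mulrDr !binzS IHk.
have -> : m + 1 - k.+1%:Z = m - k%:Z by lia.
rewrite mulrDr -(binzS m k) (_ : (k.+2%:R : F) = 1 + k.+1%:R) ?nat1r //.
have -> : m - k%:Z = m - k.+1%:Z + 1 by lia.
by rewrite intrD; ring.
Qed.

Lemma binz_abs m k : k.+1%:R * binz F m k.+1 = m%:~R * binz F (m - 1) k.
Proof.
elim: k => [|k IHk]; first by rewrite binzS !binz0 subr0.
apply: (mulfI (natS_neq0 k)); rewrite binzS mulrCA IHk.
rewrite [RHS]mulrCA binzS mulrCA; congr (_ * (_ * _)); congr (_%:~R); lia.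
Qed.

Lemma binz_N1 k : binz F (-1) k = (-1) ^+ k.
Proof.
elim: k => [|k IHk]; first by rewrite binz0.
apply: (mulfI (natS_neq0 k)); rewrite binzS IHk exprS intrD !rmorphN /=.
by rewrite -pmulrn -natr1; ring.
Qed.

Lemma bc_lt0 m i : i < 0 -> bc m i = 0.
Proof. by case: i. Qed.

Lemma bc0 m : bc m 0 = 1.
Proof. by rewrite -[RHS](mulr1 1) -{2}(binz0 m). Qed.

Lemma bc_pascal m i : bc (m + 1) i = bc m i - bc m (i - 1).
Proof.
case: i => [[|k]|k]; last by rewrite !bc_lt0 ?subr0 //; lia.
  by rewrite !bc0 bc_lt0 ?subr0.
have -> : (k.+1%:Z - 1 : int) = k%:Z by lia.
by rewrite /bc binz_pascal exprS; ring.
Qed.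

(** Comparison of the expansions of [(t-1)^m] and of its derivative. *)
Lemma bc_abs m i : i%:~R * bc m i = - m%:~R * bc (m - 1) (i - 1).
Proof.
case: i => [[|k]|k]; last by rewrite !bc_lt0 ?mulr0 //; lia.
  by rewrite bc0 bc_lt0 // mul0r mulr0.
have -> : (k.+1%:Z - 1 : int) = k%:Z by lia.
rewrite /bc exprS -[k.+1%:Z%:~R]pmulrn.
transitivity (- (-1) ^+ k * (k.+1%:R * binz F m k.+1)); first ring.
by rewrite binz_abs; ring.
Qed.

Lemma bc_top m i : (m - i)%:~R * bc m i = m%:~R * bc (m - 1) i.
Proof.
have := bc_abs m i; have := bc_pascal (m - 1) i; rewrite subrK => ->.
move=> h; rewrite intrD mulrDl rmorphN mulNr.
have -> : i%:~R * (bc (m - 1) i - bc (m - 1) (i - 1)) = - m%:~R * bc (m - 1) (i - 1) by [].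
ring.
Qed.

End Binomials.

(** * Power series and the expansions of [exp(az) (exp(z)-1)^m] *)

Section SeriesRing.
Variable F : numFieldType.

Definition series := fps F.

HB.instance Definition _ := GRing.Zmodule.copy series (nat -> F).

Implicit Types s t u : series.

Lemma seriesD s t n : (s + t) n = s n + t n. Proof. by []. Qed.
Lemma seriesN s n : (- s) n = - s n. Proof. by []. Qed.

Let tr n s : {poly F} := \poly_(i < n.+1) s i.

Lemma coef_tr n s i : (i <= n)%N -> (tr n s)`_i = s i.
Proof. by move=> lt_in; rewrite coef_poly ltnS lt_in. Qed.

Lemma fps_mul_tr s t n i : (i <= n)%N ->
  fps_mul s t i = (tr n s * tr n t)`_i.
Proof.
move=> lt_in; rewrite coefM; apply: eq_bigr => j _.
by rewrite !coef_tr //; have := ltn_ord j; lia.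
Qed.

Lemma series_mulA : associative (@fps_mul F : series -> series -> series).
Proof.
move=> s t u; apply/funext => n.
transitivity ((tr n s * (tr n t * tr n u))`_n).
  rewrite coefM; apply: eq_bigr => j _; rewrite coef_tr; last exact: leq_ord.
  by rewrite (fps_mul_tr _ _ (n := n)) // leq_subr.
rewrite mulrA coefM; apply: eq_bigr => j _; rewrite coef_tr ?leq_subr //.
by rewrite (fps_mul_tr _ _ (n := n)) // leq_ord.
Qed.

Lemma series_mulC : commutative (@fps_mul F : series -> series -> series).
Proof.
by move=> s t; apply/funext => n; rewrite !(fps_mul_tr _ _ (leqnn n)) mulrC.
Qed.

Lemma series_mul1 : left_id (fps1 F) (@fps_mul F : series -> series -> series).
Proof.
move=> s; apply/funext => n; rewrite /fps_mul big_ord_recl /= mul1r subn0.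
by rewrite big1 ?addr0 // => i _; rewrite /fps1 /= mul0r.
Qed.

Lemma series_mulDl :
  left_distributive (@fps_mul F : series -> series -> series) +%R.
Proof.
move=> s t u; apply/funext => n; rewrite seriesD /fps_mul -big_split /=.
by apply: eq_bigr => i _; rewrite mulrDl.
Qed.

Lemma series_1neq0 : fps1 F != 0 :> series.
Proof.
by apply/eqP => /(congr1 (fun s : series => s 0%N)) /eqP; rewrite oner_eq0.
Qed.

HB.instance Definition _ := GRing.Zmodule_isComNzRing.Build series
  series_mulA series_mulC series_mul1 series_mulDl series_1neq0.

Lemma seriesME s t n : (s * t) n = \sum_(i < n.+1) s i * t (n - i)%N.
Proof. by []. Qed.

Lemma series1E n : (1 : series) n = (n == 0%N)%:R.
Proof. by []. Qed.

Definition series_unit : pred series := fun s => s 0%N != 0.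

Definition series_inv s : series := if s 0%N == 0 then s else fps_inv s.

Lemma series_mulVr : {in series_unit, left_inverse 1 series_inv *%R}.
Proof.
move=> s us; rewrite mulrC /series_inv (negPf us); exact: fps_mulV.
Qed.

Lemma series_unitPl s t : t * s = 1 -> series_unit s.
Proof.
move=> /(congr1 (fun s : series => s 0%N)); rewrite seriesME series1E.
rewrite big_ord_recl big_ord0 addr0 subn0 => h; apply/eqP => s0.
by move: h; rewrite s0 mulr0 => /esym /eqP; rewrite oner_eq0.
Qed.

Lemma series_inv_out : {in [predC series_unit], series_inv =1 id}.
Proof. by move=> s /=; rewrite /series_inv inE negbK => ->. Qed.

HB.instance Definition _ := GRing.ComNzRing_hasMulInverse.Build series
  series_mulVr series_unitPl series_inv_out.

Lemma seriesX s k : s ^+ k = fps_exp s k.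
Proof. by elim: k => //= k IHk; rewrite exprS IHk. Qed.

(** The variable [z]. *)
Definition sX : series := fun n => (n == 1%N)%:R.

Lemma sXE s n : (sX * s) n = if n is k.+1 then s k else 0.
Proof.
rewrite seriesME; case: n => [|k]; first by rewrite big_ord_recl big_ord0 mul0r addr0.
rewrite big_ord_recl mul0r add0r big_ord_recl mul1r subSS subn0.
by rewrite big1 ?addr0 // => i _; rewrite /sX /= mul0r.
Qed.

(** The derivation [z d/dz], which avoids a shift of the coefficients. *)
Definition theta s : series := fun n => n%:R * s n.

Lemma thetaM s t : theta (s * t) = theta s * t + s * theta t.
Proof.
apply/funext => n; rewrite seriesD /theta !seriesME mulr_sumr -big_split /=.
apply: eq_bigr => i _; rewrite -{1}(subnKC (leq_ord i)) natrD; ring.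
Qed.

Lemma theta1 : theta 1 = 0.
Proof. by apply/funext => -[|n]; rewrite /theta ?mul0r // series1E mulr0. Qed.

Lemma thetaXz s (m : int) : s \is a GRing.unit ->
  theta (s ^ m) = m%:~R * (s ^ (m - 1) * theta s).
Proof.
move=> us.
have pos (k : nat) : theta (s ^ k%:Z) = k%:Z%:~R * (s ^ (k%:Z - 1) * theta s).
  elim: k => [|k IHk]; first by rewrite expr0z theta1 mul0r.
  have -> : s ^ k.+1%:Z = s * s ^ k%:Z by rewrite -exprSz.
  rewrite thetaM IHk -[in RHS]addn1 PoszD addrK intrD.
  have -> : s ^ k%:Z = s * s ^ (k%:Z - 1).
    by rewrite -{2}[s]expr1z -exprzDr // addrC subrK.
  ring.
have inv k : theta (s ^ (- k%:Z)) = - (s ^ (- k%:Z) * s ^ (- k%:Z)) * theta (s ^ k%:Z).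
  have h : s ^ (- k%:Z) * s ^ k%:Z = 1 by rewrite -exprzDr // addNr expr0z.
  have := thetaM (s ^ (- k%:Z)) (s ^ k%:Z); rewrite h theta1 => h2.
  have h3 : theta (s ^ (- k%:Z)) * s ^ k%:Z = - (s ^ (- k%:Z) * theta (s ^ k%:Z)).
    by apply/eqP; rewrite -addr_eq0 -h2.
  by rewrite -[LHS]mulr1 -h mulrCA h3; ring.
case: (intP m) => [|k|k]; [exact: (pos 0%N)|exact: pos|].
have -> : s ^ (- k.+1%:Z - 1) = s ^ (- k.+1%:Z) * s ^ (- k.+1%:Z) * s ^ (k.+1%:Z - 1).
  by rewrite -!exprzDr //; congr (s ^ _); lia.
by rewrite inv pos rmorphN; ring.
Qed.

Lemma series_natE (k : nat) s n : (s *+ k) n = s n *+ k.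
Proof. by elim: k => // k IHk; rewrite !mulrSr seriesD IHk. Qed.

Lemma series_intM (m : int) s n : (m%:~R * s) n = m%:~R * s n.
Proof.
rewrite !mulrzl; case: m => k; first by rewrite -!pmulrn series_natE.
by rewrite !NegzE !mulrNz seriesN -!pmulrn series_natE.
Qed.

(** The substitution [z |-> -z]. *)
Definition flip s : series := fun n => (-1) ^+ n * s n.

Lemma flipM s t : flip (s * t) = flip s * flip t.
Proof.
apply/funext => n; rewrite /flip !seriesME mulr_sumr; apply: eq_bigr => i _.
by rewrite -{1}(subnKC (leq_ord i)) exprD; ring.
Qed.

Lemma flip1 : flip 1 = 1.
Proof.
by apply/funext => -[|n]; rewrite /flip ?mul1r // series1E mulr0.
Qed.

Lemma flipXz s (m : int) : s \is a GRing.unit -> flip (s ^ m) = flip s ^ m.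
Proof.
move=> us.
have pos (k : nat) : flip (s ^ k%:Z) = flip s ^ k%:Z.
  elim: k => [|k IHk]; first by rewrite !expr0z flip1.
  have -> : s ^ k.+1%:Z = s * s ^ k%:Z by rewrite -exprSz.
  by rewrite flipM IHk -exprSz.
have uf : flip s \is a GRing.unit.
  by move: us; rewrite !qualifE /= /series_unit /flip mul1r.
case: (intP m) => [|k|k]; [exact: (pos 0%N)|exact: pos|].
have h : s ^ (- k.+1%:Z) * s ^ k.+1%:Z = 1 by rewrite -exprzDr // addNr expr0z.
have := congr1 flip h; rewrite flipM flip1 pos => h2.
by rewrite -[LHS]mulr1 -(expr0z (flip s)) -(subrr k.+1%:Z) exprzDr // mulrA h2 mul1r.
Qed.

Definition sexp (a : int) : series := fps_expo a%:~R.

Lemma sexpE a n : sexp a n = a%:~R ^+ n / n`!%:R. Proof. by []. Qed.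

Lemma fact_neq0 n : (n`!%:R : F) != 0.
Proof. by rewrite pnatr_eq0 -lt0n fact_gt0. Qed.

Lemma sexpD a b : sexp (a + b) = sexp a * sexp b.
Proof.
apply/funext => n; rewrite seriesME sexpE intrD exprDn mulr_suml.
rewrite (reindex_inj rev_ord_inj); apply: eq_bigr => i _ /=.
have le_in : (i <= n)%N by rewrite -ltnS.
rewrite !subSS subKn // bin_sub // -mulr_natl !sexpE.
have := bin_fact le_in => /(congr1 (fun k => k%:R : F)); rewrite !natrM => <-.
have := fact_neq0 i; have := fact_neq0 (n - i) => h1 h2.
have h3 : 'C(n, i)%:R != 0 :> F by rewrite pnatr_eq0 -lt0n bin_gt0.
by field; rewrite h1 h2 h3.
Qed.

Lemma sexp0 : sexp 0 = 1.
Proof.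
by apply/funext => -[|n]; rewrite sexpE ?expr0 ?fact0 ?divr1 // expr0n mul0r.
Qed.

Lemma theta_sexp a : theta (sexp a) = a%:~R * (sX * sexp a).
Proof.
apply/funext => -[|n]; rewrite series_intM sXE /theta ?mul0r ?mulr0 // !sexpE.
rewrite factS natrM exprS; have := fact_neq0 n => h.
by field; rewrite h nat1r pnatr_eq0.
Qed.

(** [(exp(z) - 1)/z] *)
Definition sE : series := fps_expm1_divx F.

Lemma sE_unit : sE \is a GRing.unit.
Proof. exact: fps_expm1_divx0. Qed.

Lemma sX_sE : sX * sE = sexp 1 - 1.
Proof.
apply/funext => -[|n]; rewrite sXE seriesD seriesN sexpE series1E ?subr0 //.
  by rewrite expr0 fact0 divr1 subrr.
by rewrite /sE /fps_expm1_divx /fps_expm1 /fps_expo /fps1 ?subr0.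
Qed.

Lemma theta_sE : theta sE = sexp 1 - sE.
Proof.
apply/funext => n; rewrite seriesD seriesN sexpE /theta /sE /fps_expm1_divx.
rewrite /fps_expm1 /fps_expo /fps1 /= ?subr0 !expr1n factS natrM.
have := fact_neq0 n => h.
by field; rewrite h nat1r pnatr_eq0.
Qed.

Lemma flip_sexp a : flip (sexp a) = sexp (- a).
Proof.
by apply/funext => n; rewrite /flip !sexpE rmorphN /= [in RHS]exprNn mulrA.
Qed.

Lemma flip_sE : flip sE = sexp (-1) * sE.
Proof.
have sXI s t : sX * s = sX * t -> s = t.
  by move=> h; apply/funext => n; have := congr1 (fun u : series => u n.+1) h; rewrite !sXE.
have fX : flip sX = - sX.
  apply/funext => n; rewrite /flip seriesN /sX; case: eqP => [->|_].
    by rewrite expr1 mulr1.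
  by rewrite mulr0 oppr0.
apply: sXI; rewrite mulrCA sX_sE mulrBr -sexpD addNr sexp0 mulr1.
have := flipM sX sE; rewrite fX sX_sE mulNr => h.
have fB s t : flip (s - t) = flip s - flip t.
  by apply/funext => n; rewrite /flip !seriesD !seriesN /flip mulrBr.
rewrite fB flip1 flip_sexp in h.
by rewrite -[LHS]opprK -h opprB.
Qed.

Definition kser (a m : int) : series := sexp a * sE ^ m.

Lemma kserM a b m n : kser a m * kser b n = kser (a + b) (m + n).
Proof. by rewrite /kser sexpD exprzDr ?sE_unit //; ring. Qed.

Lemma kser_step a m : kser (a + 1) m = kser a m + sX * kser a (m + 1).
Proof.
rewrite /kser sexpD exprzDr ?sE_unit // expr1z.
have -> : sexp 1 = 1 + sX * sE by rewrite sX_sE addrCA subrr addr0.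
ring.
Qed.

Lemma theta_kser a m : m%:~R * kser a m + theta (kser a m)
  = a%:~R * (sX * kser a m) + m%:~R * kser (a + 1) (m - 1).
Proof.
rewrite /kser thetaM theta_sexp (thetaXz _ sE_unit) theta_sE sexpD.
have -> : sE ^ m = sE * sE ^ (m - 1).
  by rewrite -{2}[sE]expr1z -exprzDr ?sE_unit // addrC subrK.
ring.
Qed.

Lemma flip_kser a m : flip (kser a m) = kser (- a - m) m.
Proof.
rewrite /kser flipM flip_sexp flipXz ?sE_unit // flip_sE.
have ue b : sexp b \is a GRing.unit.
  by rewrite qualifE /= /series_unit sexpE expr0 fact0 divr1 oner_eq0.
rewrite exprMz_comm ?sE_unit ?ue //; last exact: mulrC.
rewrite mulrA sexpD; congr (_ * _ * _).
have pos (k : nat) : sexp (-1) ^ k%:Z = sexp (- k%:Z).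
  elim: k => [|k IHk]; first by rewrite expr0z sexp0.
  by rewrite exprSz IHk -sexpD; congr sexp; lia.
case: (intP m) => [|k|k]; [by rewrite expr0z oppr0 sexp0|exact: pos|].
rewrite opprK -[RHS]mul1r -(expr0z (sexp (-1))) -(addNr k.+1%:Z) exprzDr ?ue //.
by rewrite -mulrA pos -sexpD addNr sexp0 mulr1.
Qed.

Lemma kser0 a m : kser a m 0%N = 1.
Proof.
have e0 b : sexp b 0%N = 1 by rewrite sexpE expr0 fact0 divr1.
have E0 : sE 0%N = 1 by rewrite /sE /fps_expm1_divx /fps_expm1 /fps_expo /fps1 /= ?subr0 expr1n divr1.
have M0 s t : (s * t) 0%N = s 0%N * t 0%N by rewrite seriesME big_ord_recl big_ord0 addr0.
have pos (k : nat) : (sE ^ k%:Z) 0%N = 1.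
  by elim: k => // k IHk; rewrite exprSz M0 IHk E0 mulr1.
rewrite /kser M0 e0 mul1r; case: (intP m) => [//|k|k]; first exact: pos.
have := congr1 (fun s : series => s 0%N) (exprzDr sE_unit (- k.+1%:Z) k.+1%:Z).
by rewrite addNr M0 pos mulr1 => <-.
Qed.

End SeriesRing.

Section LaurentCoefficients.
Variable F : numFieldType.

(** The coefficient of [z^n] in [exp(az) (exp(z)-1)^m], an element of F((z)). *)
Definition lc (a m n : int) : F :=
  if n - m is Posz k then kser F a m k else 0.

Lemma lc_lt a m n : n < m -> lc a m n = 0.
Proof. by rewrite /lc; case e : (n - m) => //; lia. Qed.

Lemma lcE a m n k : n = m + k%:Z -> lc a m n = kser F a m k.
Proof. by move=> ->; rewrite /lc addrAC subrr add0r. Qed.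

Lemma lc_diag a m : lc a m m = 1.
Proof. by rewrite (lcE a (k := 0)) ?addr0 // kser0. Qed.

Lemma lc_diag0 a m n : n = m -> lc a m n = 1.
Proof. by move=> ->; exact: lc_diag. Qed.

Variant cmp_spec (m n : int) : Type :=
| CmpLt of n < m
| CmpGe (k : nat) of n = m + k%:Z.

Lemma cmpP m n : cmp_spec m n.
Proof.
case: (ltP n m) => h; first exact: CmpLt.
by apply: (@CmpGe m n `|n - m|%N); lia.
Qed.

(** [exp((a+1)z) - exp(az) = exp(az)(exp(z)-1)] *)
Lemma lc_step a m n : lc (a + 1) m n = lc a m n + lc a (m + 1) n.
Proof.
case: (cmpP m n) => [h|k e]; first by rewrite !lc_lt ?addr0 //; lia.
rewrite !(lcE _ e) kser_step seriesD sXE; congr (_ + _).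
case: k e => [|k] e; first by rewrite lc_lt //; lia.
by rewrite (lcE a (k := k)) //; lia.
Qed.

(** The coefficient of [z^n] in the derivative of [exp(az)(exp(z)-1)^m]. *)
Lemma lc_deriv a m n :
  (n + 1)%:~R * lc a m (n + 1) = a%:~R * lc a m n + m%:~R * lc (a + 1) (m - 1) n.
Proof.
case: (cmpP m (n + 1)) => [h|k e]; first by rewrite !lc_lt ?mulr0 ?addr0 //; lia.
have := congr1 (fun s : series F => s k) (theta_kser F a m).
rewrite !seriesD !series_intM /theta sXE -(lcE a e) => h.
rewrite [lc (a + 1) _ _](lcE _ (k := k)); last by lia.
have -> : lc a m n = if k is j.+1 then kser F a m j else 0.
  case: k e h => [|k] e _; first by rewrite lc_lt //; lia.
  by rewrite (lcE _ (k := k)) //; lia.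
by rewrite -h e intrD mulrDl -pmulrn.
Qed.

Lemma lc_mul (a b m n k : int) :
  lc (a + b) (m + n) k = zsum (fun i => lc a m i * lc b n (k - i)).
Proof.
case: (cmpP (m + n) k) => [h|j e].
  rewrite lc_lt // zsum0 // => i.
  by case: (cmpP m i) => [hi|l el]; [rewrite lc_lt ?mul0r|rewrite [lc b _ _]lc_lt ?mulr0 //; lia].
rewrite (lcE _ e) -kserM seriesME.
rewrite (@zsumE _ m (m + j%:Z)); last first.
  move=> i hi; case: (ltP i m) => him; first by rewrite lc_lt ?mul0r.
  by rewrite [lc b _ _]lc_lt ?mulr0 //; lia.
rewrite zrangeE big_map -[iota 0 j.+1]/(index_iota 0 j.+1) big_mkord.
apply: eq_bigr => i _; rewrite (lcE _ (k := i)) // (lcE _ (k := (j - i)%N)) //.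
by have := ltn_ord i; lia.
Qed.

Lemma zfin_lcM a b m n k : zfin (fun i => lc a m i * lc b n (k - i)).
Proof.
exists m, (k - n) => i hi; case: (ltP i m) => him; first by rewrite lc_lt ?mul0r.
by rewrite [lc b _ _]lc_lt ?mulr0 //; lia.
Qed.

Lemma lc_flip a m n : (-1) ^ n * lc a m n = (-1) ^ m * lc (- a - m) m n.
Proof.
case: (cmpP m n) => [h|k e]; first by rewrite !lc_lt ?mulr0.
rewrite !(lcE _ e) -flip_kser /flip mulrA e; congr (_ * _).
by rewrite exprzDr ?unitrN1.
Qed.

Lemma lc_expo a n : lc a 0 n = if n is Posz k then a%:~R ^+ k / k`!%:R else 0.
Proof. by rewrite /lc subr0; case: n => // k; rewrite /kser expr0z mulr1. Qed.

(** The residue of [t^b (t-1)^l dt/t] at [t=1] is minus its residue at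
    infinity when there is no pole at 0. *)
Lemma lc_residue (b l : int) : 1 <= b -> lc b l (-1) = bc F l (b + l).
Proof.
case: (ltP l 0) => hl hb; last first.
  rewrite lc_lt; last by lia.
  have : l < b + l by lia.
  case: l hl => // l _; case: (b + (l : int)) => // k hk.
  rewrite /bc /binz (bigD1 (Ordinal (hk : (l < k)%N))) //= subrr.
  by rewrite !mul0r mulr0.
have [k e] : exists k : nat, l = - 1 - k%:Z by exists (absz (l + 1)%R); lia.
elim: k l b e hb {hl} => [|k IHk] l b e hb.
  rewrite lc_diag0; last by lia.
  have -> : l = -1 by lia.
  have [j ->] : exists j : nat, b + -1 = j by exists (absz (b - 1)%R); lia.
  suff -> : bc F (-1) j = (-1) ^+ j * (-1) ^+ j by rewrite -exprMn mulrNN mul1r expr1n.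
  by rewrite /bc binz_N1.
have lN0 : (l + 1)%:~R != 0 :> F by rewrite intr_eq0; lia.
apply: (mulfI lN0).
have := lc_deriv (b - 1) (l + 1) (-1); rewrite addNr mul0r subrK addrK.
move/esym/eqP; rewrite addrC addr_eq0 => /eqP ->.
have h2 := bc_top F (l + 1) (b + l); rewrite addrK in h2.
have -> : b + l = (b - 1) + (l + 1) by lia.
have e2 : l + 1 - ((b - 1) + (l + 1)) = - (b - 1) by lia.
rewrite (_ : b + l = (b - 1) + (l + 1)) in h2; last by lia.
rewrite e2 rmorphN mulNr in h2; rewrite -h2.
case: (ltP 0 (b - 1)) => hb1; first by rewrite IHk //; lia.
by rewrite (_ : b - 1 = 0) ?mul0r //; lia.
Qed.

End LaurentCoefficients.

Section KernelIdentity.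
Variable F : numFieldType.
Implicit Types a b l m n p q : int.

Lemma bc_next m i : (i + 1)%:~R * bc F m (i + 1) = (i - m)%:~R * bc F m i.
Proof.
rewrite bc_abs addrK -[i - m]opprB rmorphN !mulNr; congr (- _).
by rewrite -bc_top.
Qed.

Lemma natz1_neq0 (r : nat) : (r%:Z + 1)%:~R != 0 :> F.
Proof. by rewrite intr_eq0; lia. Qed.

(** Both sides are the coefficient of [z1^(j-r) z2^r] in
    [exp(a(z1-z2)) (exp(z1-z2)-1)^l], expanded for |z1| > |z2|; on the right
    the factor [exp(z1-z2)-1 = exp(-z2)(t1-t2)] is expanded in powers of
    [t1-1] and [t2-1]. *)
Lemma kernel_taylor a l (r j : int) :
  bc F j r * lc F a l j =
  zsum (fun i => bc F l i * (lc F a (l - i) (j - r) * lc F (- a - l) i r)).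
Proof.
case: r => r; last first.
  rewrite bc_lt0 // mul0r zsum0 // => i; case: (ltP i 0) => hi.
    by rewrite bc_lt0 ?mul0r.
  by rewrite [lc _ _ i _]lc_lt ?mulr0 //; lia.
set c := - a - l.
have sup r0 j0 : zsupp 0 r0%:Z
    (fun i => bc F l i * (lc F a (l - i) j0 * lc F c i r0%:Z)).
  move=> i hi; case: (ltP i 0) => hi0; first by rewrite bc_lt0 ?mul0r.
  by rewrite [lc _ _ i _]lc_lt ?mulr0 //; lia.
elim: r j => [|r IHr] j.
  rewrite (@zsum1 _ 0) => [|i hi]; last by apply: (sup 0%N); lia.
  by rewrite !bc0 !subr0 lc_diag mulr1.
apply: (mulfI (natz1_neq0 r)).
have -> : r.+1%:Z = r%:Z + 1 by lia.
rewrite mulrA bc_next -mulrA IHr.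
set n' := j - (r%:Z + 1); have ej : j - r%:Z = n' + 1 by rewrite /n'; lia.
rewrite -[r%:Z - j]opprB rmorphN /= mulNr ej -!zsumMl; last 2 first.
- by exists 0, r.+1%:Z; move=> i hi; rewrite sup //; lia.
- by exists 0, r%:Z => i hi; rewrite -ej sup.
pose f1 i := bc F l i * lc F a (l - i) n' * ((c + i)%:~R * lc F c i r).
pose f2 i := i%:~R * bc F l i * lc F a (l - i) n' * lc F c (i - 1) r.
have f1f : zfin f1.
  exists 0, r%:Z => i hi; have := @sup r j i hi; rewrite /f1.
  case: (ltP i 0) => hi0; first by rewrite bc_lt0 ?mul0r.
  by rewrite [lc _ c i _]lc_lt ?mulr0 //; lia.
have f2f : zfin f2.
  exists 0, (r%:Z + 1) => i hi; rewrite /f2.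
  case: (ltP i 0) => hi0; first by rewrite bc_lt0 ?(mul0r, mulr0).
  by rewrite [lc _ c _ _]lc_lt ?mulr0 //; lia.
transitivity (zsum (fun i => f1 i + f2 i)); last first.
  apply: eq_zsum => i; have := lc_deriv F c i r.
  have := lc_step F c (i - 1) r; rewrite subrK => -> h.
  transitivity (bc F l i * lc F a (l - i) n' * ((r%:Z + 1)%:~R * lc F c i (r%:Z + 1))).
    by rewrite h /f1 /f2 intrD; ring.
  ring.
rewrite zsumD // [zsum f2](zsum_shift 1) -zsumD //; last first.
  by case: f2f => lo [hi fs]; exists (lo - 1), (hi - 1) => i h; apply: fs; lia.
rewrite -(@zsumN _ F^o); last first.
  by exists 0, r%:Z => i hi; rewrite -ej sup // mulr0.
apply: eq_zsum => i; rewrite /f1 /f2 bc_next addrK.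
have := lc_deriv F a (l - i) n'; have := lc_step F a (l - i - 1) n'.
rewrite subrK (_ : l - (i + 1) = l - i - 1); last by lia.
move=> -> h.
transitivity (- bc F l i * ((n' + 1)%:~R * lc F a (l - i) (n' + 1)) * lc F c i r).
  ring.
by rewrite h /c !(intrD, rmorphN, rmorphB) /=; ring.
Qed.

(** The coefficient of [z1^p z2^q] in the same expansion multiplied by [exp((a+b+l) z2)
    (exp(z2)-1)^n]. *)
Lemma kernel_prod a b l n p q :
  zsum (fun r => bc F (p + r) r * (lc F a l (p + r) * lc F (a + b + l) n (q - r)))
  = zsum (fun i => bc F l i * (lc F a (l - i) p * lc F b (n + i) q)).
Proof.
set A := a + b + l; set c := - a - l.
transitivity (zsum (fun r => zsum (fun i =>
    bc F l i * lc F a (l - i) p * (lc F c i r * lc F A n (q - r))))).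
  apply: eq_zsum => r; rewrite mulrA kernel_taylor addrK mulrC -zsumMl.
    by apply: eq_zsum => i; rewrite -/c; ring.
  exists 0, r => i hi; case: (ltP i 0) => hi0; first by rewrite bc_lt0 ?mul0r.
  by rewrite [lc _ _ i _]lc_lt ?mulr0 //; lia.
rewrite zsum_exch; last first.
  exists (Num.min 0 0), (Num.max 0 (q - n)) => r i hi.
  case: (ltP i 0) => hi0; first by rewrite bc_lt0 ?mul0r.
  case: (ltP r i) => hir; first by rewrite [lc _ c i _]lc_lt ?mul0r ?mulr0 //; lia.
  by rewrite [lc _ A _ _]lc_lt ?mulr0 //; lia.
apply: eq_zsum => i; rewrite zsumMl; last exact: zfin_lcM.
rewrite -lc_mul (_ : c + A = b); last by rewrite /c /A; lia.
by rewrite mulrA (addrC i).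
Qed.

End KernelIdentity.

(** * Expansions at infinity *)

Section ExpansionAtInfinity.
Variables (F : numFieldType) (X : lmodType F).
Implicit Types (a m n p q : int) (C : int -> X).

(** If [C p] is the coefficient of [t^(-p)] in a Laurent series R(t) in
    [t^(-1)], this is the coefficient of [t^0] in [t^a (t-1)^m R(t)]. *)
Definition atinf m a C : X := zsum (fun i => bc F m i *: C (a + m - i)).

Definition lowb (lo : int) C := forall p, p < lo -> C p = 0.

Lemma atinf_supp lo m a C : lowb lo C ->
  zsupp 0 (a + m - lo) (fun i => bc F m i *: C (a + m - i)).
Proof.
move=> Cl i hi; case: (ltP i 0) => hi0; first by rewrite bc_lt0 ?scale0r.
by rewrite Cl ?scaler0 //; lia.
Qed.

Lemma atinf_fin lo m a C : lowb lo C ->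
  zfin (fun i => bc F m i *: C (a + m - i)).
Proof. by move=> Cl; exists 0, (a + m - lo); exact: atinf_supp. Qed.

Lemma atinf_lt lo m a C : lowb lo C -> a + m < lo -> atinf m a C = 0.
Proof. by move=> Cl h; apply: zsum0 => i; apply: (atinf_supp Cl); lia. Qed.

Lemma atinf0 a C : atinf 0 a C = C a.
Proof.
rewrite /atinf (@zsum1 _ 0) => [|i hi].
  by rewrite bc0 scale1r addr0 subr0.
case: i hi => [[//|i]|i] _; last by rewrite bc_lt0 ?scale0r.
by rewrite /bc /binz big_ord_recl subr0 !mul0r mulr0 scale0r.
Qed.

Lemma atinf_step lo m a C : lowb lo C ->
  atinf (m + 1) a C = atinf m (a + 1) C - atinf m a C.
Proof.
move=> Cl; rewrite /atinf; have h : a + (m + 1) = a + 1 + m by lia.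
rewrite [X in _ - X](zsum_shift (-1)) -zsumB.
- apply: eq_zsum => i; rewrite bc_pascal scalerBl h; congr (_ - _ *: C _); lia.
- exact: atinf_fin Cl.
- have [l [u s]] := atinf_fin m a Cl.
  by exists (l + 1), (u + 1) => i hi; apply: s; lia.
Qed.

Lemma atinf_abs lo m a C : lowb lo C ->
  atinf m a (fun p => p%:~R *: C p)
  = a%:~R *: atinf m a C + m%:~R *: atinf (m - 1) (a + 1) C.
Proof.
move=> Cl; have f1 := atinf_fin m a Cl; have f2 := atinf_fin (m - 1) (a + 1) Cl.
rewrite /atinf -(zsumZ _ f1) -(zsumZ _ f2) -zsumD; try exact: zfinZ.
apply: eq_zsum => i; rewrite !scalerA -bc_top (_ : a + 1 + (m - 1) = a + m); last lia.
by rewrite -scalerDl; congr (_ *: _); rewrite -!addrA !intrD; ring.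
Qed.

Lemma atinf_eq m a C C' : C =1 C' -> atinf m a C = atinf m a C'.
Proof. by move=> e; apply: eq_zsum => i; rewrite e. Qed.

Lemma atinfD m a lo (C C' : int -> X) : lowb lo C -> lowb lo C' ->
  atinf m a (fun p => C p + C' p) = atinf m a C + atinf m a C'.
Proof.
move=> Cl Cl'; rewrite /atinf -zsumD.
- by apply: eq_zsum => i; rewrite scalerDr.
- exact: atinf_fin Cl.
- exact: atinf_fin Cl'.
Qed.

Lemma lowb_widen lo lo' (C : int -> X) : lowb lo C -> lo' <= lo -> lowb lo' C.
Proof. by move=> Cl h p hp; apply: Cl; lia. Qed.

Lemma atinf_lin m a lo (C C' : int -> X) (x y : F) : lowb lo C -> lowb lo C' ->
  atinf m a (fun p => x *: C p + y *: C' p) = x *: atinf m a C + y *: atinf m a C'.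
Proof.
move=> Cl Cl'; have h := atinf_fin m a Cl; have h' := atinf_fin m a Cl'.
rewrite /atinf -(zsumZ _ h) -(zsumZ _ h') -zsumD; try exact: zfinZ.
apply: eq_zsum => i; rewrite scalerDr !scalerA.
by rewrite [x * _]mulrC [y * _]mulrC.
Qed.

Lemma lowb_mulint lo (C : int -> X) : lowb lo C -> lowb lo (fun p => p%:~R *: C p).
Proof. by move=> Cl p hp; rewrite Cl ?scaler0. Qed.

Lemma atinf_diff l a lo (C : int -> X) : lowb lo C ->
  atinf l a (fun j => C (j + 1) - C j) = atinf (l + 1) a C.
Proof.
move=> Cl; rewrite (atinf_step _ _ Cl) /atinf -zsumB; last exact: atinf_fin Cl.
  by apply: eq_zsum => i; rewrite scalerBr; congr (_ *: C _ - _); lia.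
by have := atinf_fin l (a + 1) Cl.
Qed.

Lemma atinf_comp (k : nat) l a lo (C : int -> X) : lowb lo C ->
  atinf l a (fun j => atinf k j C) = atinf (k%:Z + l) a C.
Proof.
move=> Cl; elim: k l => [|k IHk] l.
  by rewrite add0r; apply: atinf_eq => j; rewrite atinf0.
transitivity (atinf l a (fun j => atinf k (j + 1) C - atinf k j C)).
  by apply: atinf_eq => j; rewrite -(atinf_step _ _ Cl) -addn1 PoszD.
have Dl : lowb (lo - k%:Z) (fun j => atinf k j C).
  by move=> j hj; apply: (atinf_lt Cl); lia.
rewrite (atinf_diff _ _ Dl) IHk -addn1 PoszD; congr atinf; lia.
Qed.

Lemma lowb_ind (P : int -> Prop) lo : (forall p, p < lo -> P p) ->
  (forall p, (forall p', p' < p -> P p') -> P p) -> forall p, P p.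
Proof.
move=> Plo Pst p; have [n hn] : exists n : nat, p < lo + n%:Z.
  by exists (absz (p - lo)%R).+1; lia.
elim: n p hn => [|n IHn] p hp; first by apply: Plo; lia.
by apply: Pst => p' hp'; apply: IHn; lia.
Qed.

(** The system is triangular: the leading coefficient [bc m 0] is 1. *)
Lemma atinf_uniq lo a P C : lowb lo C ->
  (forall m, a + m <= P -> atinf m a C = 0) -> forall p, p <= P -> C p = 0.
Proof.
move=> Cl h; apply: (lowb_ind (lo := lo)) => [p hp _|p IHp hp]; first exact: Cl.
have := h (p - a); rewrite /atinf (@zsum1 _ 0).
  rewrite bc0 scale1r => e; have h2 : a + (p - a) - 0 = p by lia.
  by rewrite h2 in e; apply: e; lia.
move=> i hi; case: (ltP i 0) => hi0; first by rewrite bc_lt0 ?scale0r.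
by rewrite IHp ?scaler0 //; lia.
Qed.

(** Multiplication by [t = 1 + (t-1)] raises [a]. *)
Lemma atinf_up lo m a0 C (e : int -> int -> X) : lowb lo C ->
  (forall a m, e (a + 1) m = e a m + e a (m + 1)) ->
  (forall m, e a0 m = atinf m a0 C) ->
  forall a, a0 <= a -> e a m = atinf m a C.
Proof.
move=> Cl e1 e0 a ha; have [n ->] : exists n : nat, a = a0 + n%:Z.
  by exists (absz (a - a0)%R); lia.
elim: n m {ha} => [|n IHn] m; first by rewrite addr0.
rewrite (_ : a0 + n.+1%:Z = a0 + n%:Z + 1); last by lia.
by rewrite e1 !IHn (atinf_step _ _ Cl) addrC subrK.
Qed.

(** Binomial coefficients without sign: the expansion of [t^m] at infinity in
    powers of [t-1]. *)
Definition bp m i : F := if i is Posz k then binz F m k else 0.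

Lemma bp_lt0 m i : i < 0 -> bp m i = 0. Proof. by case: i. Qed.

Lemma bp00 i : bp 0 i = (i == 0)%:R.
Proof.
case: i => [[|k]|k] //; first by rewrite /bp binz0.
by rewrite /bp /binz big_ord_recl subr0 !mul0r.
Qed.

Lemma bp_pascal m i : bp (m + 1) i = bp m i + bp m (i - 1).
Proof.
case: i => [[|k]|k]; last by rewrite !bp_lt0 ?addr0 //; lia.
  by rewrite [bp _ (0 - 1)]bp_lt0 ?addr0 // /bp !binz0.
have -> : (k.+1%:Z - 1 : int) = k%:Z by lia.
by rewrite /bp binz_pascal.
Qed.

Lemma bc_bp m k :
  zsum (fun i => bc F m i * bp (m - i) (k - i)) = (k == 0)%:R.
Proof.
have sup m' (k' : int) : zsupp 0 k' (fun i => bc F m' i * bp (m' - i) (k' - i)).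
  move=> i hi; case: (ltP i 0) => hi0; first by rewrite bc_lt0 ?mul0r.
  by rewrite bp_lt0 ?mulr0 //; lia.
have st m' : zsum (fun i => bc F (m' + 1) i * bp (m' + 1 - i) (k - i))
           = zsum (fun i => bc F m' i * bp (m' - i) (k - i)).
  transitivity (zsum (fun i => bc F m' i * bp (m' + 1 - i) (k - i)
        - bc F m' (i - 1) * bp (m' - (i - 1)) (k - i))).
    apply: eq_zsum => i; rewrite bc_pascal mulrBl; congr (_ - _ * bp _ _); lia.
  have s1 : zfin (fun i => bc F m' i * bp (m' + 1 - i) (k - i)).
    exists 0, k => i hi; case: (ltP i 0) => hi0; first by rewrite bc_lt0 ?mul0r.
    by rewrite bp_lt0 ?mulr0 //; lia.
  have s2 : zfin (fun i => bc F m' i * bp (m' - i) (k - 1 - i)).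
    exists 0, k => i hi; case: (ltP i 0) => hi0; first by rewrite bc_lt0 ?mul0r.
    by rewrite bp_lt0 ?mulr0 //; lia.
  rewrite (@zsumB _ F^o) //; last first.
    case: s2 => lo [up s2]; exists (lo + 1), (up + 1) => i hi.
    by have := s2 (i - 1); rewrite (_ : k - 1 - (i - 1) = k - i); [apply; lia|lia].
  rewrite [X in _ - X](zsum_shift 1) -(@zsumB _ F^o) //; last first.
    case: s2 => lo [up s2]; exists lo, up => i hi.
    by have := s2 i hi; rewrite addrK (_ : k - 1 - i = k - (i + 1)) //; lia.
  apply: eq_zsum => i; rewrite addrK -mulrBr; congr (_ * _).
  rewrite (_ : m' + 1 - i = m' - i + 1); last by lia.
  by rewrite bp_pascal (_ : k - (i + 1) = k - i - 1) ?addrK //; lia.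
have e0 : zsum (fun i => bc F 0 i * bp (0 - i) (k - i)) = (k == 0)%:R.
  rewrite (@zsum1 _ 0) => [|i hi].
    by rewrite bc0 mul1r !subr0 bp00.
  case: i hi => [[//|i]|i] _; last by rewrite bc_lt0 ?mul0r.
  by rewrite /bc /binz big_ord_recl subr0 !mul0r mulr0 mul0r.
pose G m' := zsum (fun i => bc F m' i * bp (m' - i) (k - i)).
have Gp (n : nat) m' : G (m' + n%:Z) = G m'.
  elim: n => [|n IHn]; first by rewrite addr0.
  by rewrite -addn1 PoszD addrA /G st -/(G _) IHn.
rewrite -e0 -/(G m) -/(G 0); case: m => n; first by rewrite -(Gp n 0) add0r.
by rewrite -(Gp n.+1 (Negz n)) NegzE addNr.
Qed.

(** The Laurent series in [t^(-1)] whose products with the [t^a (t-1)^m] have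
    the constant terms [e m]. *)
Definition infcoef a (e : int -> X) p : X :=
  zsum (fun i => bp (p - a) i *: e (p - a - i)).

Lemma infcoef_supp a lo (e : int -> X) p : (forall m, a + m < lo -> e m = 0) ->
  zsupp 0 (p - lo) (fun i => bp (p - a) i *: e (p - a - i)).
Proof.
move=> e0 i hi; case: (ltP i 0) => hi0; first by rewrite bp_lt0 ?scale0r.
by rewrite e0 ?scaler0 //; lia.
Qed.

Lemma infcoef_lowb a lo (e : int -> X) : (forall m, a + m < lo -> e m = 0) ->
  lowb lo (infcoef a e).
Proof. by move=> e0 p hp; apply: zsum0 => i; apply: (infcoef_supp e0); lia. Qed.

Lemma infcoefP a lo (e : int -> X) : (forall m, a + m < lo -> e m = 0) ->
  forall m, atinf m a (infcoef a e) = e m.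
Proof.
move=> e0 m; rewrite /atinf /infcoef.
transitivity (zsum (fun i => zsum (fun j => (bc F m i * bp (m - i) (j - i)) *: e (m - j)))).
  apply: eq_zsum => i; rewrite -zsumZ; last by exists 0, (a + m - i - lo); exact: infcoef_supp.
  rewrite (zsum_shift (- i)); apply: eq_zsum => j; rewrite scalerA.
  by congr (_ * bp _ _ *: e _); lia.
rewrite zsum_exch; last first.
  exists (Num.min 0 (a + m - lo)), (Num.max 0 (a + m - lo)) => i j hi.
  case: (ltP i 0) => hi0; first by rewrite bc_lt0 ?mul0r ?scale0r.
  case: (ltP j i) => hj; first by rewrite bp_lt0 ?mulr0 ?scale0r //; lia.
  by rewrite e0 ?scaler0 //; lia.
rewrite (@zsum1 _ 0) => [|j hj].
  rewrite zsumZl; last first.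
    exists 0, 0 => i hi; case: (ltP i 0) => hi0; first by rewrite bc_lt0 ?mul0r.
    by rewrite bp_lt0 ?mulr0 //; lia.
  by rewrite bc_bp eqxx scale1r subr0.
rewrite zsumZl; last first.
  exists 0, j => i hi; case: (ltP i 0) => hi0; first by rewrite bc_lt0 ?mul0r.
  by rewrite bp_lt0 ?mulr0 //; lia.
by rewrite bc_bp (negPf hj) scale0r.
Qed.

(** The residue theorem on the projective line, for the differential forms
    [t^a (t-1)^m R(t) dt/t]: [eu] gives the residues at 1, [C1 p] is the
    coefficient of [t^(-p)] in R at infinity and [s C2 p] that of [t^(p-q)] in R
    at 0. For [a] large there is no pole at 0, for [a + m] small there is none at
    infinity, and the symmetry [t |-> 1/t] exchanges the two cases, which cover
    all [a] when [m] is small enough. The other forms are differences of such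
    forms, since multiplication by [t-1] raises [m]. *)
Lemma residue_theorem (s : F) q a0 lo (eu ev : int -> int -> X) (C1 C2 : int -> X) :
  s * s = 1 ->
  (forall a m, eu (a + 1) m = eu a m + eu a (m + 1)) ->
  (forall a m, ev a m = (- s * (-1) ^ m) *: eu (q - a - m) m) ->
  lowb lo C1 -> lowb lo C2 ->
  (forall a m, a0 <= a -> eu a m = atinf m a C1) ->
  (forall a m, a0 <= a -> ev a m = atinf m a C2) ->
  forall a m, eu a m = atinf m a C1 - (s * (-1) ^ m) *: atinf m (q - a - m) C2.
Proof.
move=> ss eu1 sk l1 l2 h1 h2.
pose d a m := eu a m - (atinf m a C1 - (s * (-1) ^ m) *: atinf m (q - a - m) C2).
suff d0 : forall a m, d a m = 0 by move=> a m; exact: subr0_eq (d0 a m).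
have dst a m : d a (m + 1) = d (a + 1) m - d a m.
  have -> : d a (m + 1) = (eu (a + 1) m - eu a m) -
    ((atinf m (a + 1) C1 - (s * (-1) ^ m) *: atinf m (q - (a + 1) - m) C2) -
     (atinf m a C1 - (s * (-1) ^ m) *: atinf m (q - a - m) C2)).
    rewrite /d (atinf_step _ _ l1); congr (_ - _).
      by rewrite eu1 [RHS]addrC addKr.
    rewrite [RHS]subACA -scalerBr; congr (_ - _).
    rewrite (_ : q - a - (m + 1) = q - (a + 1) - m); last by lia.
    rewrite (atinf_step _ _ l2) (_ : q - (a + 1) - m + 1 = q - a - m); last by lia.
    rewrite exprzDr ?unitrN1 // expr1z mulrN1 mulrN scaleNr -scalerN.
    by rewrite opprB.
  by rewrite /d subACA.
have sk' a m : eu a m = (- s * (-1) ^ m) *: ev (q - a - m) m.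
  have c1 : (- s * (-1) ^ m) * (- s * (-1) ^ m) = 1.
    by transitivity ((s * s) * ((-1) ^ m * (-1) ^ m)); [ring|rewrite ss signz_sqr mul1r].
  by rewrite sk scalerA c1 scale1r; congr eu; lia.
pose a1 := Num.max a0 (q - lo + 1).
have big a m : a1 <= a -> d a m = 0.
  move=> ha; rewrite /d (atinf_lt l2); last by lia.
  by rewrite scaler0 subr0 h1 ?subrr //; lia.
have small a m : a1 <= q - a - m -> d a m = 0.
  move=> ha; rewrite /d (atinf_lt l1); last by lia.
  rewrite sub0r opprK sk' h2; last by lia.
  by rewrite -scalerDl mulNr addNr scale0r.
have dn (n : nat) b m : m + 2 * a1 - q <= n%:Z -> d b m = 0.
  elim: n b m => [|n IHn] b m hm.
    by case: (leP a1 b) => hb; [exact: big|apply: small; lia].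
  case: (leP (m + 2 * a1 - q) n%:Z) => hm'; first exact: IHn.
  by rewrite -(subrK 1 m) dst !IHn ?subrr //; lia.
by move=> a m; apply: (dn (absz (m + 2 * a1 - q)%R)); lia.
Qed.

(** Two expansions of [t1^(s-m) t2^b (t2-1)^n (t1-t2)^m] at [t1] infinite, where
    [c s b n] is the value of a linear functional on [t1^s t2^b (t2-1)^n]: on the
    left [t1-t2] is expanded in powers of [t1] and [t2], on the right in powers
    of [t1-1] and [t2-1], and then [t1-1] in powers of [t1]. Both satisfy the
    recursion in [m] that expresses multiplication by [t1-t2]. *)
Lemma expand_difference (c : int -> int -> int -> X) lo m s b n :
  (forall s b n, s < lo -> c s b n = 0) ->
  (forall s b n, c s (b + 1) n = c s b n + c s b (n + 1)) ->
  zsum (fun i => bc F m i *: c (s - i) (b + i) n) =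
  zsum (fun h => bc F m h *: zsum (fun i => bc F (m - h) i *: c (s - h - i) b (n + h))).
Proof.
move=> c0 c1.
have sL m' s' b' n' : zsupp 0 (s' - lo) (fun i => bc F m' i *: c (s' - i) (b' + i) n').
  move=> i hi; case: (ltP i 0) => hi0; first by rewrite bc_lt0 ?scale0r.
  by rewrite c0 ?scaler0 //; lia.
have sI m' s' b' n' : zsupp 0 (s' - lo) (fun i => bc F m' i *: c (s' - i) b' n').
  move=> i hi; case: (ltP i 0) => hi0; first by rewrite bc_lt0 ?scale0r.
  by rewrite c0 ?scaler0 //; lia.
pose I m' s' b' n' := zsum (fun i => bc F m' i *: c (s' - i) b' n').
pose L m' s' b' n' := zsum (fun i => bc F m' i *: c (s' - i) (b' + i) n').
pose R m' s' b' n' := zsum (fun h => bc F m' h *: I (m' - h) (s' - h) b' (n' + h)).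
have sR f m' s' b' n' : zsupp 0 (s' - lo)
    (fun h => bc F m' h *: I (f h) (s' - h) b' (n' + h)).
  move=> i hi; case: (ltP i 0) => hi0; first by rewrite bc_lt0 ?scale0r.
  rewrite /I zsum0 ?scaler0 // => j; apply: sI; lia.
suff : L m s b n = R m s b n by [].
have fL m' s' b' n' : zfin (fun i => bc F m' i *: c (s' - i) (b' + i) n').
  by exists 0, (s' - lo); exact: sL.
have fI m' s' b' n' : zfin (fun i => bc F m' i *: c (s' - i) b' n').
  by exists 0, (s' - lo); exact: sI.
have fR f m' s' b' n' :
    zfin (fun h => bc F m' h *: I (f h) (s' - h) b' (n' + h)).
  by exists 0, (s' - lo); exact: sR.
have shl (f : int -> X) : zfin f -> zfin (fun i => f (i - 1)).
  by move=> [l [u fs]]; exists (l + 1), (u + 1) => i hi; apply: fs; lia.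
have Ist m' s' b' n' : I (m' + 1) s' b' n' = I m' s' b' n' - I m' (s' - 1) b' n'.
  rewrite /I [X in _ - X](zsum_shift (-1)) -zsumB; last 2 first.
  - exact: (fI m' s' b' n').
  - exact: (shl _ (fI m' (s' - 1) b' n')).
  apply: eq_zsum => i; rewrite bc_pascal scalerBl; congr (_ - _ *: c _ _ _); lia.
have Lst m' s' b' n' : L (m' + 1) s' b' n' = L m' s' b' n' - L m' (s' - 1) (b' + 1) n'.
  rewrite /L [X in _ - X](zsum_shift (-1)) -zsumB; last 2 first.
  - exact: (fL m' s' b' n').
  - exact: (shl _ (fL m' (s' - 1) (b' + 1) n')).
  apply: eq_zsum => i; rewrite bc_pascal scalerBl; congr (_ - _ *: c _ _ _); lia.
have I1 m' s' b' n' : I m' s' (b' + 1) n' = I m' s' b' n' + I m' s' b' (n' + 1).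
  rewrite /I -zsumD; first by apply: eq_zsum => i; rewrite c1 scalerDr.
    exact: (fI m' s' b' n').
  exact: (fI m' s' b' (n' + 1)).
have R1 m' s' b' n' : R m' s' (b' + 1) n' = R m' s' b' n' + R m' s' b' (n' + 1).
  rewrite /R -zsumD; last 2 first.
  - exact: (fR (fun h => m' - h) m' s' b' n').
  - exact: (fR (fun h => m' - h) m' s' b' (n' + 1)).
  apply: eq_zsum => i; rewrite I1 scalerDr; congr (_ + _ *: I _ _ _ _); lia.
have Rst m' s' b' n' : R (m' + 1) s' b' n' = R m' s' b' n' - R m' (s' - 1) (b' + 1) n'.
  transitivity (zsum (fun h => bc F m' h *: I (m' - h) (s' - h) b' (n' + h))
    - zsum (fun h => bc F m' h *: I (m' - h) (s' - 1 - h) b' (n' + h))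
    - zsum (fun h => bc F m' h *: I (m' - h) (s' - 1 - h) b' (n' + 1 + h))).
    rewrite [X in _ - X](zsum_shift (-1)) -zsumB; last 2 first.
    - exact: (fR (fun h => m' - h) m' s' b' n').
    - exact: (fR (fun h => m' - h) m' (s' - 1) b' n').
    rewrite -zsumB; last 2 first.
    - case: (fR (fun h => m' - h) m' s' b' n') => l1 [u1 s1].
      case: (fR (fun h => m' - h) m' (s' - 1) b' n') => l2 [u2 s2].
      exists (Num.min l1 l2), (Num.max u1 u2) => i hi.
      by rewrite s1 ?s2 ?subr0 //; lia.
    - exact: (shl _ (fR (fun h => m' - h) m' (s' - 1) b' (n' + 1))).
    apply: eq_zsum => i; rewrite bc_pascal scalerBl; congr (_ - _ *: I _ _ _ _); try lia.
    rewrite -scalerBr (_ : m' + 1 - i = m' - i + 1); last by lia.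
    by rewrite Ist (_ : s' - i - 1 = s' - 1 - i) //; lia.
  by rewrite R1 opprD addrA.
have e0 s' b' n' : L 0 s' b' n' = R 0 s' b' n'.
  have b0 i : i != 0 -> bc F 0 i = 0.
    case: i => [[//|i]|i] _; last by rewrite bc_lt0.
    by rewrite /bc /binz big_ord_recl subr0 !mul0r mulr0.
  rewrite /L (@zsum1 _ 0) => [|i hi]; last by rewrite b0 ?scale0r.
  rewrite /R (@zsum1 _ 0) => [|i hi]; last by rewrite b0 ?scale0r.
  rewrite /I (@zsum1 _ 0) => [|i hi]; last by rewrite subr0 b0 ?scale0r.
  by rewrite !(subr0, addr0) !bc0 !scale1r.
case: m => k.
  by elim: k s b n => [|k IHk] s' b' n'; [exact: e0|rewrite -addn1 PoszD Lst Rst !IHk].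
rewrite NegzE; elim: {k}k.+1 s b n => [|k IHk]; first exact: e0.
apply: (lowb_ind (lo := lo)) => [s' hs' b' n'|s' IHs b' n'].
  rewrite /L zsum0 => [|i]; last by apply: (sL (- k.+1%:Z) s'); lia.
  rewrite /R zsum0 // => i.
  by apply: (sR (fun h => - k.+1%:Z - h) (- k.+1%:Z) s'); lia.
have hk : - k%:Z = - k.+1%:Z + 1 by lia.
have := Lst (- k.+1%:Z) s' b' n'; have := Rst (- k.+1%:Z) s' b' n'.
rewrite -hk -IHk => -> /eqP; rewrite (IHs (s' - 1)); last by lia.
by rewrite (inj_eq (addIr _)) => /eqP ->.
Qed.

End ExpansionAtInfinity.

Section TripleSums.
Variable M : nmodType.
Implicit Types f : int -> int -> int -> M.

Definition zfin3 f := exists lo hi : int, forall k j r,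
  ~~ [&& lo <= k, k <= hi, lo <= j, j <= hi, lo <= r & r <= hi] -> f k j r = 0.

Lemma zfin3_2 f k : zfin3 f -> zfin2 (f k).
Proof. by move=> [lo [hi fs]]; exists lo, hi => j r h; apply: fs; lia. Qed.

Lemma zsum3_rot f : zfin3 f ->
  zsum (fun k => zsum (fun j => zsum (fun r => f k j r))) =
  zsum (fun r => zsum (fun k => zsum (fun j => f k j r))).
Proof.
move=> ff; transitivity (zsum (fun k => zsum (fun r => zsum (fun j => f k j r)))).
  by apply: eq_zsum => k; apply: zsum_exch; exact: zfin3_2.
apply: zsum_exch; case: ff => lo [hi fs]; exists lo, hi => k r h.
by apply: zsum0 => j; apply: fs; lia.
Qed.

(** Reindexing by [p = j - r] and [q = k + r]. *)
Lemma zsum3_shift f : zfin3 f ->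
  zsum (fun k => zsum (fun j => zsum (fun r => f k j r))) =
  zsum (fun q => zsum (fun p => zsum (fun r => f (q - r) (p + r) r))).
Proof.
move=> ff; rewrite zsum3_rot // [RHS]zsum3_rot; last first.
  case: ff => lo [hi fs].
  exists (Num.min (Num.min (lo + lo) (lo - hi)) lo),
         (Num.max (Num.max (hi + hi) (hi - lo)) hi) => q p r h.
  by apply: fs; lia.
apply: eq_zsum => r; rewrite (zsum_shift (- r)); apply: eq_zsum => q.
by rewrite (zsum_shift r).
Qed.

(** Reindexing by [q = k + j - r]. *)
Lemma zsum3_shear f : zfin3 f ->
  zsum (fun k => zsum (fun j => zsum (fun r => f k j r))) =
  zsum (fun q => zsum (fun p => zsum (fun r => f (q - r) (p + r) p))).
Proof.
move=> ff; rewrite zsum3_rot //.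
case: ff => lo [hi fs].
transitivity (zsum (fun p => zsum (fun j => zsum (fun q => f (q + p - j) j p)))).
  apply: eq_zsum => p; rewrite zsum_exch; last first.
    by exists lo, hi => i j h; apply: fs; lia.
  apply: eq_zsum => j; rewrite (zsum_shift (p - j)); apply: eq_zsum => q.
  by congr f; lia.
transitivity (zsum (fun p => zsum (fun q => zsum (fun j => f (q + p - j) j p)))).
  apply: eq_zsum => p; apply: zsum_exch.
  exists (Num.min lo (lo + lo - hi)), (Num.max hi (hi + hi - lo)) => i j h.
  by apply: fs; lia.
rewrite zsum_exch; last first.
  exists (Num.min lo (lo + lo - hi)), (Num.max hi (hi + hi - lo)) => i j h.
  by apply: zsum0 => k; apply: fs; lia.
apply: eq_zsum => q; apply: eq_zsum => p; rewrite (zsum_shift p).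
by apply: eq_zsum => r; congr f; lia.
Qed.

End TripleSums.

Section KernelIdentity2.
Variable F : numFieldType.

(** The analogue of [kernel_prod] for the expansion for |z2| > |z1|. *)
Lemma kernel_prod_swap (a b l n p q : int) :
  zsum (fun r => bc F (p + r) p *
    ((-1) ^ (p + r) * lc F a l (p + r) * lc F (a + b + l) n (q - r)))
  = (-1) ^ l * zsum (fun i => bc F l i * (lc F b (n + l - i) q * lc F a i p)).
Proof.
set A := a + b + l; set a' := - a - l.
have supi r : zsupp 0 p (fun i => bc F l i * (lc F a' (l - i) r * lc F a i p)).
  move=> i hi; case: (ltP i 0) => hi0; first by rewrite bc_lt0 ?mul0r.
  by rewrite [lc _ _ i _]lc_lt ?mulr0 //; lia.
transitivity (zsum (fun r => zsum (fun i => (-1) ^ l *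
    (bc F l i * lc F a i p * (lc F a' (l - i) r * lc F A n (q - r)))))).
  apply: eq_zsum => r; rewrite lc_flip -/a'.
  transitivity ((-1) ^ l * lc F A n (q - r) * (bc F (p + r) p * lc F a' l (p + r))); first ring.
  rewrite kernel_taylor (_ : p + r - p = r); last by lia.
  rewrite (_ : - a' - l = a); last by rewrite /a'; lia.
  rewrite -zsumMl; last by exists 0, p; exact: supi.
  by apply: eq_zsum => i; ring.
rewrite zsum_exch; last first.
  exists (Num.min (Num.min 0 (l - p)) p), (Num.max p (q - n)) => r i hi.
  case: (ltP i 0) => hi0; first by rewrite bc_lt0 ?mul0r ?mulr0.
  case: (ltP p i) => hip; first by rewrite [lc _ a i _]lc_lt // mulr0 mul0r mulr0.
  case: (ltP r (l - i)) => hr; first by rewrite [lc _ a' _ _]lc_lt // mul0r !mulr0.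
  by rewrite [lc _ A _ _]lc_lt ?mulr0 //; lia.
rewrite -zsumMl; last first.
  exists 0, p => i hi; case: (ltP i 0) => hi0; first by rewrite bc_lt0 ?mul0r.
  by rewrite [lc _ _ i _]lc_lt ?mulr0 //; lia.
apply: eq_zsum => i.
transitivity ((-1) ^ l * (bc F l i * lc F a i p) * zsum (fun r => lc F a' (l - i) r * lc F A n (q - r))).
  by rewrite -zsumMl; [apply: eq_zsum => r; ring|exact: zfin_lcM].
rewrite -lc_mul (_ : a' + A = b); last by rewrite /a' /A; lia.
rewrite (_ : l - i + n = n + l - i); last by lia.
ring.
Qed.

End KernelIdentity2.

(** * The vertex super-algebra in the coordinate [t = exp(z)] *)

Section VertexSuperalgebra.
Variables (F : numFieldType) (V : vertexSuperalgebra F).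
Implicit Types (u v w : V) (a b l m n : int).

Local Notation one := (vacuum V).

(** The residue of [t^a (t-1)^m Y(u,z)v dz], where [t = exp(z)]. *)
Definition expres a m u v : V := zsum (fun n => lc F a m n *: nprod u n v).

(** The translation operator. *)
Definition vder u : V := nprod u (-2) one.

Lemma vder_linear : linear vder.
Proof. exact: nprod_linearl. Qed.

Lemma vpar_ind (P : V -> Prop) : (forall x u, vpar x u -> P u) ->
  (forall u v, P u -> P v -> P (u + v)) -> forall u, P u.
Proof.
move=> Ph PD u; have [u0 [u1 [h0 h1 ->]]] := vpar_sum u.
by apply: PD; [exact: (Ph false)|exact: (Ph true)].
Qed.

Lemma nprod0l n v : nprod 0 n v = 0.
Proof. exact: (lin0 (nprod_linearl n v)). Qed.

Lemma nprod0r u n : nprod u n 0 = 0.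
Proof. exact: (lin0 (nprod_linearr u n)). Qed.

Lemma nprod_trunc_fin u (f : int -> V) : zfin f ->
  exists N : int, forall r p, N <= p -> nprod u p (f r) = 0.
Proof.
move=> [lo [hi fs]].
suff [N hN] : exists N : int, forall r p, r \in zrange lo hi -> N <= p ->
    nprod u p (f r) = 0.
  exists N => r p hp; case: (boolP (r \in zrange lo hi)) => [|hr]; first by move=> /hN; apply.
  by rewrite fs ?nprod0r // -mem_zrange.
elim: (zrange lo hi) => [|r s [N IHs]]; first by exists 0.
have [N' hN'] := nprod_trunc u (f r).
exists (Num.max N N') => r' p; rewrite inE => /orP[/eqP ->|hr] hp.
  by apply: hN'; lia.
by apply: IHs => //; lia.
Qed.

Lemma expres_fin a m u v : zfin (fun n => lc F a m n *: nprod u n v).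
Proof.
have [N hN] := nprod_trunc u v; exists m, N => n hn.
case: (ltP n m) => h; first by rewrite lc_lt ?scale0r.
by rewrite hN ?scaler0 //; lia.
Qed.

Lemma expres_linearl a m v : linear (fun u => expres a m u v).
Proof.
move=> k u u' /=; rewrite /expres -zsumZ; last exact: expres_fin.
rewrite -zsumD; last exact: expres_fin; last exact/zfinZ/expres_fin.
  apply: eq_zsum => n; rewrite (nprod_linearl n v) scalerDr !scalerA.
by rewrite [_ * k]mulrC.
Qed.

Lemma expres_linearr a m u : linear (expres a m u).
Proof.
move=> k v v'; rewrite /expres -zsumZ; last exact: expres_fin.
rewrite -zsumD; last exact: expres_fin; last exact/zfinZ/expres_fin.
  apply: eq_zsum => n; rewrite (nprod_linearr u n) scalerDr !scalerA.
by rewrite [_ * k]mulrC.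
Qed.

Lemma expres_step a m u v :
  expres (a + 1) m u v = expres a m u v + expres a (m + 1) u v.
Proof.
rewrite /expres -zsumD; try exact: expres_fin.
apply: eq_zsum => n; by rewrite lc_step scalerDl.
Qed.

Lemma expres_trunc u v :
  exists N : int, forall a m, N <= m -> expres a m u v = 0.
Proof.
have [N hN] := nprod_trunc u v; exists N => a m hm; apply: zsum0 => n.
case: (ltP n m) => h; first by rewrite lc_lt ?scale0r.
by rewrite hN ?scaler0 //; lia.
Qed.

(** For [m = 0] the right side of the Jacobi identity has a single term. *)
Lemma nprod_assoc (x y : bool) u v w l n : vpar x u -> vpar y v ->
  nprod (nprod u l v) n w =
  zsum (fun r => bc F l r *: nprod u (l - r) (nprod v (n + r) w))
  - ((-1) ^+ (x && y) * (-1) ^ l) *: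
    zsum (fun r => bc F l r *: nprod v (n + l - r) (nprod u r w)).
Proof.
move=> hu hv; have := vjacobi w l 0 n hu hv.
have [N1 h1] := nprod_trunc v w; have [N2 h2] := nprod_trunc u w.
rewrite (@natsum_zsum _ _ (absz (N1 - n)%R)) => [|i hi]; last first.
  by rewrite h1 ?nprod0r ?scaler0 //; lia.
rewrite (@natsum_zsum _ _ (absz N2)) => [|i hi]; last first.
  by rewrite h2 ?nprod0r ?scaler0 //; lia.
rewrite (@natsum_zsum _ _ 1%N) => [|i hi]; last first.
  by case: i hi => // i _; rewrite /binz big_ord_recl subr0 !mul0r scale0r.
move=> e; symmetry; move: e; rewrite [X in _ = X](@zsum1 _ 0); last first.
  case=> [[//|i]|//] _.
  by rewrite /binz big_ord_recl subr0 !mul0r scale0r.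
rewrite /= binz0 scale1r addr0 !add0r subr0 => <-; congr (_ - _).
  by apply: eq_zsum => -[i|i]; last by rewrite bc_lt0 ?scale0r.
rewrite -scalerA -zsumZ; last first.
  exists 0, N2 => i hi; case: (ltP i 0) => h; first by rewrite bc_lt0 ?scale0r.
  by rewrite h2 ?nprod0r ?scaler0 //; lia.
congr (_ *: _); apply: eq_zsum => -[i|i]; last by rewrite bc_lt0 ?scale0r ?scaler0.
by rewrite add0r scalerA /bc; congr (_ *: _); ring.
Qed.

Lemma bc_N2 i : bc F (-2) i = if 0 <= i then (i + 1)%:~R else 0.
Proof.
case: i => k; last by rewrite bc_lt0.
elim: k => [|k IHk]; first by rewrite bc0.
apply: (mulfI (natz1_neq0 F k)).
have := bc_next F (-2) k%:Z; rewrite (_ : k%:Z + 1 = k.+1%:Z); last by lia.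
move=> ->; rewrite IHk /= -!intrM; congr (_%:~R); lia.
Qed.

(** The iterate [(u_(-2) 1)_n], where the modes of the vacuum leave one term. *)
Lemma vder_nprod u n w : nprod (vder u) n w = (- n)%:~R *: nprod u (n - 1) w.
Proof.
elim/vpar_ind: u => [x u hu|u v hu hv]; last first.
  rewrite /vder (linD (nprod_linearl _ _)) !(linD (nprod_linearl _ _)).
  by rewrite -!/(vder _) hu hv scalerDr.
rewrite /vder (nprod_assoc w (-2) n hu (vacuum_even V)) andbF expr0 mul1r.
rewrite (@zsum1 _ (- 1 - n)) => [|i hi]; last first.
  by rewrite nprod_vacuuml ifN ?nprod0r ?scaler0 //; lia.
rewrite (@zsum1 _ (n - 1)) => [|i hi]; last first.
  by rewrite nprod_vacuuml ifN ?scaler0 //; lia.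
rewrite !nprod_vacuuml !ifT; [|lia|lia].
have -> : -2 - (- 1 - n) = n - 1 by lia.
rewrite scalerA -scalerBl; congr (_ *: _); rewrite !bc_N2.
have -> : (-1 : F) ^ (-2) = 1.
  have h := @exprzDr F (-1) (unitrN1 F) (-1) (-1).
  by rewrite signz_sqr in h; exact: h.
rewrite mul1r; case: (ltrgtP n 0) => hn.
- rewrite (_ : (0 <= - 1 - n) = true) 1?(_ : (0 <= n - 1) = false); try lia.
  by rewrite subr0; congr (_%:~R); lia.
- rewrite (_ : (0 <= - 1 - n) = false) 1?(_ : (0 <= n - 1) = true); try lia.
  by rewrite sub0r -rmorphN; congr (_%:~R); lia.
- by rewrite hn subr0.
Qed.

(** Integration by parts. *)
Lemma expres_vder a m u v :
  expres a m (vder u) v =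
  - (a%:~R *: expres a m u v + m%:~R *: expres (a + 1) (m - 1) u v).
Proof.
rewrite /expres -!zsumZ; try exact: expres_fin.
rewrite -zsumD; try exact/zfinZ/expres_fin.
rewrite (zsum_shift 1) -zsumN; last first.
  have [l1 [h1 s1]] := expres_fin a m u v.
  have [l2 [h2 s2]] := expres_fin (a + 1) (m - 1) u v.
  exists (Num.min l1 l2), (Num.max h1 h2) => i hi.
  by rewrite s1 ?s2 ?scaler0 ?addr0 //; lia.
apply: eq_zsum => n; rewrite vder_nprod addrK !scalerA -scalerDl -lc_deriv.
by rewrite -scaleNr rmorphN; congr (_ *: _); ring.
Qed.

Lemma nprod_vacuumr u n : 0 <= n -> nprod u n one = 0.
Proof. exact: nprod_vacuumr_ge0. Qed.

Lemma vderM u n v : vder (nprod u n v) = nprod (vder u) n v + nprod u n (vder v).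
Proof.
elim/vpar_ind: u => [x u hu|u u' hu hu']; last first.
  rewrite (linD (nprod_linearl n v)) !(linD vder_linear).
  rewrite (linD (nprod_linearl n v)) (linD (nprod_linearl n (vder v))) hu hu'.
  by rewrite addrACA.
elim/vpar_ind: v => [y v hv|v v' hv hv']; last first.
  rewrite (linD (nprod_linearr u n)) !(linD vder_linear).
  rewrite (linD (nprod_linearr u n)) (linD (nprod_linearr (vder u) n)) hv hv'.
  by rewrite addrACA.
rewrite {1}/vder (nprod_assoc one n (-2) hu hv) [X in _ *: X]zsum0; last first.
  move=> i; case: (ltP i 0) => h; first by rewrite bc_lt0 ?scale0r.
  by rewrite nprod_vacuumr // nprod0r scaler0.
rewrite scaler0 subr0 (@zsumE _ 0 1); last first.
  move=> i hi; case: (ltP i 0) => h; first by rewrite bc_lt0 ?scale0r.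
  by rewrite nprod_vacuumr ?nprod0r ?scaler0 //; lia.
have -> : zrange 0 1 = [:: 0; 1] by [].
rewrite big_cons big_seq1 addr0.
rewrite bc0 scale1r subr0 addrC vder_nprod nprod_vacuumrN1.
congr (_ *: _ + _).
by have := bc_next F n 0; rewrite bc0 add0r mulr1 mul1r sub0r.
Qed.

Lemma expres_vderM a m u v : vder (expres a m u v) =
  expres a m (vder u) v + expres a m u (vder v).
Proof.
rewrite /expres {1}/vder (zsum_lin (nprod_linearl _ _)); last exact: expres_fin.
rewrite -zsumD; try exact: expres_fin.
apply: eq_zsum => n.
by rewrite (linZ (nprod_linearl _ _)) -/(vder _) vderM scalerDr.
Qed.

Lemma expres_vacuuml a m v : expres a m one v = lc F a m (-1) *: v.
Proof.
rewrite /expres (@zsum1 _ (-1)) ?nprod_vacuuml ?eqxx // => i hi.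
by rewrite nprod_vacuuml (negPf hi) scaler0.
Qed.

(** The Jacobi identity with [m = -1] and [n = 0], applied to the vacuum, gives
    skew-symmetry, Y(v,z)u = (-1)^(|u||v|) exp(zD) Y(u,-z)v. *)
Lemma nprod_skew (x y : bool) u v l : vpar x u -> vpar y v ->
  nprod v l u = - ((-1) ^+ (x && y) * (-1) ^ l) *:
    zsum (fun i => if i is Posz k then
      (-1) ^+ k *: nprod (nprod u (l + i) v) (- 1 - i) one else 0).
Proof.
move=> hu hv; have := vjacobi one l (-1) 0 hu hv.
have [N hN] := nprod_trunc u v.
rewrite (@natsum_zsum _ _ 0%N) => [|i hi]; last first.
  by rewrite nprod_vacuumr ?nprod0r ?scaler0 //; lia.
rewrite [X in X - _]zsum0 => [|[i|//]]; last first.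
  by rewrite nprod_vacuumr ?nprod0r ?scaler0 //; lia.
rewrite (@natsum_zsum _ _ 1%N) => [|i hi]; last first.
  by rewrite [nprod u _ _]nprod_vacuumr ?nprod0r ?scaler0 //; lia.
rewrite [X in _ *: X](@zsum1 _ 0) => [|[[//|i]|//] _]; last first.
  by rewrite [nprod u _ _]nprod_vacuumr ?nprod0r ?scaler0 //; lia.
rewrite (@natsum_zsum _ _ (absz (N - l)%R)) => [|i hi]; last first.
  by rewrite hN ?nprod0l ?scaler0 //; lia.
rewrite /= (_ : 0 + l - 0%:Z = l); last by lia.
rewrite (_ : -1 + 0%:Z = -1); last by lia.
rewrite binz0 mul1r mulr1 nprod_vacuumrN1 sub0r.
move=> h; set s := (-1) ^+ _; set g := (-1) ^ l.
have sg : (s * g) * (s * g) = 1.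
  transitivity ((s * s) * (g * g)); first ring.
  by rewrite /s /g signz_sqr -signr_addb addbb mul1r.
have -> : nprod v l u = (s * g) *: (s *: (g *: nprod v l u)).
  by rewrite !scalerA -(mulrA (s * g)) sg scale1r.
rewrite -[X in _ *: X]opprK h scalerN -scaleNr; congr (_ *: _); apply: eq_zsum => -[k|//].
congr (_ *: _).
exact: binz_N1.
Qed.

(** The property of the maps [x |-> x_[q] w] that comes from
    Y_W(Dx,x1) = x1 d/dx1 Y_W(x,x1). *)
Definition homog (X : lmodType F) (q : int) (f : V -> X) :=
  linear f /\ forall x, f (vder x) = (- q)%:~R *: f x.

Lemma homog_divided (X : lmodType F) q (f : V -> X) x k : homog q f ->
  f (nprod x (- 1 - k%:Z) one) = lc F (- q) 0 k *: f x.
Proof.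
move=> [lf fD]; elim: k x => [|k IHk] x.
  by rewrite subr0 nprod_vacuumrN1 lc_diag scale1r.
have := IHk (vder x); rewrite vder_nprod (linZ lf) fD scalerA.
rewrite (_ : - 1 - k%:Z - 1 = - 1 - k.+1%:Z); last by lia.
rewrite (_ : - (- 1 - k%:Z) = k%:Z + 1); last by lia.
have := lc_deriv F (- q) 0 k; rewrite mul0r addr0 (_ : k%:Z + 1 = k.+1%:Z); last by lia.
rewrite [lc F (- q) 0 k%:Z * _]mulrC => <- h.
have k0 : k.+1%:Z%:~R != 0 :> F by rewrite intr_eq0.
by rewrite -[LHS]scale1r -(mulVf k0) -scalerA h !scalerA mulKf.
Qed.

(** Under a homogeneous map the operator [exp(zD)] of skew-symmetry becomes
    [t^(-q)], and the substitution of [-z] for [z] is [t |-> 1/t]. *)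
Lemma expres_skew (X : lmodType F) q (f : V -> X) (x y : bool) u v a m :
  homog q f -> vpar x u -> vpar y v ->
  f (expres a m v u) =
  (- (-1) ^+ (x && y) * (-1) ^ m) *: f (expres (q - a - m) m u v).
Proof.
move=> hf hu hv; have [lf _] := hf; set s := (-1) ^+ _.
have [N hN] := nprod_trunc u v.
rewrite /expres !(zsum_lin lf); try exact: expres_fin.
have fN n : N <= n -> f (nprod u n v) = 0 by move=> h; rewrite hN ?lin0.
transitivity (zsum (fun l => zsum (fun n =>
    (- s * (-1) ^ n * (lc F a m l * lc F (- q) 0 (n - l))) *: f (nprod u n v)))).
  apply: eq_zsum => l; rewrite (linZ lf) (nprod_skew l hu hv) (linZ lf) -/s.
  rewrite (zsum_lin lf); last first.
    exists 0, (N - l) => -[k|k] // hk; rewrite hN ?nprod0l ?scaler0 //; lia.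
  rewrite scalerA -zsumZ; last first.
    exists 0, (N - l) => -[k|k] hk; last by rewrite (lin0 lf).
    by rewrite hN ?nprod0l ?scaler0 ?(lin0 lf) //; lia.
  rewrite [RHS](zsum_shift l); apply: eq_zsum => -[k|k]; last first.
    by rewrite (lin0 lf) scaler0 addrK [lc _ (- q) _ _]lc_lt // !mulr0 scale0r.
  rewrite (linZ lf) (homog_divided _ _ hf) !scalerA addrK [l + _]addrC.
  congr (_ *: _); rewrite exprzDr ?unitrN1 // -[(-1) ^ k%:Z]/((-1) ^+ k); ring.
rewrite zsum_exch; last first.
  exists (Num.min m N), (Num.max m N) => l n h.
  case: (ltP l m) => hl; first by rewrite [lc _ a _ _]lc_lt // mul0r mulr0 scale0r.
  case: (ltP n l) => hn; first by rewrite [lc _ (- q) _ _]lc_lt ?mulr0 ?scale0r //; lia.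
  by rewrite fN ?scaler0 //; lia.
rewrite -zsumZ; last first.
  have [lo [hi fs]] := expres_fin (q - a - m) m u v.
  by exists lo, hi => n hn; rewrite fs ?(lin0 lf).
apply: eq_zsum => n; rewrite zsumZl; last first.
  have [lo [hi fs]] := zfin_lcM F a (- q) m 0 n.
  by exists lo, hi => l hl; rewrite fs ?mulr0.
rewrite zsumMl; last exact: zfin_lcM.
rewrite -lc_mul addr0 (linZ lf) scalerA; congr (_ *: _).
rewrite -!mulrA; congr (_ * _); rewrite lc_flip; congr (_ * lc _ _ _ _); lia.
Qed.

(** The Jacobi identity in the coordinates [t1 = exp(z1)] and [t2 = exp(z2)], for
    [t1^a t2^b (t2-1)^n (t1-t2)^l Y(u,z1) Y(v,z2) w dz1 dz2]. The left side is the
    residue at [t1 = t2]; on the right [(t1-t2)^l] is expanded in powers of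
    [t1-1] and [t2-1], in the two possible ways. Both sides are combinations of
    the [u_p v_q w] and the [v_q u_p w], whose coefficients agree by
    [kernel_prod] and [kernel_prod_swap]. *)
Lemma expres_assoc (x y : bool) u v w a b l n : vpar x u -> vpar y v ->
  expres (a + b + l) n (expres a l u v) w =
  zsum (fun i => bc F l i *: expres a (l - i) u (expres b (n + i) v w))
  - ((-1) ^+ (x && y) * (-1) ^ l) *:
    zsum (fun i => bc F l i *: expres b (n + l - i) v (expres a i u w)).
Proof.
move=> hu hv; set s := (-1) ^+ _; set A := a + b + l.
have [Nv hNv] := nprod_trunc v w; have [Nu hNu] := nprod_trunc u w.
have [Nuv hNuv] := nprod_trunc u v.
have [M1 hM1] : exists M : int, forall q p, n <= q -> M <= p ->
    nprod u p (nprod v q w) = 0.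
  have [|M hM] := @nprod_trunc_fin u (fun q => if n <= q then nprod v q w else 0).
    exists n, Nv => q hq; case: ifP => // h; apply: hNv; lia.
  by exists M => q p hq hp; have := hM q p hp; rewrite hq.
have [M2 hM2] : exists M : int, forall p q, 0 <= p -> M <= q ->
    nprod v q (nprod u p w) = 0.
  have [|M hM] := @nprod_trunc_fin v (fun q => if 0 <= q then nprod u q w else 0).
    exists 0, Nu => q hq; case: ifP => // h; apply: hNu; lia.
  by exists M => q p hq hp; have := hM q p hp; rewrite hq.
pose f1 k j r := (bc F j r * (lc F a l j * lc F A n k)) *:
   nprod u (j - r) (nprod v (k + r) w).
pose f2 k j r := (bc F j r * ((-1) ^ j * lc F a l j * lc F A n k)) *:
   nprod v (k + j - r) (nprod u r w).
have f1f : zfin3 f1.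
  exists (Num.min (Num.min 0 n) l),
    (Num.max (Num.max (Nv - n) Nv) (M1 + Nv - n)) => k j r h; rewrite /f1.
  case: (ltP r 0) => hr; first by rewrite bc_lt0 ?mul0r ?scale0r.
  case: (ltP j l) => hj; first by rewrite [lc _ a _ _]lc_lt // mul0r mulr0 scale0r.
  case: (ltP k n) => hk; first by rewrite [lc _ A _ _]lc_lt // !mulr0 scale0r.
  case: (leP Nv (k + r)) => hkr; first by rewrite hNv ?nprod0r ?scaler0.
  by rewrite hM1 ?scaler0 //; lia.
have f2f : zfin3 f2.
  exists (Num.min (Num.min 0 n) l),
    (Num.max (Num.max Nu (M2 + Nu - l)) (M2 + Nu - n)) => k j r h; rewrite /f2.
  case: (ltP r 0) => hr; first by rewrite bc_lt0 ?mul0r ?scale0r.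
  case: (ltP j l) => hj; first by rewrite [lc _ a _ _]lc_lt // mulr0 mul0r mulr0 scale0r.
  case: (ltP k n) => hk; first by rewrite [lc _ A _ _]lc_lt // !mulr0 scale0r.
  case: (leP Nu r) => hkr; first by rewrite hNu ?nprod0r ?scaler0.
  by rewrite hM2 ?scaler0 //; lia.
have z1 (g : int -> int -> int -> V) k : zfin3 g -> zfin (fun j => zsum (g k j)).
  move=> [lo [hi gs]]; exists lo, hi => j hj; apply: zsum0 => r; apply: gs; lia.
have z2 (g : int -> int -> int -> V) : zfin3 g ->
    zfin (fun k => zsum (fun j => zsum (g k j))).
  move=> [lo [hi gs]]; exists lo, hi => k hk; apply: zsum0 => j.
  by apply: zsum0 => r; apply: gs; lia.
transitivity (zsum (fun k => zsum (fun j => zsum (f1 k j)))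
   - s *: zsum (fun k => zsum (fun j => zsum (f2 k j)))).
  rewrite -zsumZ; last exact: z2.
  rewrite -zsumB; last exact/zfinZ/z2; last exact: z2.
  apply: eq_zsum => k; rewrite /expres (zsum_lin (nprod_linearl k w)); last exact: expres_fin.
  rewrite -zsumZ; last exact/(zfin_lin (nprod_linearl k w))/expres_fin.
  rewrite -zsumZ; last exact: z1.
  rewrite -zsumB; last exact/zfinZ/z1; last exact: z1.
  apply: eq_zsum => j; rewrite (linZ (nprod_linearl k w)) scalerA.
  rewrite (nprod_assoc w j k hu hv) -/s scalerBr; congr (_ - _).
    rewrite -zsumZ; first by apply: eq_zsum => r; rewrite scalerA /f1; congr (_ *: _); ring.
    exists 0, (Nv - k) => r hr; case: (ltP r 0) => hr0; first by rewrite bc_lt0 ?scale0r.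
    by rewrite hNv ?nprod0r ?scaler0 //; lia.
  rewrite !scalerA -!zsumZ.
  - by apply: eq_zsum => r; rewrite !scalerA /f2; congr (_ *: _); ring.
  - exists 0, Nu => r hr; rewrite /f2; case: (ltP r 0) => hr0.
      by rewrite bc_lt0 ?mul0r ?scale0r.
    by rewrite hNu ?nprod0r ?scaler0 //; lia.
  exists 0, Nu => r hr; case: (ltP r 0) => hr0; first by rewrite bc_lt0 ?scale0r.
  by rewrite hNu ?nprod0r ?scaler0 //; lia.
rewrite (zsum3_shift f1f) (zsum3_shear f2f) -scalerA; congr (_ - _ *: _).
  pose g q p i := (bc F l i * (lc F a (l - i) p * lc F b (n + i) q)) *:
    nprod u p (nprod v q w).
  have gf : zfin3 g.
    exists (Num.min (Num.min 0 n) (l - Nv + n)), (Num.max (Num.max (Nv - n) Nv) M1).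
    move=> q p i h; rewrite /g.
    case: (ltP i 0) => hi; first by rewrite bc_lt0 ?mul0r ?scale0r.
    case: (ltP q (n + i)) => hq; first by rewrite [lc _ b _ _]lc_lt // !mulr0 scale0r.
    case: (leP Nv q) => hq'; first by rewrite hNv ?nprod0r ?scaler0.
    case: (ltP p (l - i)) => hp; first by rewrite [lc _ a _ _]lc_lt // mul0r mulr0 scale0r.
    by rewrite hM1 ?scaler0 //; lia.
  transitivity (zsum (fun q => zsum (fun p => zsum (g q p)))).
    apply: eq_zsum => q; apply: eq_zsum => p; rewrite /f1 /g.
    rewrite [RHS]zsumZl -?kernel_prod -?zsumZl.
    - by apply: eq_zsum => r; rewrite addrK subrK.
    - exists (Num.min 0 (l - p)), (q - n) => r hr.
      case: (ltP r 0) => hr0; first by rewrite bc_lt0 ?mul0r.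
      by rewrite [lc _ (a + b + l) _ _]lc_lt ?mulr0 //; lia.
    - exists 0, (q - n) => i hi; case: (ltP i 0) => hi0; first by rewrite bc_lt0 ?mul0r.
      by rewrite [lc _ b _ _]lc_lt ?mulr0 //; lia.
  rewrite zsum3_rot //; apply: eq_zsum => i; rewrite zsum_exch; last first.
    by case: gf => lo [hi gs]; exists lo, hi => q p h; apply: gs; lia.
  rewrite /expres -zsumZ; last exact: expres_fin.
  apply: eq_zsum => p; rewrite (zsum_lin (nprod_linearr u p)); last exact: expres_fin.
  rewrite -!zsumZ.
  - by apply: eq_zsum => q; rewrite (linZ (nprod_linearr u p)) !scalerA /g; congr (_ *: _); ring.
  - exact/zfinZ/(zfin_lin (nprod_linearr u p))/expres_fin.
  - exact/(zfin_lin (nprod_linearr u p))/expres_fin.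
pose g q p i := ((-1) ^ l * (bc F l i * (lc F b (n + l - i) q * lc F a i p))) *:
    nprod v q (nprod u p w).
have gf : zfin3 g.
  exists (Num.min 0 (n + l - Nu)), (Num.max Nu M2).
  move=> q p i h; rewrite /g.
  case: (ltP i 0) => hi; first by rewrite bc_lt0 ?mul0r ?mulr0 ?scale0r.
  case: (ltP p i) => hp; first by rewrite [lc _ a _ _]lc_lt // !mulr0 scale0r.
  case: (leP Nu p) => hp'; first by rewrite hNu ?nprod0r ?scaler0.
  case: (ltP q (n + l - i)) => hq; first by rewrite [lc _ b _ _]lc_lt // mul0r !mulr0 scale0r.
  by rewrite hM2 ?scaler0 //; lia.
transitivity (zsum (fun q => zsum (fun p => zsum (g q p)))).
  apply: eq_zsum => q; apply: eq_zsum => p; rewrite /f2 /g.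
  have kf : zfin (fun i => bc F l i * (lc F b (n + l - i) q * lc F a i p)).
    exists 0, p => i hi; case: (ltP i 0) => hi0; first by rewrite bc_lt0 ?mul0r.
    by rewrite [lc _ a _ _]lc_lt ?mulr0 //; lia.
  rewrite [RHS]zsumZl; last by case: kf => lo [hi ks]; exists lo, hi => i hi'; rewrite ks ?mulr0.
  rewrite zsumMl // -kernel_prod_swap -zsumZl.
    by apply: eq_zsum => r; congr (_ *: nprod _ _ _); lia.
  exists (Num.min 0 (l - p)), (q - n) => r hr.
  case: (ltP (p + r) l) => hr0; first by rewrite [lc _ a _ _]lc_lt // mulr0 mul0r mulr0.
  by rewrite [lc _ (a + b + l) _ _]lc_lt ?mulr0 //; lia.
rewrite zsum3_rot // -zsumZ; last first.
  exists 0, Nu => i hi; case: (ltP i 0) => hi0; first by rewrite bc_lt0 ?scale0r.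
  rewrite [expres a i u w](_ : _ = 0) ?(lin0 (expres_linearr _ _ _)) ?scaler0 //.
  apply: zsum0 => p; case: (ltP p i) => hp; first by rewrite lc_lt ?scale0r.
  by rewrite hNu ?scaler0 //; lia.
apply: eq_zsum => i.
rewrite /expres -!zsumZ.
- apply: eq_zsum => q; rewrite (zsum_lin (nprod_linearr v q)); last exact: expres_fin.
  rewrite -!zsumZ.
  + by apply: eq_zsum => p; rewrite (linZ (nprod_linearr v q)) !scalerA /g; congr (_ *: _); ring.
  + exact/zfinZ/zfinZ/(zfin_lin (nprod_linearr v q))/expres_fin.
  + exact/zfinZ/(zfin_lin (nprod_linearr v q))/expres_fin.
  + exact/(zfin_lin (nprod_linearr v q))/expres_fin.
- exact/zfinZ/expres_fin.
- exact: expres_fin.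
Qed.

End VertexSuperalgebra.

(** * Coordinated modules and the residue identity *)

Section Modes.
Variables (F : numFieldType) (V : vertexSuperalgebra F) (W : lmodType F).
Variable mode : V -> int -> W -> W.
Implicit Types (u v : V) (w : W) (a m n p q l : int).

Local Notation one := (vacuum V).

Definition modeprod u v w q : int -> W := fun p => mode u p (mode v (q - p) w).

(** With R(t) the rational function that [Y_W(u,x1) Y_W(v,x2) w] depends on in
    the variable [t = x1/x2], these are the residues of the forms
    [t^a (t-1)^m R(t) dt/t] at 1 on the left, at infinity and at 0 on the right. *)
Definition residue_identity := forall (x y : bool) u v, vpar x u -> vpar y v ->
  forall a m q w, mode (expres a m u v) q w =
    atinf m a (modeprod u v w q)
    - ((-1) ^+ (x && y) * (-1) ^ m) *: atinf m (q - a - m) (modeprod v u w q).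

Hypothesis mode_linearl : forall n w, linear (fun v => mode v n w).
Hypothesis mode_linearr : forall v n, linear (mode v n).
Hypothesis mode_trunc :
  forall v w, exists N : int, forall n, N <= n -> mode v n w = 0.

Lemma modeprod_lowb u v w : exists N : int, forall q, lowb (q - N) (modeprod u v w q).
Proof.
have [N hN] := mode_trunc v w; exists N => q p hp.
by rewrite /modeprod hN ?(lin0 (mode_linearr _ _)) //; lia.
Qed.

(** Multiplication by [x1 - x2] is a difference along the antidiagonals. *)
Lemma YYk_atinf (k : nat) u v w p (T : int) :
  YYk mode k u v w (- p) (T + p) = atinf k p (modeprod u v w (k%:Z - T)).
Proof.
have [N hN] := modeprod_lowb u v w.
elim: k p T => [|k IHk] p T.
  rewrite atinf0 /YYk /= /YY /modeprod opprK sub0r.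
  by congr (mode u p (mode v _ w)); lia.
rewrite /YYk iterS /mul_x1Bx2 -!/(YYk mode k u v w).
rewrite (_ : - p - 1 = - (p + 1)); last by lia.
rewrite {1}(_ : T + p = (T - 1) + (p + 1)); last by lia.
rewrite (_ : T + p - 1 = (T - 1) + p); last by lia.
rewrite !IHk (_ : k%:Z - (T - 1) = k.+1%:Z - T); last by lia.
by rewrite -(atinf_step _ _ (hN _)) -addn1 PoszD.
Qed.

Lemma expm1X_lc (k j : nat) : fps_exp (fps_expm1 F) k j = lc F 0 k j.
Proof.
have e1 : (fps_expm1 F : series F) = sX F * sE F by rewrite sX_sE.
rewrite -[fps_exp _ _]/(fps_exp (fps_expm1 F : series F) k) -seriesX e1 exprMn.
have sXn (s : series F) (i : nat) :
    (sX F ^+ k * s) i = if (k <= i)%N then s (i - k)%N else 0.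
  elim: k i => [|k' IHk] i; first by rewrite expr0 mul1r subn0.
  by rewrite exprS -mulrA sXE; case: i => [//|i]; rewrite IHk ltnS subSS.
rewrite sXn; case: leqP => h; last by rewrite lc_lt //; lia.
by rewrite (@lcE F 0 k j (j - k)%N) /kser ?sexp0 ?mul1r //; lia.
Qed.

Lemma exp_coef_lc a p : exp_coef F a p = lc F a 0 p.
Proof. by rewrite lc_expo. Qed.

Lemma Yiter_coef_zsum (k : nat) u v w p q :
  Yiter_coef mode k u v w p (- q) =
  zsum (fun j => lc F 0 k j *: mode (nprod u (j - p - 1) v) q w).
Proof.
have [N hN] := nprod_trunc u v.
rewrite /Yiter_coef (@natsum_zsum _ _ (absz (N + p + 1)%R)) => [|j hj]; last first.
  by rewrite hN ?(lin0 (mode_linearl _ _)) ?scaler0 //; lia.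
apply: eq_zsum => -[j|j]; last by rewrite lc_lt ?scale0r.
by rewrite expm1X_lc opprK.
Qed.

Lemma subst_coef_zsum (k : nat) u v w p q :
  subst_coef k (YYk mode k u v w) p (- q) =
  zsum (fun j => lc F (- j) 0 p *: atinf k j (modeprod u v w q)).
Proof.
rewrite /subst_coef -[LHS]/(zsum _) (zsum_rev 0); apply: eq_zsum => j.
rewrite sub0r exp_coef_lc opprK YYk_atinf; congr (_ *: atinf _ _ (modeprod _ _ _ _)).
lia.
Qed.

(** Multiplication of [(e^z-1)^k Y_W(Y(u,z)v,x) w] by [e^(az) (e^z-1)^l]. *)
Lemma mode_expres_iter (k : nat) u v w a l q :
  mode (expres a (k%:Z + l) u v) q w =
  zsum (fun p => lc F a l (- 1 - p) *: Yiter_coef mode k u v w p (- q)).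
Proof.
have [N hN] := nprod_trunc u v.
have fN n : N <= n -> mode (nprod u n v) q w = 0.
  by move=> h; rewrite hN ?(lin0 (mode_linearl _ _)).
rewrite (zsum_lin (mode_linearl q w)); last exact: expres_fin.
transitivity (zsum (fun n => zsum (fun i =>
   (lc F a l i * lc F 0 k (n - i)) *: mode (nprod u n v) q w))).
  apply: eq_zsum => n; rewrite zsumZl; last exact: zfin_lcM.
  by rewrite -lc_mul addr0 (linZ (mode_linearl q w)) addrC.
rewrite zsum_exch; last first.
  exists (Num.min l (l + k%:Z)), (Num.max N (N - k%:Z)) => n i h.
  case: (ltP i l) => hi; first by rewrite lc_lt ?mul0r ?scale0r.
  case: (ltP (n - i) k%:Z) => hn; first by rewrite [lc F 0 _ _]lc_lt // mulr0 scale0r.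
  by rewrite fN ?scaler0 //; lia.
rewrite (zsum_rev (- 1)); apply: eq_zsum => p; rewrite Yiter_coef_zsum -zsumZ; last first.
  exists 0, (N + p + 1) => j hj; case: (ltP j k%:Z) => hjk; first by rewrite lc_lt ?scale0r.
  by rewrite fN ?scaler0 //; lia.
rewrite (zsum_shift (- 1 - p)); apply: eq_zsum => j.
rewrite scalerA addrK; congr (_ *: mode (nprod u _ v) q w); lia.
Qed.

Section Substitution.
Variables (k : nat) (u v : V) (w : W) (q a0 : int).
Hypothesis A0 : forall j, a0 <= j -> atinf k j (modeprod u v w q) = 0.

(** [(t-1)^k R(t)] is a Laurent polynomial, for which the residue at 1 and the
    expansion at infinity can be compared on monomials, by [lc_residue]. *)
Lemma subst_expansion a l : a0 <= a ->
  zsum (fun p => lc F a l (- 1 - p) *: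
          subst_coef k (YYk mode k u v w) p (- q))
  = atinf (k%:Z + l) a (modeprod u v w q).
Proof.
move=> ha; have [N hN] := modeprod_lowb u v w.
set C := modeprod u v w q; have Cl : lowb (q - N) C := hN q.
have Al : lowb (q - N - k%:Z) (fun j => atinf k j C).
  by move=> j hj; apply: (atinf_lt Cl); lia.
transitivity (zsum (fun p => zsum (fun j =>
    (lc F a l (- 1 - p) * lc F (- j) 0 p) *: atinf k j C))).
  apply: eq_zsum => p; rewrite subst_coef_zsum -/C -zsumZ.
    by apply: eq_zsum => j; rewrite scalerA.
  exists (q - N - k%:Z), a0 => j hj.
  by case: (leP a0 j) => h; [rewrite A0 ?scaler0|rewrite Al ?scaler0 //; lia].
rewrite zsum_exch; last first.
  exists (Num.min 0 (q - N - k%:Z)), (Num.max (- 1 - l) a0) => p j h.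
  case: (ltP p 0) => hp; first by rewrite [lc F _ 0 _]lc_lt // mulr0 scale0r.
  case: (ltP (- 1 - p) l) => hl; first by rewrite lc_lt // mul0r scale0r.
  by case: (leP a0 j) => hj; [rewrite A0 ?scaler0|rewrite Al ?scaler0 //; lia].
rewrite -(atinf_comp k l a Cl) /atinf -/C [RHS](zsum_rev (a + l)).
apply: eq_zsum => j; rewrite (_ : a + l - (a + l - j) = j); last by lia.
rewrite -/(atinf k j C); case: (leP a0 j) => hj; first by rewrite A0 // zsum0 ?scaler0 // => p; rewrite scaler0.
rewrite zsumZl; last first.
  exists 0, (- 1 - l) => p hp; case: (ltP p 0) => hp0; first by rewrite [lc F _ 0 _]lc_lt // mulr0.
  by rewrite lc_lt ?mul0r //; lia.
rewrite (zsum_rev (- 1)); congr (_ *: _).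
transitivity (lc F (a + (- j)) (l + 0) (- 1)).
  rewrite lc_mul; apply: eq_zsum => p; congr (lc F _ _ _ * _); lia.
rewrite addr0 lc_residue; last by lia.
congr bc; lia.
Qed.

End Substitution.

(** The case of the residue identity in which [a] is so large that there is no
    residue at 0; the bound on [a] is uniform in [q]. *)
Definition weak_assoc u v := forall w, exists a0 : int, forall q a m, a0 <= a ->
  mode (expres a m u v) q w = atinf m a (modeprod u v w q).

(** The residues of both sides of the associativity axiom, multiplied by
    [e^(az) (e^z-1)^(m-k)]. *)
Lemma assoc_residue k u v :
  (forall w, in_laurent2 (YYk mode k u v w)) ->
  (forall w p q, Yiter_coef mode k u v w p q = subst_coef k (YYk mode k u v w) p q) ->
  weak_assoc u v.
Proof.
move=> hl ha w; have [N hN] := hl w.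
have A0 q j : 1 - N <= j -> atinf k j (modeprod u v w q) = 0.
  move=> hj; have := YYk_atinf k u v w j (k%:Z - q).
  rewrite (_ : k%:Z - (k%:Z - q) = q); last by lia.
  by move=> <-; apply: hN; lia.
exists (1 - N) => q a m h; rewrite (_ : m = k%:Z + (m - k%:Z)); last by lia.
rewrite -(subst_expansion (A0 q) _ h) mode_expres_iter.
by apply: eq_zsum => p; rewrite ha.
Qed.

(** The coefficients of the powers of [z] are recovered from the residues of the
    products with [e^(az) (e^z-1)^l], [l < 0], since these have the leading
    term [z^l]. *)
Lemma weak_assoc_assoc u v : weak_assoc u v -> exists k : nat,
  (forall w, in_laurent2 (YYk mode k u v w)) /\
  (forall w p q, Yiter_coef mode k u v w p q = subst_coef k (YYk mode k u v w) p q).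
Proof.
move=> wa; have [N hN] := nprod_trunc u v; pose k := absz N; exists k.
have kN n : k%:Z <= n -> nprod u n v = 0 by move=> h; apply: hN; lia.
have e0 a m : k%:Z <= m -> expres a m u v = 0.
  move=> h; apply: zsum0 => n; case: (ltP n m) => hn; first by rewrite lc_lt ?scale0r.
  by rewrite kN ?scaler0 //; lia.
have A0 w : exists a0 : int, forall q j, a0 <= j -> atinf k j (modeprod u v w q) = 0.
  have [a0 ha0] := wa w; exists a0 => q j hj.
  by rewrite -ha0 // e0 // (lin0 (mode_linearl _ _)).
split=> [w|w p q].
  have [a0 ha0] := A0 w; have [M hM] := mode_trunc v w.
  exists (Num.min (1 - a0) (- M)) => a b hab.
  rewrite (_ : b = (a + b) + (- a)); last by lia.
  rewrite -{1}[a]opprK YYk_atinf; case: (ltP a (1 - a0)) => ha.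
    by apply: ha0; lia.
  apply: zsum0 => i; case: (ltP i 0) => hi; first by rewrite bc_lt0 ?scale0r.
  by rewrite /modeprod hM ?(lin0 (mode_linearr _ _)) ?scaler0 //; lia.
rewrite -[q]opprK; move: (- q) => {}q.
have [a0 ha0] := A0 w; have [a1 ha1] := wa w.
pose a := Num.max a0 a1.
pose Y p := Yiter_coef mode k u v w p (- q).
pose S p := subst_coef k (YYk mode k u v w) p (- q).
have [M hM] := modeprod_lowb u v w.
have Y0 p' : p' < 0 -> Y p' = 0.
  move=> hp; rewrite /Y Yiter_coef_zsum zsum0 // => j.
  case: (ltP j k%:Z) => hj; first by rewrite lc_lt ?scale0r.
  by rewrite kN ?(lin0 (mode_linearl _ _)) ?scaler0 //; lia.
have S0 p' : p' < 0 -> S p' = 0.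
  move=> hp; rewrite /S subst_coef_zsum zsum0 // => j.
  by rewrite lc_lt ?scale0r.
have sup (f : int -> W) l : (forall p', p' < 0 -> f p' = 0) ->
    zfin (fun p' => lc F a l (- 1 - p') *: f p').
  move=> f0; exists 0, (- 1 - l) => p' hp'; case: (ltP p' 0) => h; first by rewrite f0 ?scaler0.
  by rewrite lc_lt ?scale0r //; lia.
rewrite -/(Y p) -/(S p); apply: subr0_eq.
move: p; apply: (@lowb_ind (fun p => Y p - S p = 0) 0) => [p hp|p IHp]; first by rewrite Y0 // S0 // subrr.
have : zsum (fun p' => lc F a (- 1 - p) (- 1 - p') *: (Y p' - S p')) = 0.
  transitivity (zsum (fun p' => lc F a (- 1 - p) (- 1 - p') *: Y p')
              - zsum (fun p' => lc F a (- 1 - p) (- 1 - p') *: S p')).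
    rewrite -zsumB; [by apply: eq_zsum => i; rewrite scalerBr| |]; exact: sup.
  rewrite /Y -mode_expres_iter /S (subst_expansion (ha0 q)); last by rewrite /a; lia.
  by rewrite ha1 ?subrr // /a; lia.
rewrite (@zsum1 _ p) => [|i hi]; first by rewrite lc_diag scale1r.
case: (ltP p i) => h; first by rewrite lc_lt ?scale0r //; lia.
by rewrite IHp ?scaler0 //; lia.
Qed.

Lemma weak_assocDl u u' v : weak_assoc u v -> weak_assoc u' v -> weak_assoc (u + u') v.
Proof.
move=> h h' w; have [a0 ha] := h w; have [a1 ha'] := h' w.
exists (Num.max a0 a1) => q a m ham.
have [N hN] := modeprod_lowb u v w; have [N' hN'] := modeprod_lowb u' v w.
rewrite (linD (expres_linearl _ _ _)) (linD (mode_linearl _ _)) ha ?ha'; try lia.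
rewrite -(@atinfD _ _ _ _ (Num.min (q - N) (q - N'))); last 2 first.
- by apply: (lowb_widen (hN q)); lia.
- by apply: (lowb_widen (hN' q)); lia.
by apply: atinf_eq => p; rewrite /modeprod (linD (mode_linearl _ _)).
Qed.

Lemma weak_assocDr u v v' : weak_assoc u v -> weak_assoc u v' -> weak_assoc u (v + v').
Proof.
move=> h h' w; have [a0 ha] := h w; have [a1 ha'] := h' w.
exists (Num.max a0 a1) => q a m ham.
have [N hN] := modeprod_lowb u v w; have [N' hN'] := modeprod_lowb u v' w.
rewrite (linD (expres_linearr _ _ _)) (linD (mode_linearl _ _)) ha ?ha'; try lia.
rewrite -(@atinfD _ _ _ _ (Num.min (q - N) (q - N'))); last 2 first.
- by apply: (lowb_widen (hN q)); lia.
- by apply: (lowb_widen (hN' q)); lia.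
by apply: atinf_eq => p; rewrite /modeprod (linD (mode_linearl _ _)) (linD (mode_linearr _ _)).
Qed.

Lemma residue_weak_assoc : residue_identity -> forall u v, weak_assoc u v.
Proof.
move=> J; elim/vpar_ind => [x u hu|u u' hu hu' v]; last exact: weak_assocDl.
elim/vpar_ind => [y v hv w|]; last by move=> v v'; exact: weak_assocDr.
have [N hN] := modeprod_lowb v u w; exists (N + 1) => q a m ha.
rewrite (J _ _ _ _ hu hv) [atinf m (q - a - m) _](atinf_lt (hN q)) ?scaler0 ?subr0 //.
lia.
Qed.

Hypothesis mode_vacuum : forall n w, mode one n w = if n == 0 then w else 0.

(** Weak associativity with [v = 1] and [m = -2]. *)
Lemma mode_vder : (forall u, weak_assoc u one) ->
  forall q w, homog q (fun v => mode v q w).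
Proof.
move=> wa q w; split=> [|x]; first exact: mode_linearl.
have [a0 ha0] := wa x w; pose a := Num.max (Num.max a0 2) (q + 2).
have := ha0 q a (-2); rewrite /atinf (@zsum1 _ (a - 2 - q)) => [|i hi]; last first.
  rewrite /modeprod mode_vacuum ifN ?(lin0 (mode_linearr _ _)) ?scaler0 //; lia.
rewrite /modeprod mode_vacuum ifT; last by lia.
rewrite (_ : a - 2 - (a - 2 - q) = q); last by lia.
rewrite (_ : expres a (-2) x one = vder x + (a - 1)%:~R *: x); last first.
  rewrite /expres (@zsumE _ (-2) (-1)).
    have -> : zrange (-2) (-1) = [:: -2; -1] by [].
    rewrite big_cons big_seq1 lc_diag scale1r nprod_vacuumrN1; congr (_ + _ *: _).
    rewrite lc_residue; last by rewrite /a; lia.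
    rewrite bc_N2 ifT; last by rewrite /a; lia.
    congr (_%:~R); lia.
  move=> i hi; case: (ltP i 0) => h; last by rewrite nprod_vacuumr ?scaler0.
  by rewrite lc_lt ?scale0r //; lia.
rewrite (linD (mode_linearl q w)) (linZ (mode_linearl q w)) bc_N2 ifT; last by rewrite /a; lia.
have -> : (a - 2 - q + 1)%:~R = (a - 1)%:~R + (- q)%:~R :> F.
  by rewrite -intrD; congr (_%:~R); lia.
rewrite scalerDl => h; apply: (addrI ((a - 1)%:~R *: mode x q w)).
by rewrite addrC h // /a; lia.
Qed.

Lemma weak_assoc_residue : (forall u v, weak_assoc u v) -> residue_identity.
Proof.
move=> wa x y u v hu hv a m q w.
have hq := mode_vder (fun u => wa u one) q w.
have [a0 ha0] := wa u v w; have [a1 ha1] := wa v u w.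
have [N hN] := modeprod_lowb u v w; have [N' hN'] := modeprod_lowb v u w.
apply: (@residue_theorem _ _ _ q (Num.max a0 a1) (Num.min (q - N) (q - N'))
   (fun a m => mode (expres a m u v) q w) (fun a m => mode (expres a m v u) q w)).
- by rewrite -signr_addb addbb.
- by move=> b n; rewrite expres_step (linD (mode_linearl q w)).
- by move=> b n; rewrite (expres_skew _ _ hq hu hv).
- by apply: (lowb_widen (hN q)); lia.
- by apply: (lowb_widen (hN' q)); lia.
- by move=> b n hb; apply: ha0; lia.
- by move=> b n hb; apply: ha1; lia.
Qed.

End Modes.

(** * The universal module: functionals on the vertex super-algebra *)

Section RegularFunctionals.
Variables (F : numFieldType) (V : vertexSuperalgebra F) (X : lmodType F).
Implicit Types (f : V -> X) (u v w : V) (a b m n p q r s : int).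

Local Notation one := (vacuum V).

(** The properties of the map [v |-> v_[n] w] from V to the degree 0 part, for
    [w] of degree [n]: the rational function R(t) that
    expresses [f (Y(u,z) v)] in terms of [t = exp(z)] is finite at infinity and
    has a pole of order at most [n] at 0. *)
Definition regular n f := homog n f /\
  forall a m u v, n + 1 <= a -> a + m < 0 -> f (expres a m u v) = 0.

(** The coefficient of [t^(-p)] in R(t) at infinity, where
    [R(exp z) = f (Y(v,z) u)]; it stands for [v_[p] u_[n-p] f]. *)
Definition rcoef f n v u : int -> X :=
  infcoef (n + 1) (fun m => f (expres (n + 1) m v u)).

(** The action of [u_[r]] on functionals of degree [n]: the image has degree
    [n - r], so that [v_[n-r]] maps it to degree 0. *)
Definition ract f n u r : V -> X := fun v => rcoef f n v u (n - r).

Lemma regular_lin n f : regular n f -> linear f.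
Proof. by case=> -[]. Qed.

Section Fixed.
Variables (n : int) (f : V -> X).
Hypothesis rf : regular n f.

Let lf : linear f := regular_lin rf.

Lemma regular_van v u m : (n + 1) + m < 0 -> f (expres (n + 1) m v u) = 0.
Proof. by case: rf => _ h; apply: h. Qed.

Lemma rcoef_lowb v u : lowb 0 (rcoef f n v u).
Proof. apply: infcoef_lowb; exact: regular_van. Qed.

Lemma rcoefP v u a m : n + 1 <= a ->
  f (expres a m v u) = atinf m a (rcoef f n v u).
Proof.
move=> ha; apply: (@atinf_up _ _ 0 m (n + 1) _ (fun a m => f (expres a m v u))) => //.
- exact: rcoef_lowb.
- by move=> c l; rewrite expres_step (linD lf).
- by move=> l; rewrite (infcoefP (@regular_van v u)).
Qed.

Lemma rcoef_uniq v u (C : int -> X) lo : lowb lo C ->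
  (forall m, atinf m (n + 1) C = f (expres (n + 1) m v u)) -> C =1 rcoef f n v u.
Proof.
move=> Cl hC p; apply: subr0_eq.
apply: (@atinf_uniq _ _ (Num.min lo 0) (n + 1) p (fun p => C p - rcoef f n v u p)) => //.
  by move=> k hk; rewrite Cl ?(rcoef_lowb v u) ?subr0 //; lia.
move=> m _; rewrite /atinf.
transitivity (atinf m (n + 1) C - atinf m (n + 1) (rcoef f n v u)).
  rewrite /atinf -zsumB; first by apply: eq_zsum => i; rewrite scalerBr.
    exact: (atinf_fin m (n + 1) Cl).
  exact: (atinf_fin m (n + 1) (rcoef_lowb v u)).
by rewrite hC -rcoefP ?subrr.
Qed.

Lemma rcoef_fin v u p : zfin (fun i =>
  bp F (p - (n + 1)) i *: f (expres (n + 1) (p - (n + 1) - i) v u)).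
Proof.
exists 0, (p - 0); apply: (@infcoef_supp _ _ (n + 1) 0 (fun m => f (expres (n + 1) m v u))).
exact: regular_van.
Qed.

Lemma rcoef_linearr v p : linear (fun u => rcoef f n v u p).
Proof.
move=> k u u' /=; rewrite /rcoef /infcoef -zsumZ; last exact: rcoef_fin.
rewrite -zsumD; [|exact/zfinZ/rcoef_fin|exact: rcoef_fin].
apply: eq_zsum => i; rewrite (expres_linearr _ _ v) lf scalerDr !scalerA.
by rewrite [_ * k]mulrC.
Qed.

Lemma rcoef_linearl u p : linear (fun v => rcoef f n v u p).
Proof.
move=> k v v' /=; rewrite /rcoef /infcoef -zsumZ; last exact: rcoef_fin.
rewrite -zsumD; [|exact/zfinZ/rcoef_fin|exact: rcoef_fin].
apply: eq_zsum => i; rewrite (expres_linearl _ _ u) lf scalerDr !scalerA.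
by rewrite [_ * k]mulrC.
Qed.

Lemma rcoef_vderl v u p : rcoef f n (vder v) u p = (- p)%:~R *: rcoef f n v u p.
Proof.
have Cl := rcoef_lowb v u.
rewrite -(@rcoef_uniq (vder v) u (fun p => 0 *: rcoef f n v u p +
  (-1) *: (p%:~R *: rcoef f n v u p)) 0).
- by rewrite scale0r add0r scalerA mulN1r rmorphN.
- by move=> k hk; rewrite Cl // !scaler0 addr0.
move=> m; rewrite (atinf_lin _ _ _ _ Cl (lowb_mulint Cl)) (atinf_abs _ _ Cl).
rewrite -!rcoefP; try lia.
by rewrite scale0r add0r scaleN1r expres_vder (linN lf) (linD lf) !(linZ lf).
Qed.

Lemma rcoef_vderr v u p : rcoef f n v (vder u) p = (p - n)%:~R *: rcoef f n v u p.
Proof.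
have Cl := rcoef_lowb v u.
rewrite -(@rcoef_uniq v (vder u) (fun p => (- n)%:~R *: rcoef f n v u p +
  1 *: (p%:~R *: rcoef f n v u p)) 0).
- by rewrite scale1r -scalerDl addrC -intrD.
- by move=> k hk; rewrite Cl // !scaler0 addr0.
move=> m; rewrite (atinf_lin _ _ _ _ Cl (lowb_mulint Cl)) (atinf_abs _ _ Cl).
rewrite -!rcoefP; try lia.
have := expres_vderM (n + 1) m v u => /(congr1 f); rewrite (linD lf).
case: rf => -[_ ->] _; rewrite expres_vder (linN lf) (linD lf) !(linZ lf).
by move=> ->; rewrite scale1r addrAC addNr add0r.
Qed.

(** [f v] is the residue at 1 of R(t) dt/(t (t-1)), where
    [R(exp z) = f (Y(v,z) 1)] is finite at infinity and vanishes at 0. *)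
Lemma regular_neg : n < 0 -> forall v, f v = 0.
Proof.
move=> hn v; have -> : v = expres 0 (-1) v one.
  rewrite /expres (@zsum1 _ (-1)) ?lc_diag ?scale1r ?nprod_vacuumrN1 // => i hi.
  case: (ltP i (-1)) => h; first by rewrite lc_lt ?scale0r.
  by rewrite nprod_vacuumr ?scaler0 //; lia.
by case: rf => _; apply; lia.
Qed.

End Fixed.

(** By the symmetry [t |-> 1/t], finiteness at infinity bounds the pole at 0. *)
Lemma weak_regular n f : homog n f ->
  (forall (x y : bool) u v, vpar x u -> vpar y v -> exists N : int,
     forall a m, N <= a -> a + m < 0 -> f (expres a m u v) = 0) ->
  regular n f.
Proof.
move=> hf wr; split=> // a m u v ha hm; have [lf _] := hf.
elim/vpar_ind: u => [x u hu|u u' hu hu']; last by rewrite (linD (expres_linearl _ _ _)) (linD lf) hu hu' addr0.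
elim/vpar_ind: v => [y v hv|v v' hv hv']; last by rewrite (linD (expres_linearr _ _ _)) (linD lf) hv hv' addr0.
have [N1 h1] := wr _ _ _ _ hu hv; have [N2 h2] := wr _ _ _ _ hv hu.
pose N := Num.max N1 N2.
have van1 l : N + l < 0 -> f (expres N l u v) = 0 by move=> h; apply: h1; rewrite /N; lia.
have van2 l : N + l < 0 -> f (expres N l v u) = 0 by move=> h; apply: h2; rewrite /N; lia.
pose C1 := infcoef N (fun m => f (expres N m u v)).
pose C2 := infcoef N (fun m => f (expres N m v u)).
have l1 : lowb 0 C1 := infcoef_lowb van1; have l2 : lowb 0 C2 := infcoef_lowb van2.
rewrite (@residue_theorem _ _ ((-1) ^+ (x && y)) n N 0 (fun a m => f (expres a m u v))
  (fun a m => f (expres a m v u)) C1 C2) //.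
- rewrite (atinf_lt l1) // [X in _ *: X](atinf_lt l2) ?scaler0 ?subr0 //; lia.
- by rewrite -signr_addb addbb.
- by move=> c l; rewrite expres_step (linD lf).
- by move=> c l; exact: (expres_skew _ _ hf hu hv).
- move=> c l hc; apply: (@atinf_up _ _ 0 l N _ (fun a m => f (expres a m u v))) => //.
    by move=> d k; rewrite expres_step (linD lf).
  by move=> k; rewrite (infcoefP van1).
- move=> c l hc; apply: (@atinf_up _ _ 0 l N _ (fun a m => f (expres a m v u))) => //.
    by move=> d k; rewrite expres_step (linD lf).
  by move=> k; rewrite (infcoefP van2).
Qed.

Lemma expres_assoc_finl u v w a b l n :
  zfin (fun i => bc F l i *: expres a (l - i) u (expres b (n + i) v w)).
Proof.
have [N hN] := expres_trunc v w; exists 0, (N - n) => i hi.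
case: (ltP i 0) => h; first by rewrite bc_lt0 ?scale0r.
by rewrite hN ?(lin0 (expres_linearr _ _ _)) ?scaler0 //; lia.
Qed.

Lemma expres_assoc_finr u v w a b l n :
  zfin (fun i => bc F l i *: expres b (n + l - i) v (expres a i u w)).
Proof.
have [N hN] := expres_trunc u w; exists 0, N => i hi.
case: (ltP i 0) => h; first by rewrite bc_lt0 ?scale0r.
by rewrite hN ?(lin0 (expres_linearr _ _ _)) ?scaler0 //; lia.
Qed.

(** The term of the Jacobi identity with [u] outermost vanishes: it is the
    residue at 1 of a form that has no other pole. *)
Lemma regular_assoc n f (x y : bool) v u w a b l k : regular n f ->
  vpar x v -> vpar y u -> n + 1 <= b -> b + l + k < 0 ->
  f (expres (a + b + l) k (expres a l v u) w) =
  zsum (fun i => bc F l i *: f (expres a (l - i) v (expres b (k + i) u w))).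
Proof.
move=> rf hv hu hb hk; have lf := regular_lin rf.
rewrite (expres_assoc _ _ _ _ _ hv hu) (linB lf) (linZ lf).
rewrite !(zsum_lin lf); [|exact: expres_assoc_finr|exact: expres_assoc_finl].
rewrite [X in _ - _ *: X]zsum0 => [|i].
  by rewrite scaler0 subr0; apply: eq_zsum => i; rewrite (linZ lf).
rewrite (linZ lf); case: (ltP i 0) => hi; first by rewrite bc_lt0 ?scale0r.
by case: rf => _ ->; rewrite ?scaler0 //; lia.
Qed.

(** By [regular_assoc] the functional has no pole at infinity. *)
Lemma ract_regular n f u r : regular n f -> regular (n - r) (ract f n u r).
Proof.
move=> rf; apply: weak_regular.
  split=> [|v]; first exact: rcoef_linearl.
  by rewrite /ract rcoef_vderl.
move=> x y v u1 hv hu1; exists (Num.max (n + 1) (n - r + 1)) => a m ha ham.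
apply: (@atinf_uniq _ _ 0 (n + 1) (n - r) (rcoef f n (expres a m v u1) u)) => //.
  exact: rcoef_lowb.
move=> k hk; rewrite -rcoefP //.
rewrite {1}(_ : n + 1 = a + (n + 1 - a - m) + m); last by lia.
rewrite (regular_assoc _ _ rf hv hu1); try lia.
apply: zsum0 => i; case: (ltP i 0) => hi; first by rewrite bc_lt0 ?scale0r.
by case: rf => _ ->; rewrite ?scaler0 //; lia.
Qed.

Lemma rcoef0 n f v u p : (forall x, f x = 0) -> rcoef f n v u p = 0.
Proof. by move=> f0; apply: zsum0 => i; rewrite f0 scaler0. Qed.

(** This stands for [v_[s] u1_[p] u2_[n-s-p] f]. *)
Definition rprod f n v u1 u2 s p : X :=
  ract (ract f n u2 (n - s - p)) (s + p) u1 p v.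

Lemma rprod_regular n f u s p : regular n f ->
  regular (s + p) (ract f n u (n - s - p)).
Proof.
move=> rf; have := ract_regular u (n - s - p) rf.
by rewrite (_ : n - (n - s - p) = s + p) //; lia.
Qed.

Lemma rprod_lowb n f v u1 u2 s : regular n f -> lowb (- s) (rprod f n v u1 u2 s).
Proof.
move=> rf p hp; apply: rcoef0; apply: (regular_neg (rprod_regular u2 s p rf)); lia.
Qed.

(** Weak associativity for the action of V on functionals. The coefficients of
    [v_[s] (expres b k u1 u2) f] are compared with those of [v_[s] u1_[p] u2_[r] f]
    by the two ways of computing a residue of the three-point function: with
    [v] at [t1], [u1] at [t2] and [u2] at 1, the pairs [u1 u2] or [v u1] may be
    contracted first. *)
Lemma rcoef_expres n f (x y : bool) v u1 u2 s b k : regular n f ->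
  vpar x v -> vpar y u1 -> n + 1 <= b ->
  rcoef f n v (expres b k u1 u2) s = atinf k b (rprod f n v u1 u2 s).
Proof.
move=> rf hv hu1; have lf := regular_lin rf.
have cl s' b' k' : s' < 0 -> rcoef f n v (expres b' k' u1 u2) s' = 0.
  exact: (rcoef_lowb rf).
have Bl s' p : s' < 0 -> rprod f n v u1 u2 s' p = 0.
  move=> hs; rewrite /rprod /ract (_ : s' + p - p = s'); last by lia.
  exact: (rcoef_lowb (rprod_regular u2 s' p rf)).
move: s b k; apply: (@lowb_ind (fun s => forall b k, n + 1 <= b ->
    rcoef f n v (expres b k u1 u2) s = atinf k b (rprod f n v u1 u2 s)) 0).
  by move=> s hs b k _; rewrite cl // /atinf zsum0 // => i; rewrite Bl ?scaler0.
move=> s IHs b k hb; case: (ltP s 0) => hs.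
  by rewrite cl // /atinf zsum0 // => i; rewrite Bl ?scaler0.
(* With the weight [t1^a t2^b (t2-1)^k (t1-t2)^l] there are no residues at
   [t1 = 0] and [t2 = 0] and, [a] being large, at [t2] infinite; the expansion of
   the weight at [t1] infinite starts with [t1^s]. *)
pose a := Num.max (n + 1) (b + s + k + 1); pose l := s - a.
pose c s' b' k' := rcoef f n v (expres b' k' u1 u2) s'.
have E1 : f (expres (b + s) k (expres a l v u1) u2) =
    zsum (fun i => bc F l i *: c (s - i) (b + i) k).
  rewrite (@expand_difference _ _ c 0 l s b k) //; last first.
    by move=> s' b' k'; rewrite /c expres_step (linD (rcoef_linearr rf v s')).
  rewrite (_ : b + s = a + b + l); last by rewrite /l; lia.
  rewrite (regular_assoc _ _ rf hv hu1) //; last by rewrite /l /a; lia.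
  apply: eq_zsum => i; rewrite (rcoefP rf); last by rewrite /a; lia.
  congr (_ *: _); rewrite /atinf; apply: eq_zsum => j; rewrite /c.
  by congr (_ *: rcoef _ _ _ _ _); rewrite /l; lia.
have E2 : f (expres (b + s) k (expres a l v u1) u2) =
    zsum (fun i => bc F l i *: atinf k (b + i) (rprod f n v u1 u2 (s - i))).
  rewrite (rcoefP rf); last by lia.
  transitivity (zsum (fun j => zsum (fun i => (bc F k j * bc F l i) *:
      rprod f n v u1 u2 (s - i) (b + i + k - j)))).
    apply: eq_zsum => j; case: (ltP j 0) => hj.
      by rewrite bc_lt0 // scale0r zsum0 // => i; rewrite mul0r scale0r.
    have rg := ract_regular u2 (n - (b + s + k - j)) rf.
    have -> : rcoef f n (expres a l v u1) u2 (b + s + k - j) =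
        ract f n u2 (n - (b + s + k - j)) (expres a l v u1).
      by rewrite /ract; congr rcoef; lia.
    rewrite (rcoefP rg); last by rewrite /a; lia.
    rewrite /atinf -zsumZ; last exact: (atinf_fin l a (rcoef_lowb rg v u1)).
    apply: eq_zsum => i; rewrite scalerA; congr (_ *: _); rewrite /rprod.
    rewrite /ract (_ : n - (s - i) - (b + i + k - j) = n - (b + s + k - j)); last by lia.
    rewrite (_ : s - i + (b + i + k - j) = b + s + k - j); last by lia.
    rewrite (_ : b + s + k - j - (b + i + k - j) = s - i); last by lia.
    rewrite (_ : n - (n - (b + s + k - j)) = b + s + k - j); last by lia.
    by rewrite (_ : a + l - i = s - i) //; rewrite /l; lia.
  rewrite zsum_exch; last first.
    exists 0, (Num.max s (b + s + k)) => j i h.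
    case: (ltP j 0) => hj; first by rewrite bc_lt0 // mul0r scale0r.
    case: (ltP i 0) => hi; first by rewrite [bc F l i]bc_lt0 // mulr0 scale0r.
    case: (ltP (s - i) 0) => hsi; first by rewrite Bl ?scaler0.
    by rewrite (rprod_lowb v u1 u2 rf) ?scaler0 //; lia.
  apply: eq_zsum => i; rewrite /atinf -zsumZ; last first.
    exact: (atinf_fin k (b + i) (rprod_lowb v u1 u2 (s := s - i) rf)).
  by apply: eq_zsum => j; rewrite scalerA mulrC.
have fin1 : zfin (fun i => bc F l i *: c (s - i) (b + i) k).
  exists 0, s => i hi; case: (ltP i 0) => h; first by rewrite bc_lt0 ?scale0r.
  by rewrite /c cl ?scaler0 //; lia.
have fin2 : zfin (fun i => bc F l i *: atinf k (b + i) (rprod f n v u1 u2 (s - i))).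
  exists 0, s => i hi; case: (ltP i 0) => h; first by rewrite bc_lt0 ?scale0r.
  by rewrite /atinf zsum0 ?scaler0 // => j; rewrite Bl ?scaler0 //; lia.
have := subrr (f (expres (b + s) k (expres a l v u1) u2)).
rewrite {1}E1 E2 -zsumB // (@zsum1 _ 0) => [|i hi].
  by rewrite bc0 !scale1r !subr0 => /subr0_eq.
case: (ltP i 0) => h; first by rewrite bc_lt0 ?scale0r ?subrr.
by rewrite /c IHs ?subrr //; lia.
Qed.

Lemma ract_residue n f (x y : bool) u1 u2 a m q v : regular n f ->
  vpar x u1 -> vpar y u2 ->
  ract f n (expres a m u1 u2) q v =
  atinf m a (rprod f n v u1 u2 (n - q))
  - ((-1) ^+ (x && y) * (-1) ^ m) *:
    atinf m (q - a - m) (rprod f n v u2 u1 (n - q)).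
Proof.
move=> rf hu1 hu2.
have Rl u u' s p : linear (fun v => rprod f n v u u' s p).
  by apply: rcoef_linearl; exact: rprod_regular.
have aD u u' a' v1 v2 : atinf m a' (rprod f n (v1 + v2) u u' (n - q)) =
    atinf m a' (rprod f n v1 u u' (n - q)) + atinf m a' (rprod f n v2 u u' (n - q)).
  rewrite -[X in _ = X + _]scale1r -[X in _ = _ + X]scale1r.
  rewrite -(atinf_lin _ _ _ _ (rprod_lowb _ _ _ rf) (rprod_lowb _ _ _ rf)).
  by apply: atinf_eq => p; rewrite (linD (Rl _ _ _ _)) !scale1r.
elim/vpar_ind: v => [z v hv|v v' hv hv']; last first.
  rewrite (linD (regular_lin (ract_regular (expres a m u1 u2) q rf))) hv hv'.
  rewrite (aD u1 u2 a v v') (aD u2 u1 (q - a - m) v v').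
  by rewrite scalerDr opprD addrACA.
apply: (@residue_theorem _ _ ((-1) ^+ (x && y)) q (n + 1) (- (n - q))
  (fun a m => ract f n (expres a m u1 u2) q v)
  (fun a m => ract f n (expres a m u2 u1) q v)).
- by rewrite -signr_addb addbb.
- by move=> b k; rewrite expres_step /ract (linD (rcoef_linearr rf v _)).
- move=> b k; apply: (@expres_skew _ _ _ q (fun y => ract f n y q v)) hu1 hu2.
  split=> [|w]; first exact: (rcoef_linearr rf).
  by rewrite /ract (rcoef_vderr rf); congr (_%:~R *: _); lia.
- exact: rprod_lowb.
- exact: rprod_lowb.
- by move=> b k hb; rewrite /ract (rcoef_expres _ _ _ rf hv hu1).
- by move=> b k hb; rewrite /ract (rcoef_expres _ _ _ rf hv hu2).
Qed.

Lemma ract_vacuum n f m v : regular n f ->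
  ract f n one m v = if m == 0 then f v else 0.
Proof.
move=> rf; have lf := regular_lin rf; have [hf _] := rf; rewrite /ract.
rewrite -(@rcoef_uniq n f rf v one (fun p => if p == n then f v else 0) n).
- by rewrite (_ : (n - m == n) = (m == 0)) //; lia.
- by move=> p hp; case: eqP => // e; lia.
move=> k; rewrite /atinf (@zsum1 _ (1 + k)) => [|i hi]; last first.
  by rewrite ifN ?scaler0 //; lia.
rewrite ifT; last by lia.
rewrite (zsum_lin lf); last exact: expres_fin.
transitivity (zsum (fun i => (lc F (n + 1) k (- 1 - i) * lc F (- n) 0 i) *: f v)).
  rewrite zsumZl.
    have -> : bc F k (1 + k) = lc F ((n + 1) + (- n)) (k + 0) (- 1).
      by rewrite -lc_residue //; congr lc; lia.
    rewrite lc_mul (zsum_rev (- 1)); congr (_ *: _).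
    by apply: eq_zsum => i; congr (_ * lc F _ _ _); lia.
  exists 0, (- 1 - k) => i hi; case: (ltP i 0) => h; first by rewrite [lc _ _ 0 _]lc_lt ?mulr0.
  by rewrite lc_lt ?mul0r //; lia.
rewrite [RHS](zsum_rev (- 1)); apply: eq_zsum => -[i|i].
  by rewrite (linZ lf) (homog_divided _ _ hf) scalerA.
by rewrite [lc _ _ 0 _]lc_lt // mulr0 scale0r nprod_vacuumr ?scaler0 ?(lin0 lf) //; lia.
Qed.

End RegularFunctionals.

(** * Subspaces as vector spaces, graded submodules *)

Section SubspaceType.
Variables (F : numFieldType) (L : lmodType F) (S : set L).

Definition subsp_pred (hS : subspace S) : {pred L} := fun x => `[< S x >].

Variable hS : subspace S.

Lemma subsp_pred_closed : GRing.submod_closed (subsp_pred hS).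
Proof.
by have [S0 SD] := hS; split; [exact/asboolP|move=> a u v /asboolP Su /asboolP Sv; apply/asboolP; exact: SD].
Qed.

HB.instance Definition _ := GRing.isSubmodClosed.Build F L (subsp_pred hS)
  (GRing.submod_closed_semi subsp_pred_closed).

Record subsp := Subsp { subsp_val : L; _ : subsp_val \in subsp_pred hS }.

HB.instance Definition _ := [isSub for subsp_val].
HB.instance Definition _ := [Choice of subsp by <:].
HB.instance Definition _ := [SubChoice_isSubLmodule of subsp by <:].

Definition mksubsp x (Sx : S x) : subsp := Subsp (asboolT Sx : x \in subsp_pred hS).

Lemma subspP (x : subsp) : S (subsp_val x).
Proof. by case: x => x Sx; apply/asboolP. Qed.

Lemma subsp_val_inj : injective subsp_val.
Proof. exact: val_inj. Qed.

Lemma subsp_val_linear : linear subsp_val.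
Proof. by []. Qed.

End SubspaceType.

Section ModuleLemmas.
Variables (F : numFieldType) (V : vertexSuperalgebra F).

Lemma subspaceZ (L : lmodType F) (S : set L) a x : subspace S -> S x -> S (a *: x).
Proof. by move=> [S0 SD] Sx; have := SD a x 0 Sx S0; rewrite addr0. Qed.

Lemma subspaceD (L : lmodType F) (S : set L) x y : subspace S -> S x -> S y -> S (x + y).
Proof. by move=> [S0 SD] Sx Sy; have := SD 1 x y Sx Sy; rewrite scale1r. Qed.

Lemma subspace_sum (L : lmodType F) (S : set L) (I : Type) (r : seq I)
    (f : I -> L) : subspace S -> (forall i, S (f i)) -> S (\sum_(i <- r) f i).
Proof.
move=> hS Sf; elim: r => [|i r IHr]; first by rewrite big_nil; case: hS.
by rewrite big_cons; exact: subspaceD.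
Qed.

Lemma atinf_map (A B : lmodType F) (g : A -> B) m a lo (C : int -> A) :
  linear g -> lowb lo C -> g (atinf m a C) = atinf m a (fun p => g (C p)).
Proof.
move=> lg Cl; rewrite /atinf (zsum_lin lg); last exact: atinf_fin Cl.
by apply: eq_zsum => i; rewrite (linZ lg).
Qed.

Lemma phi_weak_assoc (W : phiModule V) u v : weak_assoc (@pmode _ _ W) u v.
Proof.
have [k [hl ha]] := @pmode_assoc _ _ W u v.
apply: assoc_residue hl ha; [exact: pmode_linearl|exact: pmode_linearr|exact: pmode_trunc].
Qed.

Lemma phi_residue (W : phiModule V) : residue_identity (@pmode _ _ W).
Proof.
apply: weak_assoc_residue; [exact: pmode_linearl|exact: pmode_linearr|exact: pmode_trunc| |].
  exact: pmode_vacuum.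
exact: phi_weak_assoc.
Qed.

(** The residue identity, unlike the associativity axiom, passes to submodules
    and to products directly. *)
Definition residue_module (W : lmodType F) (mode : V -> int -> W -> W)
  (h1 : forall n w, linear (fun v => mode v n w))
  (h2 : forall v n, linear (mode v n))
  (h3 : forall v w, exists N : int, forall n, N <= n -> mode v n w = 0)
  (h4 : forall n w, mode (vacuum V) n w = if n == 0 then w else 0)
  (h5 : residue_identity mode) : phiModule V :=
  PhiModule h1 h2 h3 h4 (fun u v =>
    weak_assoc_assoc h1 h2 h3 (residue_weak_assoc h1 h2 h3 h5 u v)).

Lemma gr_subspace (W : gradedPhiModule V) n : subspace (@gpm_gr _ _ W n).
Proof. by case: (@gpm_direct _ _ W). Qed.

Section GradedSubmodule.
Variables (W : gradedPhiModule V) (S : set W).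
Hypothesis hS : graded_submodule S.

Let sS : subspace S. Proof. by case: hS. Qed.

Let SW : lmodType F := subsp sS.

Let smode (v : V) (n : int) (x : SW) : SW :=
  mksubsp sS (let: And3 _ h _ := hS in h v n _ (subspP x)).

Let vI : injective (@subsp_val _ _ _ sS). Proof. exact: subsp_val_inj. Qed.

Let vE v n x : subsp_val (smode v n x) = pmode v n (subsp_val x). Proof. by []. Qed.

Lemma sub_linearl n x : linear (fun v => smode v n x).
Proof. by move=> a u v; apply: vI; rewrite /= pmode_linearl. Qed.

Lemma sub_linearr v n : linear (smode v n).
Proof. by move=> a x y; apply: vI; rewrite /= pmode_linearr. Qed.

Lemma sub_trunc v x : exists N : int, forall n, N <= n -> smode v n x = 0.
Proof.
have [N hN] := pmode_trunc v (subsp_val x).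
by exists N => n hn; apply: vI; rewrite vE hN.
Qed.

Lemma sub_vacuum n x : smode (vacuum V) n x = if n == 0 then x else 0.
Proof. by apply: vI; rewrite vE pmode_vacuum; case: eqP. Qed.

Lemma sub_residue : residue_identity smode.
Proof.
move=> x y u v hu hv a m q w; apply: vI.
have [N hN] := modeprod_lowb sub_linearr sub_trunc u v w.
have [N' hN'] := modeprod_lowb sub_linearr sub_trunc v u w.
rewrite vE (phi_residue hu hv) (linB (@subsp_val_linear _ _ _ sS)).
rewrite (linZ (@subsp_val_linear _ _ _ sS)).
by rewrite (atinf_map _ _ (@subsp_val_linear _ _ _ sS) (hN q))
  (atinf_map _ _ (@subsp_val_linear _ _ _ sS) (hN' q)).
Qed.

Definition sub_phiModule : phiModule V :=
  residue_module sub_linearl sub_linearr sub_trunc sub_vacuum sub_residue.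

Definition sub_gr (n : nat) : set sub_phiModule :=
  [set x | gpm_gr n (subsp_val (x : SW))].

Lemma sub_direct : direct_sum sub_gr.
Proof.
have [gs gd gu] := @gpm_direct _ _ W; split.
- by move=> n; have [g0 gD] := gs n; split=> [|a x y]; [exact: g0|exact: gD].
- move=> x; have [N [c [hc e]]] := gd (subsp_val (x : SW)).
  have Sc i : (i < N)%N -> S (c i).
    by case: hS => _ _ h hi; apply: (h N) => //; rewrite -e; exact: subspP.
  pose c' i : SW := if pselect (i < N)%N is left h then mksubsp sS (Sc i h) else 0.
  exists N, c'; split.
    by move=> i; rewrite /sub_gr /= /c'; case: pselect => h //=; case: (gs i).
  apply: vI; rewrite e (lin_sum (@subsp_val_linear _ _ _ sS)).
  apply: eq_bigr => i _; rewrite /c'; case: pselect => // h; case: h; exact: ltn_ord.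
- move=> N c hc e i hi; apply: vI.
  apply: (gu N (fun i => subsp_val (c i : SW))) => //.
  by rewrite -(lin_sum (@subsp_val_linear _ _ _ sS)) e.
Qed.

Lemma sub_degree v (m : int) (n : nat) (x : sub_phiModule) :
  sub_gr n x -> intgrade sub_gr (n%:Z - m) (pmode v m x).
Proof.
move=> hx; have := gpm_degree v m hx.
rewrite /intgrade; case: (n%:Z - m) => k //= h.
by apply: vI; exact: h.
Qed.

Definition sub_graded : gradedPhiModule V := GradedPhiModule sub_direct sub_degree.

End GradedSubmodule.

End ModuleLemmas.

(** * The graded module of functionals *)

Section FunctionalModule.
Variables (F : numFieldType) (V : vertexSuperalgebra F) (X : lmodType F).

(** Degrees are integers, because regular functionals of negative degree vanish
    ([regular_neg]). *)
Definition grfun := int -> V -> X.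

HB.instance Definition _ := GRing.Lmodule.on grfun.

Lemma regularZD n (f g : V -> X) (a : F) : regular n f -> regular n g ->
  regular n (fun v => a *: f v + g v).
Proof.
move=> [[lf Df] vf] [[lg Dg] vg]; split; first split.
- move=> b u v /=; rewrite lf lg !scalerDr !scalerA [a * b]mulrC.
  by rewrite -!addrA; congr (_ + _); rewrite addrCA.
- by move=> x; rewrite Df Dg scalerDr !scalerA mulrC.
- by move=> b m u v hb hm; rewrite vf // vg // scaler0 addr0.
Qed.

Lemma regular0 n : regular n (fun _ : V => 0 : X).
Proof.
split=> //; split=> [b u v|x] /=; by rewrite ?scaler0 ?addr0.
Qed.

Lemma rcoef_linear_fun n (f g : V -> X) (a : F) v u p : regular n f -> regular n g ->
  rcoef (fun v => a *: f v + g v) n v u p = a *: rcoef f n v u p + rcoef g n v u p.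
Proof.
move=> rf rg; have h1 := rcoef_fin rf v u p; have h2 := rcoef_fin rg v u p.
rewrite /rcoef /infcoef -(zsumZ _ h1) -zsumD //; last exact: zfinZ.
by apply: eq_zsum => i; rewrite scalerDr !scalerA [a * _]mulrC.
Qed.

(** The direct sum of the spaces of regular functionals. *)
Definition regfun : set grfun := [set w | (forall k, regular k (w k)) /\
  exists N : nat, forall k : int, N%:Z <= k -> forall v, w k v = 0].

Lemma regfun_subspace : subspace regfun.
Proof.
split=> [|a w w' [rw [N hN]] [rw' [N' hN']]].
  by split=> [k|]; [exact: regular0|exists 0%N].
split=> [k|]; first exact: regularZD.
exists (maxn N N') => k hk v; rewrite -[LHS]/(a *: w k v + w' k v).
by rewrite hN ?hN' ?scaler0 ?addr0 //; lia.
Qed.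

Definition gmode0 (u : V) (m : int) (w : grfun) : grfun := fun k => ract (w (k + m)) (k + m) u m.

Lemma regfun_mode u m w : regfun w -> regfun (gmode0 u m w).
Proof.
move=> [rw [N hN]]; split=> [k|].
  by have := ract_regular u m (rw (k + m)); rewrite addrK.
exists (N + absz m)%N => k hk v; apply: rcoef0 => x; apply: hN; lia.
Qed.

Let GW : lmodType F := subsp regfun_subspace.
Implicit Types w : GW.

Definition gmode (u : V) (m : int) (w : GW) : GW :=
  mksubsp regfun_subspace (regfun_mode u m (subspP w)).

Definition geval (k : int) (v : V) (w : GW) : X := subsp_val w k v.

Lemma geval_linear k v : linear (geval k v). Proof. by []. Qed.

Lemma geval_inj (w w' : GW) : (forall k v, geval k v w = geval k v w') -> w = w'.
Proof.
by move=> e; apply: subsp_val_inj; apply/funext => k; apply/funext => v; exact: e.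
Qed.

Lemma geval_mode k v u m w :
  geval k v (gmode u m w) = ract (subsp_val w (k + m)) (k + m) u m v.
Proof. by []. Qed.

Lemma gregular (w : GW) k : regular k (subsp_val w k).
Proof. by have [] := subspP w. Qed.

Lemma geval_neg k v (w : GW) : k < 0 -> geval k v w = 0.
Proof. by move=> hk; apply: (regular_neg (gregular w k)). Qed.

Lemma gmode_linearl n w : linear (fun v => gmode v n w).
Proof.
move=> a u v; apply: geval_inj => k x; rewrite (geval_linear k x) !geval_mode.
exact: (rcoef_linearr (gregular w _)).
Qed.

Lemma gmode_linearr v n : linear (gmode v n).
Proof.
move=> a w w'; apply: geval_inj => k x; rewrite (geval_linear k x) !geval_mode.
exact: (rcoef_linear_fun _ _ _ _ (gregular w _) (gregular w' _)).
Qed.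

Lemma gmode_trunc v w : exists N : int, forall n, N <= n -> gmode v n w = 0.
Proof.
have [_ [N hN]] := subspP w; exists N%:Z => n hn; apply: geval_inj => k x.
case: (ltP k 0) => hk; first by rewrite !geval_neg.
by rewrite geval_mode; apply: rcoef0 => y; apply: hN; lia.
Qed.

Lemma gmode_vacuum n w : gmode (vacuum V) n w = if n == 0 then w else 0.
Proof.
apply: geval_inj => k x; rewrite geval_mode (ract_vacuum _ _ (gregular w _)).
by case: eqP => [->|] //; rewrite addr0.
Qed.

Lemma gmode_residue : residue_identity gmode.
Proof.
move=> x y u1 u2 hu1 hu2 a m q w; apply: geval_inj => k v.
have [N hN] := modeprod_lowb gmode_linearr gmode_trunc u1 u2 w.
have [N' hN'] := modeprod_lowb gmode_linearr gmode_trunc u2 u1 w.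
rewrite (linB (geval_linear k v)) (linZ (geval_linear k v)).
rewrite (atinf_map _ _ (geval_linear k v) (hN q)) (atinf_map _ _ (geval_linear k v) (hN' q)).
rewrite geval_mode (ract_residue _ _ _ _ (gregular w _) hu1 hu2).
have E u u' p : geval k v (modeprod gmode u u' w q p) =
    rprod (subsp_val w (k + q)) (k + q) v u u' (k + q - q) p.
  rewrite /modeprod geval_mode /rprod /=.
  rewrite /gmode0 (_ : k + p + (q - p) = k + q); last by lia.
  rewrite (_ : k + q - q + p = k + p); last by lia.
  by rewrite (_ : k + q - (k + q - q) - p = q - p) //; lia.
congr (_ - _ *: _); apply: atinf_eq => p; by rewrite E.
Qed.

Definition fun_phiModule : phiModule V :=
  residue_module gmode_linearl gmode_linearr gmode_trunc gmode_vacuum gmode_residue.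

Definition fun_gr (n : nat) : set fun_phiModule :=
  [set w | forall k v, k != n%:Z -> geval k v (w : GW) = 0].

Definition single (n : int) (f : V -> X) : grfun := fun k => if k == n then f else fun=> 0.

Lemma single_regfun n f : regular n f -> regfun (single n f).
Proof.
move=> rf; split=> [k|]; first by rewrite /single; case: eqP => [->|_] //; exact: regular0.
exists (absz n).+1 => k hk v; rewrite /single ifN //; lia.
Qed.

Lemma fun_direct : direct_sum fun_gr.
Proof.
split.
- move=> n; split=> [k v _|a w w' hw hw' k v hk] //.
  by rewrite (geval_linear k v) hw // hw' // scaler0 addr0.
- move=> w; have [rw [N hN]] := subspP (w : GW).
  pose c (i : nat) : GW := mksubsp regfun_subspace (single_regfun (rw i)).
  have cE i k v : geval k v (c i) = if k == i%:Z then geval k v (w : GW) else 0.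
    by rewrite /geval /= /single; case: eqP => [->|].
  exists N, c; split=> [i k v hk|]; first by rewrite cE (negPf hk).
  apply: geval_inj => k v; rewrite (lin_sum (geval_linear k v)).
  case: (boolP ((0 <= k) && (k < N%:Z))) => [hk|hk].
    have [n en] : exists n : nat, k = n%:Z by exists (absz k); lia.
    have hn : (n < N)%N by lia.
    rewrite (bigD1 (Ordinal hn)) // big1 => [|i hi].
      by rewrite Monoid.mulm1 cE en /= eqxx.
    by rewrite cE ifN // en; apply: contraNneq hi => -[e]; apply/eqP/val_inj.
  rewrite big1 => [|i _]; last by rewrite cE ifN //; have := ltn_ord i; lia.
  case: (ltP k 0) => h; first exact: geval_neg.
  by apply: hN; lia.
- move=> N c hc e i hi; apply: geval_inj => k v.
  case: (eqVneq k i%:Z) => [->|hk]; last exact: hc.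
  have := congr1 (geval i%:Z v) e; rewrite (lin_sum (geval_linear _ v)).
  rewrite (bigD1 (Ordinal hi)) // big1 ?Monoid.mulm1 // => j hj.
  by apply: hc; apply: contraNneq hj => -[e']; apply/eqP/val_inj.
Qed.

Lemma fun_degree v (m : int) (n : nat) (w : fun_phiModule) :
  fun_gr n w -> intgrade fun_gr (n%:Z - m) (pmode v m w).
Proof.
move=> hw.
have h0 k x : k + m != n%:Z -> geval k x (gmode v m (w : GW)) = 0.
  by move=> hk; rewrite geval_mode; apply: rcoef0 => y; exact: hw.
rewrite /intgrade; case e : (n%:Z - m) => [j|j].
  by move=> k x hk; apply: h0; lia.
apply: geval_inj => k x; case: (ltP k 0) => hk; first exact: geval_neg.
by apply: h0; lia.
Qed.

Definition fun_graded : gradedPhiModule V := GradedPhiModule fun_direct fun_degree.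

End FunctionalModule.

(** * Submodules generated in degree 0 *)

Section Span.
Variables (F : numFieldType) (L : lmodType F).
Implicit Types (A B S : set L).

Lemma span_incl A x : A x -> linear_span A x.
Proof.
move=> Ax; exists 1%N, (fun=> 1), (fun=> x); split=> //.
by rewrite big_ord1 scale1r.
Qed.

Lemma span_min A S : subspace S -> (forall x, A x -> S x) ->
  forall x, linear_span A x -> S x.
Proof.
move=> hS AS x [n [a [y [Ay ->]]]]; apply: subspace_sum => // i.
by apply: subspaceZ => //; apply: AS.
Qed.

Lemma subspaceN S x : subspace S -> S x -> S (- x).
Proof. by move=> hS Sx; rewrite -scaleN1r; apply: subspaceZ. Qed.

Lemma subspaceB S x y : subspace S -> S x -> S y -> S (x - y).
Proof. by move=> hS Sx Sy; apply: subspaceD => //; apply: subspaceN. Qed.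

Lemma subspace_zsum S (f : int -> L) : subspace S -> zfin f ->
  (forall i, S (f i)) -> S (zsum f).
Proof.
by move=> hS [lo [hi fs]] Sf; rewrite (zsumE fs); apply: subspace_sum.
Qed.

Lemma zsumD1 (f : int -> L) : zfin f ->
  zsum f = f 0 + zsum (fun i => if i == 0 then 0 else f i).
Proof.
move=> [lo [hi fs]].
transitivity (zsum (fun i => if i == 0 then f i else 0)
            + zsum (fun i => if i == 0 then 0 else f i)).
  rewrite -zsumD; first by apply: eq_zsum => i; case: eqP; rewrite ?addr0 ?add0r.
  - by exists lo, hi => i hi'; rewrite fs // if_same.
  - by exists lo, hi => i hi'; rewrite fs // if_same.
by rewrite (@zsum1 _ 0 (fun i => if i == 0 then f i else 0)) // => i /negPf ->.
Qed.

End Span.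

Section GradedModules.
Variables (F : numFieldType) (V : vertexSuperalgebra F).

Section OneModule.
Variable W : gradedPhiModule V.
Implicit Types (v : V) (w x : W).

Lemma gr0 n : @gpm_gr _ _ W n 0.
Proof. by case: (gr_subspace W n). Qed.

Lemma gr_decomp w : exists (N : nat) (c : nat -> W),
  (forall i, gpm_gr i (c i)) /\ w = \sum_(i < N) c i.
Proof. by case: (@gpm_direct _ _ W) => _ h _; exact: h. Qed.

Lemma gr_uniq (N : nat) (c : nat -> W) : (forall i, gpm_gr i (c i)) ->
  \sum_(i < N) c i = 0 -> forall i, (i < N)%N -> c i = 0.
Proof. by case: (@gpm_direct _ _ W) => _ _ h; exact: h. Qed.

Lemma sum_pad (A : nmodType) (N M : nat) (c : nat -> A) : (N <= M)%N ->
  \sum_(i < M) (if (i < N)%N then c i else 0) = \sum_(i < N) c i.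
Proof.
by move=> h; rewrite -big_mkcond (big_ord_widen M c h).
Qed.

Lemma sum_single (A : nmodType) (n N : nat) (x : A) : (n < N)%N ->
  \sum_(i < N) (if i == n :> nat then x else 0) = x.
Proof.
move=> h; rewrite (bigD1 (Ordinal h)) //= eqxx big1 ?addr0 // => i hi.
by rewrite ifN //; apply: contraNneq hi => e; apply/eqP/val_inj.
Qed.

Lemma gr_decomp_uniq (N M : nat) (c d : nat -> W) :
  (forall i, gpm_gr i (c i)) -> (forall i, gpm_gr i (d i)) ->
  \sum_(i < N) c i = \sum_(i < M) d i ->
  forall i, (if (i < N)%N then c i else 0) = (if (i < M)%N then d i else 0).
Proof.
move=> hc hd e i; pose K := (maxn (maxn N M) i.+1); apply: subr0_eq.
apply: (@gr_uniq K (fun i => (if (i < N)%N then c i else 0) - (if (i < M)%N then d i else 0))).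
- move=> j; apply: subspaceB; first exact: gr_subspace.
    by case: ifP => _; [exact: hc|exact: gr0].
  by case: ifP => _; [exact: hd|exact: gr0].
- by rewrite sumrB !sum_pad ?e ?subrr //; rewrite /K; lia.
- rewrite /K; lia.
Qed.

Lemma gr_disjoint n m x : gpm_gr n x -> gpm_gr m x -> n != m -> x = 0.
Proof.
move=> hn hm nm.
have := @gr_decomp_uniq n.+1 m.+1 (fun i => if i == n then x else 0)
  (fun i => if i == m then x else 0).
rewrite !sum_single // => /(_ _ _ erefl n).
rewrite ltnSn eqxx (negPf nm) if_same; apply.
- by move=> i; case: eqP => [->|_] //; exact: gr0.
- by move=> i; case: eqP => [->|_] //; exact: gr0.
Qed.

(** The terms of a linear combination of homogeneous vectors are grouped by
    degree. *)
Lemma span_component (A : set W) : (forall x, A x -> exists n, gpm_gr n x) ->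
  forall (N : nat) (c : nat -> W), (forall i, gpm_gr i (c i)) ->
  linear_span A (\sum_(i < N) c i) ->
  forall i, (i < N)%N -> linear_span (A `&` gpm_gr i) (c i).
Proof.
move=> hA N c hc [k [a [x [Ax e]]]] i hi.
have /choice [d hd] : forall j, exists n, gpm_gr n (x j) by move=> j; exact: hA.
pose e' n := \sum_(j < k | d j == n) a j *: x j.
have ge n : gpm_gr n (e' n).
  rewrite /e' big_mkcond; apply: subspace_sum; first exact: gr_subspace.
  move=> j; case: eqP => [<-|_]; last exact: gr0.
  by apply: subspaceZ; [exact: gr_subspace|exact: hd].
pose M := \max_(j < k) (d j).+1.
have eM : \sum_(n < M) e' n = \sum_(j < k) a j *: x j.
  under eq_bigr do rewrite /e' big_mkcond.
  rewrite exchange_big; apply: eq_bigr => j _.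
  have hj : (d j < M)%N by rewrite /M (bigD1 j) //= leq_max leqnn.
  rewrite -[RHS](sum_single _ hj); apply: eq_bigr => n _.
  by rewrite eq_sym.
have := gr_decomp_uniq hc ge (etrans e (esym eM)) i.
rewrite hi => ->; case: ifP => _; last first.
  by have [] := subspace_linear_span (A `&` gpm_gr i).
rewrite /e' big_mkcond; apply: subspace_sum; first exact: subspace_linear_span.
move=> j; case: eqP => [dj|_]; last by have [] := subspace_linear_span (A `&` gpm_gr i).
apply: subspaceZ; first exact: subspace_linear_span.
by apply: span_incl; split => //; rewrite -dj; exact: hd.
Qed.

Definition mode_image (T : set W) : set W :=
  [set w | exists v m x, T x /\ w = pmode v m x].

(** The submodule generated by [T], when [T] consists of vectors of degree 0. *)
Definition generated (T : set W) : set W := linear_span (mode_image T).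

Lemma deg0_mode v (m : int) x : gpm_gr 0 x -> 0 < m -> pmode v m x = 0.
Proof. by move=> hx; have := gpm_degree v m hx; case: m => // -[|m]. Qed.

Lemma deg0_mode_gr v (m : int) (n : nat) x : gpm_gr 0 x -> m = - n%:Z ->
  gpm_gr n (pmode v m x).
Proof. by move=> hx ->; have := gpm_degree v (- n%:Z) hx; rewrite sub0r opprK. Qed.

Variable T : set W.
Hypothesis T0 : forall x, T x -> gpm_gr 0 x.

Let G0 : subspace (generated T). Proof. exact: subspace_linear_span. Qed.

Lemma mode_image_incl v m x : T x -> generated T (pmode v m x).
Proof. by move=> Tx; apply: span_incl; exists v, m, x. Qed.

Lemma generated_incl x : T x -> generated T x.
Proof.
by move=> Tx; have := mode_image_incl (vacuum V) 0 Tx; rewrite pmode_vacuum eqxx.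
Qed.

Lemma mode_image_homog x : mode_image T x -> exists n, gpm_gr n x.
Proof.
move=> [v [m [y [/T0 hy ->]]]]; case: (ltP 0 m) => hm.
  by exists 0%N; rewrite deg0_mode //; exact: gr0.
by exists (absz m); apply: deg0_mode_gr => //; lia.
Qed.

(** A product [u_[p] v_[b]] applied to a vector of degree 0 is rewritten by
    weak associativity, modulo products with a larger [b]. *)
Lemma generated_mode u p w : generated T w -> generated T (pmode u p w).
Proof.
have lr := @pmode_linearr _ _ W; have ll := @pmode_linearl _ _ W.
apply: (@span_min _ _ (mode_image T) [set w | generated T (pmode u p w)]).
  split=> [|a x y hx hy] /=; first by rewrite (lin0 (lr u p)); case: G0.
  by rewrite lr; case: G0 => _; apply.
move=> _ [v [b [x [Tx ->]]]] /=; have hx := T0 Tx.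
elim/vpar_ind: u => [y u hu|u u' hu hu']; last by rewrite (linD (ll p _)); apply: subspaceD.
elim/vpar_ind: v => [z v hv|v v' hv hv']; last first.
  by rewrite (linD (ll b x)) (linD (lr u p)); apply: subspaceD.
rewrite -[b]opprK; move: (- b) p => c; apply: (@lowb_ind (fun c => forall p,
  generated T (pmode u p (pmode v (- c) x))) 0) => {c} [c hc p|c IHc p].
  by rewrite (deg0_mode v hx) ?(lin0 (lr u p)); [case: G0|lia].
have h := @phi_residue _ _ W _ _ _ _ hu hv 1 (p - 1) (p - c) x.
rewrite [X in _ - _ *: X]zsum0 in h; last first.
  move=> i; case: (ltP i 0) => hi; first by rewrite bc_lt0 ?scale0r.
  by rewrite /modeprod (deg0_mode u hx) ?(lin0 (lr v _)) ?scaler0 //; lia.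
have fin : zfin (fun i => bc F (p - 1) i *: modeprod (@pmode _ _ W) u v x (p - c) (1 + (p - 1) - i)).
  exists 0, c => i hi; case: (ltP i 0) => hi0; first by rewrite bc_lt0 ?scale0r.
  by rewrite /modeprod (deg0_mode v hx) ?(lin0 (lr u _)) ?scaler0 //; lia.
rewrite scaler0 subr0 /atinf (zsumD1 fin) bc0 scale1r in h.
have -> : pmode u p (pmode v (- c) x) = modeprod (@pmode _ _ W) u v x (p - c) (1 + (p - 1) - 0).
  rewrite /modeprod (_ : 1 + (p - 1) - 0 = p); last by lia.
  by congr pmode; congr pmode; lia.
rewrite -[X in generated T X](addrK (zsum (fun i => if i == 0 then 0 else
  bc F (p - 1) i *: modeprod (@pmode _ _ W) u v x (p - c) (1 + (p - 1) - i)))).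
rewrite -h; apply: subspaceB => //; first exact: mode_image_incl.
apply: subspace_zsum => //.
  by case: fin => lo [hi fs]; exists lo, hi => i hi'; rewrite fs // if_same.
move=> i; case: eqP => [_|/eqP i0]; first by case: G0.
case: (ltP i 0) => hi; first by rewrite bc_lt0 // scale0r; case: G0.
apply: subspaceZ => //; rewrite /modeprod.
rewrite (_ : p - c - (1 + (p - 1) - i) = - (c - i)); last by lia.
by apply: IHc; lia.
Qed.

Lemma generated_graded : graded_submodule (generated T).
Proof.
split=> [//|v n w|N c hc Gc i hi]; first exact: generated_mode.
apply: (@span_min _ _ (mode_image T `&` gpm_gr i)) => //.
  by move=> x [Ax _]; exact: span_incl.
exact: (span_component mode_image_homog hc Gc).
Qed.

(** A vector [v_[m] x] with [m != 0] has no component of degree 0. *)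
Lemma generated_deg0 : subspace T -> (forall v x, T x -> T (pmode v 0 x)) ->
  forall x, gpm_gr 0 x -> generated T x -> T x.
Proof.
move=> sT mT x hx Gx.
pose c i := if i == 0%N then x else 0.
have hc i : gpm_gr i (c i) by rewrite /c; case: eqP => [->|_] //; exact: gr0.
have := @span_component _ mode_image_homog 1 c hc.
rewrite big_ord1 => /(_ Gx 0%N erefl); apply: span_min => // y.
move=> [[v [m [z [Tz ->]]]] hy]; have hz := T0 Tz.
case: (eqVneq m 0) => [->|m0]; first exact: mT.
suff -> : pmode v m z = 0 by case: sT.
case: (ltP 0 m) => hm; first exact: deg0_mode.
have em : m = - (absz m)%:Z by lia.
by apply: gr_disjoint hy (deg0_mode_gr v hz em) _; lia.
Qed.

End OneModule.

(** The direct sum of two modules, in which the graph of an isomorphism is to be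
    found. *)
Section Product.
Variables W1 W2 : gradedPhiModule V.

Let P : lmodType F := (W1 * W2)%type.

Let mode (v : V) (n : int) (w : P) : P := (pmode v n w.1, pmode v n w.2).

Lemma prod_linearl n w : linear (fun v => mode v n w).
Proof. by move=> a u v; rewrite /mode !pmode_linearl. Qed.

Lemma prod_linearr v n : linear (mode v n).
Proof. by move=> a u w; rewrite /mode !pmode_linearr. Qed.

Lemma prod_trunc v w : exists N : int, forall n, N <= n -> mode v n w = 0.
Proof.
have [N1 h1] := pmode_trunc v w.1; have [N2 h2] := pmode_trunc v w.2.
by exists (Num.max N1 N2) => n hn; rewrite /mode h1 ?h2 //; lia.
Qed.

Lemma prod_vacuum n w : mode (vacuum V) n w = if n == 0 then w else 0.
Proof. by rewrite /mode !pmode_vacuum; case: eqP => // _; case: w. Qed.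

Lemma prod_residue : residue_identity mode.
Proof.
move=> x y u v hu hv a m q w.
have [N hN] := modeprod_lowb prod_linearr prod_trunc u v w.
have [N' hN'] := modeprod_lowb prod_linearr prod_trunc v u w.
have l1 : linear (fun w : P => w.1) by [].
have l2 : linear (fun w : P => w.2) by [].
have E (A : lmodType F) (g : P -> A) : linear g ->
    g (atinf m a (modeprod mode u v w q) -
    ((-1) ^+ (x && y) * (-1) ^ m) *: atinf m (q - a - m) (modeprod mode v u w q))
  = atinf m a (fun p => g (modeprod mode u v w q p)) -
    ((-1) ^+ (x && y) * (-1) ^ m) *:
      atinf m (q - a - m) (fun p => g (modeprod mode v u w q p)).
  move=> lg; rewrite (linB lg) (linZ lg).
  by rewrite (atinf_map _ _ lg (hN q)) (atinf_map _ _ lg (hN' q)).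
apply: injective_projections.
  by rewrite (E _ _ l1); exact: (@phi_residue _ _ W1 _ _ _ _ hu hv).
by rewrite (E _ _ l2); exact: (@phi_residue _ _ W2 _ _ _ _ hu hv).
Qed.

Definition prod_phiModule : phiModule V := residue_module prod_linearl
  prod_linearr prod_trunc prod_vacuum prod_residue.

Definition prod_gr (n : nat) : set prod_phiModule :=
  [set w | gpm_gr n (w : P).1 /\ gpm_gr n (w : P).2].

Lemma prod_direct : direct_sum prod_gr.
Proof.
have S1 (I : Type) (r : seq I) (c : I -> P) :
    (\sum_(i <- r) c i).1 = \sum_(i <- r) (c i).1.
  exact: (lin_sum (g := fun w : P => w.1)).
have S2 (I : Type) (r : seq I) (c : I -> P) :
    (\sum_(i <- r) c i).2 = \sum_(i <- r) (c i).2.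
  exact: (lin_sum (g := fun w : P => w.2)).
split.
- move=> n; have [z1 d1] := gr_subspace W1 n; have [z2 d2] := gr_subspace W2 n.
  by split=> [//|a u v [hu hu'] [hv hv']]; split; [exact: d1|exact: d2].
- move=> w; have [N1 [c1 [h1 e1]]] := gr_decomp (w : P).1.
  have [N2 [c2 [h2 e2]]] := gr_decomp (w : P).2.
  exists (maxn N1 N2), (fun i => (if (i < N1)%N then c1 i else 0,
                                  if (i < N2)%N then c2 i else 0)).
  split=> [i|].
    by split=> /=; [case: ifP => _; [exact: h1|exact: gr0]|case: ifP => _; [exact: h2|exact: gr0]].
  apply: injective_projections; rewrite (S1, S2) /=.
    by rewrite sum_pad ?leq_maxl.
  by rewrite sum_pad ?leq_maxr.
- move=> N c hc e i hi; apply: injective_projections.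
    apply: (@gr_uniq W1 N (fun i => (c i : P).1)) => // [j|]; first by have [] := hc j.
    by rewrite -S1 e.
  apply: (@gr_uniq W2 N (fun i => (c i : P).2)) => // [j|]; first by have [] := hc j.
  by rewrite -S2 e.
Qed.

Lemma prod_degree v (m : int) (n : nat) (w : prod_phiModule) :
  prod_gr n w -> intgrade prod_gr (n%:Z - m) (pmode v m w).
Proof.
move=> [h1 h2]; have := gpm_degree v m h1; have := gpm_degree v m h2.
rewrite /intgrade; case: (n%:Z - m) => k //=.
by move=> e2 e1; apply: injective_projections.
Qed.

Definition prod_graded : gradedPhiModule V := GradedPhiModule prod_direct prod_degree.

End Product.

(** * The action of the Zhu algebra in degree 0 *)

Lemma zhu_res_expres d (u v : V) : zhu_res d u v = expres 1 (- d%:Z) u v.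
Proof.
have [N hN] := nprod_trunc u v.
rewrite /zhu_res (@natsum_zsum _ _ (absz (N + d%:Z)%R)) => [|j hj]; last first.
  by rewrite hN ?scaler0 //; lia.
rewrite /expres [RHS](zsum_shift (- d%:Z)); apply: eq_zsum => -[j|j]; last first.
  by rewrite lc_lt ?scale0r //; lia.
congr (_ *: _); rewrite (@lcE _ _ _ _ j) /kser; last by lia.
have kE (s t : series F) : s = t -> fps_mul (sexp F 1) s = sexp F 1 * t by move=> ->.
have e1 : fps_expo (1 : F) = sexp F 1 by [].
have uE := sE_unit F.
have iE : fps_inv (fps_expm1_divx F) = (sE F)^-1 :> series F.
  rewrite -[RHS]/(series_inv (sE F)) /series_inv ifN //; exact: fps_expm1_divx0.
rewrite /zhu_kernel iE e1 -[fps_exp _ _]seriesX.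
by rewrite -exprz_inv -exprnP.
Qed.

Section Degree0.
Variable W : gradedPhiModule V.
Implicit Types x : W.

(** For [a = 1] and vectors of degree 0 there is no residue at 0; at infinity one
    term remains for [m = -1] and none for [m = -2]. *)
Lemma deg0_zhu (u v : V) x : gpm_gr 0 x ->
  pmode (zhu_res 1 u v) 0 x = pmode u 0 (pmode v 0 x) /\
  pmode (zhu_res 2 u v) 0 x = 0.
Proof.
move=> hx; have lr := @pmode_linearr _ _ W; have ll := @pmode_linearl _ _ W.
rewrite !zhu_res_expres.
elim/vpar_ind: u => [y u hu|u u' [h1 h2] [h1' h2']]; last first.
  rewrite !(linD (expres_linearl _ _ v)) !(linD (ll 0 x)) h1 h2 h1' h2'.
  by rewrite (linD (ll 0 _)) addr0.
elim/vpar_ind: v => [z v hv|v v' [h1 h2] [h1' h2']]; last first.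
  rewrite !(linD (expres_linearr _ _ u)) !(linD (ll 0 x)) h1 h2 h1' h2'.
  by rewrite (linD (lr u 0)) addr0.
have Z (m : int) : -2 <= m -> m <= -1 ->
    atinf m (0 - 1 - m) (modeprod (@pmode _ _ W) v u x 0) = 0.
  move=> hm hm'; apply: zsum0 => i; case: (ltP i 0) => hi; first by rewrite bc_lt0 ?scale0r.
  by rewrite /modeprod (deg0_mode u hx) ?(lin0 (lr v _)) ?scaler0 //; lia.
rewrite !(phi_residue hu hv) !Z // !scaler0 !subr0; split; last first.
  apply: zsum0 => i; case: (ltP i 0) => hi; first by rewrite bc_lt0 ?scale0r.
  by rewrite /modeprod (deg0_mode v hx) ?(lin0 (lr u _)) ?scaler0 //; lia.
rewrite /atinf (@zsum1 _ 0) => [|i hi0]; first by rewrite bc0 scale1r /modeprod.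
case: (ltP i 0) => hi; first by rewrite bc_lt0 ?scale0r.
by rewrite /modeprod (deg0_mode v hx) ?(lin0 (lr u _)) ?scaler0 //; lia.
Qed.

Lemma deg0_Otilde (v : V) x : gpm_gr 0 x -> Otilde v -> pmode v 0 x = 0.
Proof.
move=> hx; apply: (@span_min _ _ _ [set v | pmode v 0 x = 0]).
  split=> [|a u u' /= hu hu']; first exact: (lin0 (@pmode_linearl _ _ W 0 x)).
  by rewrite (@pmode_linearl _ _ W) hu hu' scaler0 addr0.
by move=> _ [u [u' ->]]; case: (deg0_zhu u u' hx).
Qed.

Let U : lmodType F := subsp (gr_subspace W 0).

Lemma deg0_stable v (x : U) : @gpm_gr _ _ W 0 (pmode v 0 (subsp_val x)).
Proof. exact: (deg0_mode_gr v (n := 0) (subspP x)). Qed.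

Definition at_rep (a : Atilde V) : V := projT1 (cid (to_Atilde_surj a)).

Lemma at_repK a : to_Atilde (at_rep a) = a.
Proof. by rewrite /at_rep; case: cid. Qed.

Definition deg0_act (a : Atilde V) (x : U) : U :=
  mksubsp (gr_subspace W 0) (deg0_stable (at_rep a) x).

Lemma deg0_actE v (x : U) : subsp_val (deg0_act (to_Atilde v) x) = pmode v 0 (subsp_val x).
Proof.
apply/eqP; rewrite -subr_eq0 /=.
have ll := @pmode_linearl _ _ W 0 (subsp_val x).
rewrite -(linB ll); apply/eqP; apply: (deg0_Otilde (subspP x)).
apply/to_Atilde_eq0; rewrite (linB (@to_Atilde_linear _ V)) at_repK subrr //.
Qed.

Let vI : injective (@subsp_val _ _ _ (gr_subspace W 0)).
Proof. exact: subsp_val_inj. Qed.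

Lemma deg0_act_linearl (x : U) : linear (fun a => deg0_act a x).
Proof.
move=> k a b; apply: vI.
transitivity (pmode (k *: at_rep a + at_rep b) 0 (subsp_val x)).
  by rewrite -deg0_actE (@to_Atilde_linear _ V) !at_repK.
exact: (@pmode_linearl _ _ W).
Qed.

Lemma deg0_act_linearr a : linear (deg0_act a).
Proof. by move=> k x y; apply: vI; rewrite /= pmode_linearr. Qed.

Lemma deg0_act1 (x : U) : deg0_act (to_Atilde (vacuum V)) x = x.
Proof. by apply: vI; rewrite deg0_actE pmode_vacuum eqxx. Qed.

Lemma deg0_actM u v (x : U) : deg0_act (to_Atilde (zhu_mul u v)) x =
  deg0_act (to_Atilde u) (deg0_act (to_Atilde v) x).
Proof.
apply: vI; rewrite !deg0_actE; by case: (deg0_zhu u v (subspP x)).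
Qed.

Definition deg0_atmod : AtModule V :=
  ATModule deg0_act_linearl deg0_act_linearr deg0_act1 deg0_actM.

Lemma deg0_atmodP : degree0_module W deg0_atmod.
Proof.
pose j (x : deg0_atmod) : W := subsp_val (x : U).
have lj : linear j by [].
exists (mklinear lj); split=> [x y|| v x]; first exact: vI.
  apply/seteqP; split=> [_ [x _ <-]|y hy]; first exact: (subspP (x : U)).
  by exists (mksubsp (gr_subspace W 0) hy : U).
exact: deg0_actE.
Qed.

(** A submodule of the degree 0 part is the degree 0 part of the submodule that
    it generates. *)
Lemma deg0_irreducible : normalized W -> phi_irreducible W ->
  at_irreducible deg0_atmod.
Proof.
move=> nW [_ irr]; split.
  apply: contrapT => h; apply: nW; apply/seteqP; split=> [x hx|x ->]; last exact: gr0.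
  apply: contrapT => x0; apply: h; exists (mksubsp (gr_subspace W 0) hx : U) => e.
  by apply: x0; exact: (congr1 (@subsp_val _ _ _ _) (e : _ = 0 :> U)).
move=> S sS hS; pose T : set W := [set w | exists2 x : U, S x & w = subsp_val x].
have T0 x : T x -> gpm_gr 0 x by move=> [y _ ->]; exact: subspP.
have sT : subspace T.
  have [S0 SD] := sS; split; first by exists 0.
  move=> a _ _ [x Sx ->] [y Sy ->]; exists (a *: x + y) => //; exact: SD.
have mT v x : T x -> T (pmode v 0 x).
  move=> [y Sy ->]; exists (deg0_act (to_Atilde v) y); first exact: (hS (to_Atilde v)).
  by rewrite deg0_actE.
case: (irr _ (generated_graded T0)) => e; [left|right].
  apply/seteqP; split=> [x Sx|x ->]; last by case: sS.
  have /(generated_incl) : T (subsp_val (x : U)) by exists x.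
  by rewrite e => h; apply: vI.
apply/seteqP; split=> // x _.
have : generated T (subsp_val (x : U)) by rewrite e.
move/(generated_deg0 T0 sT mT (subspP (x : U))) => [y Sy h].
by have -> : x = y by exact: vI.
Qed.

End Degree0.

End GradedModules.

(** * Uniqueness: a module is determined by its degree 0 part *)

Section Uniqueness.
Variables (F : numFieldType) (V : vertexSuperalgebra F).

Definition swap_set (A B : Type) (G : set (A * B)) : set (B * A) :=
  [set w | G (w.2, w.1)].

Lemma graded_swap (W1 W2 : gradedPhiModule V) (G : set (W1 * W2)%type) :
  graded_submodule (G : set (prod_graded W1 W2)) ->
  graded_submodule (swap_set G : set (prod_graded W2 W1)).
Proof.
move=> [[G0 GD] Gm Gc]; split.
- by split=> [|a u v]; [exact: G0|exact: GD].
- by move=> v n w; exact: Gm.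
move=> N c hc GS i hi; apply: (Gc N (fun i => ((c i).2, (c i).1))) => // [j|].
  by have [] := hc j.
suff -> : \sum_(i < N) ((c i).2, (c i).1) =
  ((\sum_(i < N) (c i : (W2 * W1)%type)).2, (\sum_(i < N) (c i : (W2 * W1)%type)).1)
  :> (W1 * W2)%type by exact: GS.
apply: injective_projections => /=.
  rewrite (lin_sum (g := fun w : (W1 * W2)%type => w.1)) //.
  by rewrite (lin_sum (g := fun w : (W2 * W1)%type => w.2)).
rewrite (lin_sum (g := fun w : (W1 * W2)%type => w.2)) //.
by rewrite (lin_sum (g := fun w : (W2 * W1)%type => w.1)).
Qed.

(** The projection of [G] to [W1] is a nonzero graded submodule. *)
Lemma graph_total (W1 W2 : gradedPhiModule V) (G : set (W1 * W2)%type) :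
  phi_irreducible W1 -> graded_submodule (G : set (prod_graded W1 W2)) ->
  (exists x y, x <> 0 /\ G (x, y)) -> forall x, exists y, G (x, y).
Proof.
move=> [_ irr] [[G0 GD] Gm Gc] [x0 [y0 [x0N Gxy]]].
pose S : set W1 := [set x | exists y, G (x, y)].
suff /irr : graded_submodule S.
  case=> e x; last by have : S x by rewrite e.
  by case: x0N; have : S x0 by [exists y0]; rewrite e.
split.
- split=> [|a u v [y Gu] [z Gv]]; first by exists 0; exact: G0.
  by exists (a *: y + z); exact: (GD a _ _ Gu Gv).
- by move=> v n x [y /(Gm v n) h]; exists (pmode v n y).
move=> N c hc [y Gy] i hi.
have [M [d [hd ed]]] := gr_decomp y.
pose K := maxn N M.
pose e i : prod_graded W1 W2 := (if (i < N)%N then c i else 0, if (i < M)%N then d i else 0).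
have he j : gpm_gr j (e j).
  by split=> /=; case: ifP => _; try exact: gr0; [exact: hc|exact: hd].
have := Gc K e he; rewrite (_ : \sum_(i < K) e i = (\sum_(i < N) c i, y)).
  move=> /(_ Gy i) h; exists (if (i < M)%N then d i else 0).
  by have := h (leq_trans hi (leq_maxl _ _)); rewrite /e hi.
apply: injective_projections => /=.
  rewrite (lin_sum (g := fun w : (W1 * W2)%type => w.1)) //=.
  by rewrite sum_pad ?leq_maxl.
rewrite (lin_sum (g := fun w : (W1 * W2)%type => w.2)) //= sum_pad ?leq_maxr //.
Qed.

(** The vectors [y] with [(0, y)] in [G] form a proper graded submodule of [W2]. *)
Lemma graph_functional (W1 W2 : gradedPhiModule V) (G : set (W1 * W2)%type) :
  phi_irreducible W2 -> graded_submodule (G : set (prod_graded W1 W2)) ->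
  (exists y, ~ G (0, y)) -> forall y, G (0, y) -> y = 0.
Proof.
move=> [_ irr] [[G0 GD] Gm Gc] [y0 Gy0].
pose S : set W2 := [set y | G (0, y)].
suff /irr : graded_submodule S.
  case=> e y Gy; first by have : S y by []; rewrite e.
  by case: Gy0; have : S y0 by rewrite e.
split.
- split=> [|a u v Gu Gv]; first exact: G0.
  by have := GD a _ _ Gu Gv; rewrite -[_ + _]/(a *: 0 + 0, a *: u + v) scaler0 addr0.
- move=> v n y /(Gm v n).
  by rewrite -[pmode _ _ _]/(pmode v n 0, pmode v n y) (lin0 (@pmode_linearr _ _ W1 v n)).
move=> N c hc Gy i hi.
pose e i : prod_graded W1 W2 := (0, c i).
have he j : gpm_gr j (e j) by split=> /=; [exact: gr0|exact: hc].
apply: (Gc N e he _ i hi).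
suff -> : \sum_(i < N) e i = (0, \sum_(i < N) c i) :> (W1 * W2)%type by [].
apply: injective_projections => /=.
  by rewrite (lin_sum (g := fun w : (W1 * W2)%type => w.1)) //= big1.
by rewrite (lin_sum (g := fun w : (W1 * W2)%type => w.2)).
Qed.

(** If [x] has degree [n], then [G] contains [(0, z)] for the components [z] of [y]
    of other degrees. *)
Lemma graph_degree (W1 W2 : gradedPhiModule V) (G : set (W1 * W2)%type) n x y :
  graded_submodule (G : set (prod_graded W1 W2)) ->
  (forall y, G (0, y) -> y = 0) -> G (x, y) -> gpm_gr n x -> gpm_gr n y.
Proof.
move=> [_ _ Gc] Gf Gxy hx; have [M [d [hd ed]]] := gr_decomp y.
pose K := maxn n.+1 M.
pose e i : prod_graded W1 W2 := (if i == n then x else 0, if (i < M)%N then d i else 0).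
have he j : gpm_gr j (e j).
  split=> /=; first by case: eqP => [->|_] //; exact: gr0.
  by case: ifP => _; [exact: hd|exact: gr0].
have := Gc K e he; rewrite (_ : \sum_(i < K) e i = (x, y)); last first.
  apply: injective_projections => /=.
    by rewrite (lin_sum (g := fun w : (W1 * W2)%type => w.1)) //= sum_single ?leq_maxl.
  by rewrite (lin_sum (g := fun w : (W1 * W2)%type => w.2)) //= sum_pad ?leq_maxr.
move=> /(_ Gxy) h; have d0 i : (i < M)%N -> i != n -> d i = 0.
  move=> hi ni; have := h i (leq_trans hi (leq_maxr _ _)).
  by rewrite /e (negPf ni) hi => /Gf.
have -> : y = if (n < M)%N then d n else 0.
  rewrite ed; case: ltnP => hn.
    rewrite (bigD1 (Ordinal hn)) //= big1 => [|i hi]; first by rewrite addr0.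
    by apply: d0 => //; apply: contraNneq hi => e'; apply/eqP/val_inj.
  by rewrite big1 // => i _; apply: d0 => //; have := ltn_ord i; lia.
by case: ifP => _; [exact: hd|exact: gr0].
Qed.

(** The diagonal of [U * U] in degree 0 generates a submodule of [W1 * W2] that
    meets degree 0 in this diagonal, so that it is the graph of an isomorphism. *)
Lemma degree0_equivalent (W1 W2 : gradedPhiModule V) (U : AtModule V) :
  phi_irreducible W1 -> phi_irreducible W2 -> (exists x : U, x <> 0) ->
  degree0_module W1 U -> degree0_module W2 U -> phi_equivalent W1 W2.
Proof.
move=> irr1 irr2 [x0 x0N] [j1 [i1 r1 m1]] [j2 [i2 r2 m2]].
pose P := prod_graded W1 W2.
pose T : set P := [set w | exists x, w = (j1 x, j2 x)].
have T0 w : T w -> gpm_gr 0 w.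
  by move=> [x ->]; split=> /=; [rewrite -r1|rewrite -r2]; exists x.
have sT : subspace T.
  split; first by exists 0; rewrite !linear0.
  by move=> a _ _ [x ->] [y ->]; exists (a *: x + y); rewrite !linearP.
have mT v w : T w -> T (pmode v 0 w).
  by move=> [x ->]; exists (atact (to_Atilde v) x); rewrite m1 m2.
pose G : set (W1 * W2)%type := generated T.
have gG : graded_submodule (G : set P) := generated_graded T0.
have gG' := graded_swap gG.
have Gx x : G (j1 x, j2 x) by apply: generated_incl; exists x.
have j10 : j1 x0 <> 0 by move=> e; apply: x0N; apply: i1; rewrite e linear0.
have j20 : j2 x0 <> 0 by move=> e; apply: x0N; apply: i2; rewrite e linear0.
have T2 y : G (0, y) -> gpm_gr 0 y -> y = 0.
  move=> Gy hy; have [|x [e1 ->]] := generated_deg0 T0 sT mT (x := (0, y) : P) _ Gy.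
    by split=> //=; exact: gr0.
  by rewrite (i1 x 0) ?linear0.
have T1 x : G (x, 0) -> gpm_gr 0 x -> x = 0.
  move=> Gxx hx; have [|z [-> e2]] := generated_deg0 T0 sT mT (x := (x, 0) : P) _ Gxx.
    by split=> //=; exact: gr0.
  by rewrite (i2 z 0) ?linear0.
have tot1 := graph_total irr1 gG (ex_intro _ _ (ex_intro _ _ (conj j10 (Gx x0)))).
have tot2 : forall y, exists x, G (x, y).
  exact: (graph_total irr2 gG' (ex_intro _ _ (ex_intro _ (j1 x0) (conj j20 (Gx x0))))).
have f2 : forall y, G (0, y) -> y = 0.
  apply: (graph_functional irr2 gG); exists (j2 x0) => /T2 h; apply: j20.
  by apply: h; rewrite -r2; exists x0.
have f1 : forall x, G (x, 0) -> x = 0.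
  apply: (graph_functional irr1 gG'); exists (j1 x0) => /T1 h; apply: j10.
  by apply: h; rewrite -r1; exists x0.
have [[G0 GD] Gm _] := gG.
have /choice [psi hpsi] := tot1; have /choice [phi hphi] := tot2.
have GB x y x' y' : G (x, y) -> G (x', y') -> G (x - x', y - y').
  by move=> h h'; apply: (subspaceB (x := (x, y) : (W1 * W2)%type) (y := (x', y'))).
have psiE x y : G (x, y) -> psi x = y.
  by move=> h; apply: subr0_eq; apply: f2; rewrite -(subrr x); apply: GB.
have phiE x y : G (x, y) -> phi y = x.
  by move=> h; apply: subr0_eq; apply: f1; rewrite -(subrr y); apply: GB.
have lpsi : linear psi by move=> a x y; apply: psiE; exact: (GD a _ _ (hpsi x) (hpsi y)).
exists (mklinear lpsi), 0; split.
- by exists phi => x; [exact: phiE|exact: psiE].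
- by move=> v n x; apply: psiE; exact: (Gm v n _ (hpsi x)).
move=> n; rewrite addr0 /=; apply/seteqP; split=> [_ [x hx <-]|y hy].
  exact: (graph_degree gG f2 (hpsi x)).
exists (phi y); last exact: psiE.
exact: (graph_degree gG' f1 (hphi y)).
Qed.

End Uniqueness.

(** * Existence *)

Section Existence.
Variables (F : numFieldType) (V : vertexSuperalgebra F).

(** The values of [f] are the values at the vacuum of its images in degree 0. *)
Lemma ract_at_vacuum (X : lmodType F) n (f : V -> X) v : regular n f -> 0 <= n ->
  ract f n v n (vacuum V) = f v.
Proof.
move=> rf hn; have lf := regular_lin rf; rewrite /ract subrr.
rewrite -(@rcoef_uniq _ _ _ n f rf (vacuum V) v (fun p => if p == 0 then f v else 0) 0) //.
  by move=> p hp; rewrite ifN //; lia.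
move=> m; rewrite expres_vacuuml (linZ lf) lc_residue; last by lia.
rewrite /atinf (@zsum1 _ (n + 1 + m)) => [|i hi]; first by rewrite subrr.
by rewrite ifN ?scaler0 //; lia.
Qed.

Variable U : AtModule V.
Hypothesis irrU : at_irreducible U.

Let ll x : linear (fun a => atact a x : U) := @atact_linearl _ _ U x.
Let lr a : linear (@atact _ _ U a) := @atact_linearr _ _ U a.

(** In [induced] this is [v |-> v_[0] x]. *)
Definition matcoef (x : U) : V -> U := fun v => atact (to_Atilde v) x.

Lemma Otilde_vder (u : V) : Otilde (vder u).
Proof.
apply: span_incl; exists u, (vacuum V); rewrite zhu_res_expres.
rewrite /expres (@zsumE _ (-2) (-1)).
  have -> : zrange (-2) (-1) = [:: -2; -1] by [].
  rewrite big_cons big_seq1 lc_diag scale1r lc_residue //.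
  by rewrite bc_lt0 // scale0r addr0.
move=> i hi; case: (ltP i 0) => h; last by rewrite nprod_vacuumr ?scaler0.
by rewrite lc_lt ?scale0r //; lia.
Qed.

(** Integration by parts lowers [m], and multiplication by [t = 1 + (t-1)] raises
    [a]. *)
Lemma Otilde_expres (a m : int) (u v : V) : 1 <= a -> a + m < 0 -> Otilde (expres a m u v).
Proof.
have O0 := subspace_linear_span [set w | exists u v : V, w = zhu_res 2 u v].
have base (k : nat) u' : Otilde (expres 1 (- 2 - k%:Z) u' v).
  elim: k u' => [|k IHk] u'.
    by apply: span_incl; exists u', v; rewrite zhu_res_expres subr0.
  have := IHk (vder u'); rewrite expres_vder.
  rewrite expres_step (_ : - 2 - k%:Z - 1 = - 2 - k.+1%:Z); last by lia.
  rewrite (_ : - 2 - k.+1%:Z + 1 = - 2 - k%:Z); last by lia.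
  move/(subspaceN O0); rewrite opprK => h.
  have k0 : (- 2 - k%:Z)%:~R != 0 :> F by rewrite intr_eq0; lia.
  have h2 := subspaceB O0 h (subspaceZ 1%:~R O0 (IHk u')).
  rewrite addrAC subrr add0r in h2.
  have := subspaceZ (- 2 - k%:Z)%:~R^-1 O0 h2; rewrite scalerA mulVf // scale1r => h3.
  by have := subspaceB O0 h3 (IHk u'); rewrite addrK.
move=> ha hm; have [n en] : exists n : nat, a = 1 + n%:Z by exists (absz (a - 1)%R); lia.
elim: n a m en hm {ha} => [|n IHn] a m en hm.
  have [k ->] : exists k : nat, m = - 2 - k%:Z by exists (absz (m + 2)%R); lia.
  by rewrite en addr0.
rewrite (_ : a = (a - 1) + 1); last by lia.
rewrite expres_step; apply: subspaceD => //; apply: IHn; lia.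
Qed.

Lemma matcoef_regular x : regular 0 (matcoef x).
Proof.
have O0 v : Otilde v -> matcoef x v = 0.
  by move/to_Atilde_eq0; rewrite /matcoef => ->; exact: (lin0 (ll x)).
split; first split.
- by move=> k u v; rewrite /matcoef (@to_Atilde_linear _ V) ll.
- by move=> u; rewrite O0 ?oppr0 ?scale0r //; exact: Otilde_vder.
by move=> a m u v ha hm; apply: O0; apply: Otilde_expres => //; rewrite -[1]add0r.
Qed.

Let WF := fun_graded V U.

Definition embed0 (x : U) : WF :=
  mksubsp (@regfun_subspace _ V U) (single_regfun (matcoef_regular x)).

Lemma embed0E x k v : geval k v (embed0 x) = if k == 0 then matcoef x v else 0.
Proof. by rewrite /geval /= /single; case: eqP. Qed.

Lemma embed0_linear : linear embed0.
Proof.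
move=> a x y; apply: geval_inj => k v; rewrite (geval_linear k v) !embed0E.
by case: eqP => _; [exact: lr|rewrite scaler0 addr0].
Qed.

Lemma embed0_inj : injective embed0.
Proof.
move=> x y /(congr1 (geval 0 (vacuum V))); rewrite !embed0E eqxx /matcoef.
by rewrite !atact1.
Qed.

Lemma embed0_mode v x : pmode v 0 (embed0 x) = embed0 (atact (to_Atilde v) x).
Proof.
apply: geval_inj => k u; rewrite embed0E.
rewrite -[LHS]/(geval k u (gmode v 0 (embed0 x))) geval_mode addr0 /= /single.
case: eqP => [->|_]; last by apply: rcoef0.
rewrite /ract /rcoef /infcoef (@zsum1 _ 0) => [|i hi].
  rewrite [bp _ _ _]binz0 scale1r /matcoef -atactM.
  by rewrite /zhu_mul zhu_res_expres.
case: (ltP i 0) => h; first by rewrite bp_lt0 ?scale0r.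
by case: (matcoef_regular x) => _ ->; rewrite ?scaler0 //; lia.
Qed.

Let T : set WF := range embed0.

Lemma embed0_deg0 w : T w -> gpm_gr 0 w.
Proof.
move=> [x _ <-]; suff : @fun_gr _ V U 0 (embed0 x) by [].
by move=> k v hk; rewrite embed0E (negPf hk).
Qed.

Lemma T_subspace : subspace T.
Proof.
split; first by exists 0 => //; exact: (lin0 embed0_linear).
by move=> a _ _ [x _ <-] [y _ <-]; exists (a *: x + y) => //; exact: embed0_linear.
Qed.

Lemma T_mode v w : T w -> T (pmode v 0 w).
Proof. by move=> [x _ <-]; rewrite embed0_mode; exists (atact (to_Atilde v) x). Qed.

Definition induced : gradedPhiModule V := sub_graded (generated_graded embed0_deg0).

Lemma induced_deg0 (w : induced) : gpm_gr 0 w -> exists x, subsp_val w = embed0 x.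
Proof.
move=> hw; have := generated_deg0 embed0_deg0 T_subspace T_mode hw (subspP w).
by move=> [x _ e]; exists x.
Qed.

Lemma embed0_generated x : generated T (embed0 x).
Proof. by apply: generated_incl; exists x. Qed.

Definition embed_induced (x : U) : induced :=
  mksubsp _ (embed0_generated x).

Lemma induced_degree0 : degree0_module induced U.
Proof.
have lj : linear embed_induced.
  by move=> a x y; apply: subsp_val_inj; exact: embed0_linear.
exists (mklinear lj); split.
- by move=> x y /(congr1 (@subsp_val _ _ _ _)); exact: embed0_inj.
- apply/seteqP; split=> [_ [x _ <-]|w /induced_deg0 [x e]].
    by apply: embed0_deg0; exists x.
  by exists x => //; apply: subsp_val_inj; rewrite e.
by move=> v x; apply: subsp_val_inj; exact: esym (embed0_mode v x).
Qed.

(** A nonzero functional [f] of degree [n] has a nonzero value [f v], and [v_[n]]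
    maps it to the functional of degree 0 of the vector [f v]. *)
Lemma induced_irreducible : phi_irreducible induced.
Proof.
have [[x0 x0N] irr] := irrU.
have [J [iJ rJ mJ]] := induced_degree0.
split; first by exists (J x0) => e; apply: x0N; apply: iJ; rewrite e linear0.
move=> S gS; have [sS mS cS] := gS.
case: (pselect (exists2 w, S w & w <> 0)) => [[w Sw w0]|h]; [right|left]; last first.
  apply/seteqP; split=> [w Sw|w ->]; last by case: sS.
  by apply: contrapT => w0; apply: h; exists w.
have [n [y [Sy hy y0]]] : exists n y, [/\ S y, gpm_gr n y & y <> 0].
  have [N [c [hc e]]] := gr_decomp w.
  apply: contrapT => h; apply: w0; rewrite e big1 // => i _.
  apply: contrapT => ci0; apply: h; exists i, (c i); split=> //.
  by apply: (cS N) => //; rewrite -e.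
pose g : WF := subsp_val y.
have [v gv] : exists v, geval n%:Z v g <> 0.
  apply: contrapT => h; apply: y0; apply: subsp_val_inj; apply: geval_inj => k v.
  case: (eqVneq k n%:Z) => [->|hk]; last exact: (hy k v hk).
  by apply: contrapT => h2; apply: h; exists v.
pose z := pmode v n%:Z y.
have hz : gpm_gr 0 z by have := gpm_degree v n%:Z hy; rewrite subrr.
have [x ex] := induced_deg0 hz.
have xN : x <> 0.
  move=> x0'; apply: gv; have e := @ract_at_vacuum _ n%:Z _ v (gregular g n%:Z) isT.
  apply: etrans (esym e) _.
  have := congr1 (geval 0 (vacuum V)) ex; rewrite x0' (lin0 embed0_linear).
  by rewrite -[subsp_val z]/(gmode v n%:Z g) geval_mode add0r.
have Sx : S (embed_induced x).
  suff -> : embed_induced x = z by exact: mS.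
  by apply: subsp_val_inj; rewrite ex.
have SU : forall x, S (embed_induced x).
  have lj : linear embed_induced.
    by move=> a x1 x2; apply: subsp_val_inj; exact: embed0_linear.
  case: (irr [set x | S (embed_induced x)]).
  - split=> [|a x1 x2 h1 h2] /=; first by rewrite (lin0 lj); case: sS.
    by rewrite lj; case: sS => _; apply.
  - move=> a x1 /= h1; have [u <-] := to_Atilde_surj a.
    suff -> : embed_induced (atact (to_Atilde u) x1) = pmode u 0 (embed_induced x1).
      exact: mS.
    by apply: subsp_val_inj; exact: esym (embed0_mode u x1).
  - by move=> e; case: xN; have : [set x | S (embed_induced x)] x by []; rewrite e.
  - by move=> e x1; have : [set x | S (embed_induced x)] x1 by rewrite e.
apply/seteqP; split=> // w' _.
pose S' : set WF := [set g | exists2 w, S w & subsp_val w = g].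
suff [w2 Sw2 /subsp_val_inj <-] : S' (subsp_val w') by [].
apply: (@span_min _ _ (mode_image T) S') (subspP w').
  split; first by exists 0 => //; case: sS.
  move=> a _ _ [w1 h1 <-] [w2 h2 <-]; exists (a *: w1 + w2) => //.
  by case: sS => _; apply.
by move=> _ [u [m [_ [[x1 _ <-] ->]]]]; exists (pmode u m (embed_induced x1)) => //; exact: mS.
Qed.

End Existence.

(** * Equivalence of graded modules and normalization *)

Section Equivalence.
Variables (F : numFieldType) (V : vertexSuperalgebra F).

Lemma linear_inverse (A B : lmodType F) (f : {linear A -> B}) : bijective f ->
  exists g : {linear B -> A}, cancel f g /\ cancel g f.
Proof.
move=> [g fg gf]; have lg : linear g.
  by move=> a x y; apply: (can_inj fg); rewrite linearP !gf.
by exists (mklinear lg).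
Qed.

Lemma comp_linear (A B C : lmodType F) (g : {linear B -> C}) (f : {linear A -> B}) :
  linear (g \o f).
Proof. by move=> a x y /=; rewrite !linearP. Qed.

Lemma id_linear (A : lmodType F) : linear (@id A).
Proof. by []. Qed.

(** An equivalence shifting degrees by [k] also maps 0, the part of negative
    degree, to the part of degree below [k]: the images of the parts of
    nonnegative degree exhaust the target. *)
Lemma equivalence_intgrade (W1 W2 : gradedPhiModule V) (f : {linear W1 -> W2}) (k : int) :
  bijective f ->
  (forall n : nat, f @` @gpm_gr _ _ W1 n = intgrade (@gpm_gr _ _ W2) (n%:Z + k)) ->
  forall p, f @` intgrade (@gpm_gr _ _ W1) p = intgrade (@gpm_gr _ _ W2) (p + k).
Proof.
move=> bf gf [n|m]; first exact: gf.
have [g [fg gg]] := linear_inverse bf.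
rewrite image_set1 linear0; apply/seteqP; split=> [_ ->|y].
  by rewrite /intgrade; case: (_ + _) => // j; exact: gr0.
rewrite /intgrade; case e : (Negz m + k) => [n|//] hy.
have [N [c [hc ey]]] := gr_decomp (g y).
have /choice [d hd] : forall i, exists j : nat, gpm_gr j (f (c i)) /\ j != n.
  move=> i; have : intgrade (@gpm_gr _ _ W2) (i%:Z + k) (f (c i)) by rewrite -gf; exists (c i).
  rewrite /intgrade; case e' : (i%:Z + k) => [j|j] hj; first by exists j; split=> //; lia.
  by rewrite hj; exists n.+1; split; [exact: gr0|lia].
pose A : set W2 := [set w | exists i, w = f (c i)].
have hA x : A x -> exists j, gpm_gr j x by move=> [i ->]; exists (d i); case: (hd i).
have Ay : linear_span A y.
  rewrite -(gg y) ey linear_sum; apply: subspace_sum; first exact: subspace_linear_span.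
  by move=> i; apply: span_incl; exists i.
pose s i := if i == n then y else 0.
have hs i : gpm_gr i (s i) by rewrite /s; case: eqP => [->|_] //; exact: gr0.
have := @span_component _ _ _ A hA n.+1 s hs.
rewrite sum_single // => /(_ Ay n (ltnSn n)); rewrite /s eqxx.
apply: (@span_min _ _ _ [set 0]) => [|x [[i ->] hx]].
  by split=> // a u v -> ->; rewrite scaler0 addr0.
by have [h1 h2] := hd i; exact: gr_disjoint h1 hx h2.
Qed.

Lemma phi_equivalent_refl (W : gradedPhiModule V) : phi_equivalent W W.
Proof.
exists (mklinear (@id_linear W)), 0; split=> //; first by exists id.
by move=> n; rewrite addr0 /= image_id.
Qed.

Lemma phi_equivalent_sym (W1 W2 : gradedPhiModule V) :
  phi_equivalent W1 W2 -> phi_equivalent W2 W1.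
Proof.
move=> [f [k [bf mf gf]]]; have [g [fg gg]] := linear_inverse bf.
exists g, (- k); split.
- by exists f.
- by move=> v n w; apply: (can_inj fg); rewrite mf !gg.
move=> n; have := equivalence_intgrade bf gf (n%:Z - k); rewrite subrK /= => <-.
apply/seteqP; split=> [_ [_ [x hx <-] <-]|x hx]; first by rewrite fg.
by exists (f x); [exists x|rewrite fg].
Qed.

Lemma phi_equivalent_trans (W1 W2 W3 : gradedPhiModule V) :
  phi_equivalent W1 W2 -> phi_equivalent W2 W3 -> phi_equivalent W1 W3.
Proof.
move=> [f [k [bf mf gf]]] [g [l [bg mg gg]]].
exists (mklinear (comp_linear g f)), (k + l); split.
- exact: bij_comp bg bf.
- by move=> v n w /=; rewrite mf mg.
by move=> n; rewrite addrA -(equivalence_intgrade bg gg) -gf image_comp.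
Qed.

Lemma at_isomorphic_refl (U : AtModule V) : at_isomorphic U U.
Proof. by exists (mklinear (@id_linear U)); split=> //; exists id. Qed.

Lemma at_isomorphic_sym (U1 U2 : AtModule V) :
  at_isomorphic U1 U2 -> at_isomorphic U2 U1.
Proof.
move=> [f [bf mf]]; have [g [fg gg]] := linear_inverse bf.
exists g; split; first by exists f.
by move=> a x; apply: (can_inj fg); rewrite mf !gg.
Qed.

Lemma at_isomorphic_trans (U1 U2 U3 : AtModule V) :
  at_isomorphic U1 U2 -> at_isomorphic U2 U3 -> at_isomorphic U1 U3.
Proof.
move=> [f [bf mf]] [g [bg mg]]; exists (mklinear (comp_linear g f)); split.
  exact: bij_comp bg bf.
by move=> a x /=; rewrite mf mg.
Qed.

(** A shift by [k <> 0] would place the degree 0 part of one of the modules in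
    negative degrees of the other. *)
Lemma normalized_equivalence (W1 W2 : gradedPhiModule V) (f : {linear W1 -> W2}) k :
  bijective f ->
  (forall n : nat, f @` @gpm_gr _ _ W1 n = intgrade (@gpm_gr _ _ W2) (n%:Z + k)) ->
  normalized W1 -> normalized W2 -> k = 0.
Proof.
move=> bf gf n1 n2; have [g [fg gg]] := linear_inverse bf.
have gi := equivalence_intgrade bf gf.
case: (ltgtP k 0) => // hk.
  case: n1; apply/seteqP; split=> [x hx|x ->]; last exact: gr0.
  have := gi 0; rewrite add0r /intgrade /=; case: k hk {gf gi} => // k _ e.
  have : (f @` gpm_gr 0) (f x) by exists x.
  by rewrite e => /= h; apply: (can_inj fg); rewrite h linear0.
case: n2; apply/seteqP; split=> [y hy|y ->]; last exact: gr0.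
have := gi (- k); rewrite addNr /=; case: k hk {gf gi} => [[//|k]|//] _ e.
by move: hy; rewrite -e /= => -[x -> <-]; rewrite linear0.
Qed.

Lemma degree0_isomorphic (W1 W2 : gradedPhiModule V) (U1 U2 : AtModule V) :
  normalized W1 -> normalized W2 -> degree0_module W1 U1 -> degree0_module W2 U2 ->
  phi_equivalent W1 W2 -> at_isomorphic U1 U2.
Proof.
move=> n1 n2 [j1 [i1 r1 m1]] [j2 [i2 r2 m2]] [f [k [bf mf gf]]].
have k0 := normalized_equivalence bf gf n1 n2; rewrite k0 in gf.
have [g [fg gg]] := linear_inverse bf.
have /choice [p hp] : forall x, exists y, j2 y = f (j1 x).
  move=> x; have : (f @` gpm_gr 0) (f (j1 x)) by exists (j1 x) => //; rewrite -r1; exists x.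
  by rewrite gf addr0 /= -r2 => -[y _ <-]; exists y.
have /choice [q hq] : forall y, exists x, f (j1 x) = j2 y.
  move=> y; have : @gpm_gr _ _ W2 0 (j2 y) by rewrite -r2; exists y.
  by have := gf 0%N; rewrite addr0 /= => <- [w]; rewrite -r1 => -[x _ <-] e; exists x.
have lp : linear p by move=> a x y; apply: i2; rewrite hp !linearP !hp.
exists (mklinear lp); split.
  exists q => x /=; first by apply: i1; apply: (can_inj fg); rewrite hq hp.
  by apply: i2; rewrite hp hq.
move=> a x /=; have [v <-] := to_Atilde_surj a; apply: i2.
by rewrite hp m1 mf m2 hp.
Qed.

Lemma degree0_transport (W : gradedPhiModule V) (U1 U2 : AtModule V) :
  at_isomorphic U1 U2 -> degree0_module W U2 -> degree0_module W U1.
Proof.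
move=> [f [bf mf]] [j [ij rj mj]]; exists (mklinear (comp_linear j f)).
have [g fg gf] := bf; split.
- by apply: inj_comp => //; exact: can_inj fg.
- rewrite -rj; apply/seteqP; split=> [_ [x _ <-]|_ [y _ <-]]; first by exists (f x).
  by exists (g y) => //=; rewrite gf.
by move=> v x /=; rewrite mf mj.
Qed.

Section Shift.
Variables (W : gradedPhiModule V) (k : nat).
Hypothesis low : forall i, (i < k)%N -> @gpm_gr _ _ W i = [set 0].

Definition shift_gr (n : nat) : set W := gpm_gr (n + k).

Lemma sum_shift (N : nat) (c : nat -> W) : (forall i, gpm_gr i (c i)) ->
  \sum_(i < N) c i = \sum_(i < N - k) c (i + k)%N.
Proof.
move=> hc; have c0 i : (i < k)%N -> c i = 0.
  by move=> hi; have := hc i; rewrite low.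
case: (leqP N k) => hN.
  rewrite (_ : (N - k)%N = 0%N) ?big_ord0; last by lia.
  by rewrite big1 // => i _; apply: c0; have := ltn_ord i; lia.
have e : N = (k + (N - k))%N by lia.
rewrite [in LHS]e big_split_ord /= big1 ?add0r => [|i _]; last exact: c0.
by apply: eq_bigr => i _; rewrite addnC.
Qed.

Lemma shift_direct : direct_sum shift_gr.
Proof.
split=> [n|w|N c hc e i hi]; first exact: gr_subspace.
  have [N [c [hc ->]]] := gr_decomp w; exists (N - k)%N, (fun i => c (i + k)%N).
  by split=> [i|]; [exact: hc|exact: sum_shift].
pose d i := if (k <= i)%N then c (i - k)%N else 0.
have hd j : gpm_gr j (d j).
  by rewrite /d; case: ifP => h; [have := hc (j - k)%N; rewrite /shift_gr subnK|exact: gr0].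
have := @gr_uniq _ _ W (N + k) d hd; rewrite (sum_shift _ hd) addnK.
have dE j : d (j + k)%N = c j by rewrite /d leq_addl addnK.
under eq_bigr do rewrite dE.
by move=> /(_ e (i + k)%N); rewrite dE ltn_add2r; apply.
Qed.

Lemma shift_degree v (m : int) (n : nat) w :
  shift_gr n w -> intgrade shift_gr (n%:Z - m) (pmode v m w).
Proof.
move=> hw; have := gpm_degree v m hw; rewrite PoszD /shift_gr.
case e : (n%:Z - m) => [j|j].
  by rewrite (_ : n%:Z + k%:Z - m = (j + k)%N%:Z) //; lia.
rewrite /intgrade; case e' : (n%:Z + k%:Z - m) => [i|//] /=.
by rewrite low //; lia.
Qed.

Definition shifted : gradedPhiModule V := GradedPhiModule shift_direct shift_degree.

Lemma shifted_equivalent : phi_equivalent W shifted.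
Proof.
exists (mklinear (@id_linear W)), (- k%:Z); split=> //; first by exists id.
move=> n; rewrite /= image_id /intgrade; case e : (n%:Z - k%:Z) => [j|j].
  by rewrite /= /shift_gr; congr gpm_gr; lia.
by apply: low; lia.
Qed.

Lemma shifted_irreducible : phi_irreducible W -> phi_irreducible shifted.
Proof.
move=> [nz irr]; split=> // S [sS mS cS]; apply: irr; split=> // N c hc Sc i hi.
case: (ltnP i k) => hik; first by have := hc i; rewrite low // => ->; case: sS.
have := cS (N - k)%N (fun j => c (j + k)%N) (fun j => hc _).
rewrite -(sum_shift _ hc) => /(_ Sc (i - k)%N); rewrite subnK //; apply; lia.
Qed.

End Shift.

Lemma normalize (W : gradedPhiModule V) : phi_irreducible W ->
  exists W' : gradedPhiModule V,
    [/\ phi_irreducible W', phi_equivalent W W' & normalized W'].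
Proof.
move=> irr; have [[w w0] _] := irr.
have ex : exists n, `[< @gpm_gr _ _ W n <> [set 0] >].
  apply: contrapT => h; apply: w0; have [N [c [hc ->]]] := gr_decomp w.
  apply: big1 => i _; have : gpm_gr i (c i) by [].
  suff -> : @gpm_gr _ _ W i = [set 0] by [].
  by apply: contrapT => h'; apply: h; exists i; apply/asboolP.
pose k := ex_minn ex.
have low i : (i < k)%N -> @gpm_gr _ _ W i = [set 0].
  rewrite /k; case: ex_minnP => m _ hm hi; apply: contrapT => h'.
  by have := hm i (asboolT h'); lia.
exists (shifted low); split.
- exact: shifted_irreducible.
- exact: shifted_equivalent.
rewrite /normalized /= /shift_gr add0n /k.
by case: ex_minnP => m /asboolP.
Qed.

End Equivalence.

(** * The bijection of classes *)

Section Classes.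
Variables (T : Type) (E : T -> T -> Prop).
Hypotheses (Erefl : forall x, E x x) (Esym : forall x y, E x y -> E y x).
Hypothesis Etrans : forall x y z, E x y -> E y z -> E x z.

Lemma class_of_surj (C : classes E) : exists x, C = class_of E x.
Proof. by case: C => C [x e]; exists x; apply: eq_exist. Qed.

Lemma class_of_eq x y : class_of E x = class_of E y <-> E x y.
Proof.
split=> [/(congr1 sval) /= ->//|h]; apply: eq_exist; apply/funext => z.
apply/propext; split=> h'; last exact: Etrans h h'.
exact: Etrans (Esym h) h'.
Qed.

End Classes.

Theorem mainTheorem3 (R : realType) (V : vertexSuperalgebra R[i]) :
  (forall W : irrPhiModule V,
     exists W' : irrPhiModule V,
       irrPhi_equivalent W W' /\ normalized (sval W')) /\
  (exists f : classes (@irrPhi_equivalent _ V) -> classes (@irrAt_isomorphic _ V),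
     bijective f /\
     forall W : irrPhiModule V, normalized (sval W) ->
       exists U : irrAtModule V,
         degree0_module (sval W) (sval U) /\
         f (class_of (@irrPhi_equivalent _ V) W)
           = class_of (@irrAt_isomorphic _ V) U).
Proof.
have norm : forall W : irrPhiModule V, exists W' : irrPhiModule V,
    irrPhi_equivalent W W' /\ normalized (sval W').
  move=> [W irrW]; have [W' [irrW' eqW nW]] := normalize irrW.
  by exists (exist _ W' irrW').
split=> //.
have Prefl (W : irrPhiModule V) : irrPhi_equivalent W W by exact: phi_equivalent_refl.
have Psym (W1 W2 : irrPhiModule V) : irrPhi_equivalent W1 W2 -> irrPhi_equivalent W2 W1.
  exact: phi_equivalent_sym.
have Ptrans (W1 W2 W3 : irrPhiModule V) : irrPhi_equivalent W1 W2 ->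
    irrPhi_equivalent W2 W3 -> irrPhi_equivalent W1 W3.
  exact: phi_equivalent_trans.
have Arefl (U : irrAtModule V) : irrAt_isomorphic U U by exact: at_isomorphic_refl.
have Asym (U1 U2 : irrAtModule V) : irrAt_isomorphic U1 U2 -> irrAt_isomorphic U2 U1.
  exact: at_isomorphic_sym.
have Atrans (U1 U2 U3 : irrAtModule V) : irrAt_isomorphic U1 U2 ->
    irrAt_isomorphic U2 U3 -> irrAt_isomorphic U1 U3.
  exact: at_isomorphic_trans.
have Pcls := class_of_eq Prefl Psym Ptrans; have Acls := class_of_eq Arefl Asym Atrans.
pose rel (W : irrPhiModule V) (U : irrAtModule V) :=
  normalized (sval W) /\ degree0_module (sval W) (sval U).
have relP W : normalized (sval W) -> exists U, rel W U.
  case: W => W irrW nW; exists (exist _ (deg0_atmod W) (deg0_irreducible nW irrW)).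
  by split=> //; exact: deg0_atmodP.
have relS U : exists W, rel W U.
  case: U => U irrU; exists (exist _ (induced U) (induced_irreducible irrU)).
  split; last exact: induced_degree0.
  have [[x x0] _] := irrU; have [j [ij rj _]] := induced_degree0 U.
  have h : @gpm_gr _ _ (induced U) 0 (j x) by rewrite -rj; exists x.
  move=> e; apply: x0; apply: ij; rewrite linear0.
  by have {}e : @gpm_gr _ _ (induced U) 0 = [set 0] := e; rewrite e in h.
have relE W1 W2 U1 U2 : rel W1 U1 -> rel W2 U2 ->
    irrPhi_equivalent W1 W2 <-> irrAt_isomorphic U1 U2.
  move=> [n1 d1] [n2 d2]; split; first exact: degree0_isomorphic.
  move=> iso; apply: (degree0_equivalent (svalP W1) (svalP W2) _ d1).
    by case: (svalP U1).
  exact: degree0_transport iso d2.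
have /choice [f hf] : forall C : classes (@irrPhi_equivalent _ V),
    exists D : classes (@irrAt_isomorphic _ V), forall W U, rel W U ->
      C = class_of _ W -> D = class_of _ U.
  move=> C; have [W0 ->] := class_of_surj C; have [W [eW nW]] := norm W0.
  have [U rU] := relP W nW; exists (class_of _ U) => W' U' r' /Pcls eW'.
  by apply/Acls; apply/(relE _ _ _ _ rU r'); apply: Ptrans (Psym _ _ eW) eW'.
have fE W U : rel W U -> f (class_of _ W) = class_of _ U by move=> r; apply: hf r _.
have repr (C : classes (@irrPhi_equivalent _ V)) :
    exists W U, rel W U /\ C = class_of (@irrPhi_equivalent _ V) W.
  have [W0 ->] := class_of_surj C; have [W [eW nW]] := norm W0.
  by have [U rU] := relP W nW; exists W, U; split=> //; exact/Pcls.
exists f; split; last first.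
  by move=> W nW; have [U rU] := relP W nW; exists U; split; [case: rU|exact: fE].
have /choice [g hg] : forall D : classes (@irrAt_isomorphic _ V),
    exists C : classes (@irrPhi_equivalent _ V), f C = D.
  move=> D; have [U ->] := class_of_surj D; have [W rW] := relS U.
  by exists (class_of _ W); exact: fE.
exists g => // C; have : f (g (f C)) = f C by [].
have [W [U [r ->]]] := repr C; have [W' [U' [r' ->]]] := repr (g (f (class_of _ W))).
rewrite (fE _ _ r) (fE _ _ r') => /Acls iso.
by apply/Pcls; apply/(relE _ _ _ _ r' r).
Qed.
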